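(* For every integer $n\geq 2$ there exists a stable theory $T_n$ such that $T_n$ has $(k+1)$-existence and $k$-uniqueness for every $k\leq n$, but $T_n$ has neither $(n+2)$-existence nor $(n+1)$-uniqueness.
   Context: Let $T$ be a complete theory. Write $\operatorname{acl}(A)$ for the algebraic closure of $A$ in $T^{\mathrm{eq}}$. Let $\mathcal{C}_T$ be the category whose objects are algebraically closed (in $T^{\mathrm{eq}}$) substructures of models of $T$ and whose morphisms are elementary embeddings (restrictions of automorphisms of a monster model). For $m\in\mathbb{N}$ let $P(m)$ be the poset (viewed as a category with inclusions as morphisms) of all subsets of $\{1,\dots,m\}$ and $P(m)^-=P(m)\setminus\{\{1,\dots,m\}\}$. An $m$-amalgamation problem (over $\operatorname{acl}(\emptyset)$) is a functor $a:P(m)^-\to\mathcal{C}_T$ such that (i) $a(\emptyset)=\operatorname{acl}(\emptyset)$; (ii) whenever $s_1,s_2,s_3\in P(m)^-$ and $s_1\cap s_2\subseteq s_3$, the sets $a(s_1),a(s_2)$ (via the transition maps) are independent (in the sense of forking) over $a(s_1\cap s_2)$ within $a(s_3)$; (iii) $a(s)=\operatorname{acl}\{a(\{i\}): i\in s\}$ for every $s\in P(m)^-$. A solution of $a$ is a functor $\bar a:P(m)\to\mathcal{C}_T$ extending $a$ and satisfying (i)–(iii) for all $s\in P(m)$. $T$ has $m$-existence if every $m$-amalgamation problem has at least one solution, and $m$-uniqueness if every $m$-amalgamation problem has at most one solution up to isomorphism (of functors over $a$).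
   Formalization: k-uniqueness is claimed for every k ≤ n except k = 1, since 1-uniqueness as defined contradicts the failure of (n+1)-uniqueness; condition (ii) is read for s1, s2 ⊆ s3, where the transition maps into a(s3) exist. *)

(* Defs.v *)
From mathcomp Require Import all_boot.

Set Implicit Arguments.
Unset Strict Implicit.
Unset Printing Implicit Defensive.

(** First-order logic is many-sorted because T^eq is. *)

Record language := Language {
  sorts : Type;
  fsym : Type;
  far : fsym -> nat;
  fdom : forall f, 'I_(far f) -> sorts;
  fcod : fsym -> sorts;
  rsym : Type;
  rar : rsym -> nat;
  rdom : forall r, 'I_(rar r) -> sorts }.

Definition one_sorted (L : language) : Prop :=
  exists s0 : sorts L, forall s, s = s0.

(** A context is a type [X] of variables with a sort for each variable; terms
    and formulas in context [g] have their free variables in [X]. *)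
Definition scons (S X : Type) (s : S) (g : X -> S) (o : option X) : S :=
  if o is Some x then g x else s.

Definition scat (S X Y : Type) (g : X -> S) (h : Y -> S) (z : X + Y) : S :=
  match z with inl x => g x | inr y => h y end.

Inductive term (L : language) (X : Type) (g : X -> sorts L) : sorts L -> Type :=
| Var (x : X) : term g (g x)
| App (f : fsym L) (u : forall i, term g (fdom (f:=f) i)) : term g (fcod f).

Inductive formula (L : language) (X : Type) (g : X -> sorts L) : Type :=
| Equal (s : sorts L) (t u : term g s)
| Rel (r : rsym L) (u : forall i, term g (rdom (r:=r) i))
| Bot
| Imp (p q : formula g)
| All (s : sorts L) (p : formula (scons s g)).

(** Environments: tuples of elements of the family [M] with sorts [g]. *)
Definition env (S : Type) (M : S -> Type) (X : Type) (g : X -> S) : Type :=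
  forall x, M (g x).

Definition econs (S : Type) (M : S -> Type) (X : Type) (g : X -> S) (s : S)
    (d : M s) (v : env M g) : env M (scons s g) :=
  fun o => match o return M (scons s g o) with Some x => v x | None => d end.

Definition ecat (S : Type) (M : S -> Type) (X Y : Type) (g : X -> S)
    (h : Y -> S) (v : env M g) (w : env M h) : env M (scat g h) :=
  fun z => match z return M (scat g h z) with inl x => v x | inr y => w y end.

Record structure (L : language) := Structure {
  carrier :> sorts L -> Type;
  inhab : forall s, inhabited (carrier s);
  fint : forall f : fsym L, env carrier (fdom (f:=f)) -> carrier (fcod f);
  rint : forall r : rsym L, env carrier (rdom (r:=r)) -> Prop }.

Fixpoint eval (L : language) (M : structure L) (X : Type) (g : X -> sorts L)
    (v : env M g) (s : sorts L) (t : term g s) : M s :=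
  match t with
  | Var x => v x
  | App f u => fint (f:=f) (fun i => eval v (u i))
  end.

Fixpoint sat (L : language) (M : structure L) (X : Type) (g : X -> sorts L)
    (p : formula g) : env M g -> Prop :=
  match p with
  | Equal s t u => fun v => eval v t = eval v u
  | Rel r u => fun v => rint (r:=r) (fun i => eval v (u i))
  | Bot => fun _ => False
  | Imp p q => fun v => sat p v -> sat q v
  | All s p => fun v => forall d : M s, sat p (econs d v)
  end.

Definition sentence (L : language) : Type :=
  formula (fun x : void => match x return sorts L with end).

Definition holds (L : language) (M : structure L) (p : sentence L) : Prop :=
  sat (M:=M) p (fun x : void => match x with end).

Definition theory (L : language) : Type := sentence L -> Prop.

Definition model (L : language) (T : theory L) (M : structure L) : Prop :=
  forall p, T p -> holds M p.

Definition entails (L : language) (T : theory L) (p : sentence L) : Prop :=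
  forall M : structure L, model T M -> holds M p.

Definition complete (L : language) (T : theory L) : Prop :=
  (exists M : structure L, model T M) /\
  forall p : sentence L, entails T p \/ entails T (Imp p (Bot _)).

(** No formula has the order property. *)
Definition stable (L : language) (T : theory L) : Prop :=
  forall (n k : nat) (g : 'I_n -> sorts L) (h : 'I_k -> sorts L)
    (p : formula (scat g h)) (M : structure L), model T M ->
  ~ exists (a : nat -> env M g) (b : nat -> env M h),
      forall i j, sat p (ecat (a i) (b j)) <-> i < j.

Definition subfam (L : language) (M : structure L) : Type :=
  forall s, M s -> Prop.

Definition emptysub (L : language) (M : structure L) : subfam M :=
  fun _ _ => False.

Definition subunion (L : language) (M : structure L) (A B : subfam M) :
  subfam M := fun s x => A s x \/ B s x.

Definition env_in (L : language) (M : structure L) (A : subfam M) (X : Type)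
    (g : X -> sorts L) (v : env M g) : Prop :=
  forall x, A (g x) (v x).

Definition finite_pred (D : Type) (P : D -> Prop) : Prop :=
  exists (n : nat) (f : 'I_n -> D), forall d, P d -> exists i, d = f i.

Definition acl (L : language) (M : structure L) (A : subfam M) : subfam M :=
  fun s e => exists (n : nat) (h : 'I_n -> sorts L) (p : formula (scons s h))
    (b : env M h),
    [/\ env_in A b, sat p (econs e b)
      & finite_pred (fun d : M s => sat p (econs d b))].

Definition emap (L : language) (M N : structure L) (j : forall s, M s -> N s)
    (X : Type) (g : X -> sorts L) (v : env M g) : env N g :=
  fun x => j (g x) (v x).

Definition elementary (L : language) (M N : structure L)
    (j : forall s, M s -> N s) : Prop :=
  forall (X : finType) (g : X -> sorts L) (p : formula g) (v : env M g),
    sat p v <-> sat p (emap j v).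

Definition imsub (L : language) (M N : structure L) (j : forall s, M s -> N s)
    (A : subfam M) : subfam N :=
  fun s y => exists2 x, A s x & y = j s x.

Definition same_type (L : language) (M : structure L) (C : subfam M) (X : Type)
    (g : X -> sorts L) (b c : env M g) : Prop :=
  forall (q : nat) (h : 'I_q -> sorts L) (p : formula (scat g h)) (d : env M h),
    env_in C d -> (sat p (ecat b d) <-> sat p (ecat c d)).

(** In place of a monster model, witnesses are sought in elementary extensions
    of [M].  The formula p(x, b) divides over [C] when, for some [k], there is a
    sequence of realisations c_i of tp(b/C) such that {p(x, c_i) : i} is
    [k]-inconsistent. *)
Definition divides (L : language) (M : structure L) (C : subfam M) (n k : nat)
    (g : 'I_n -> sorts L) (h : 'I_k -> sorts L) (p : formula (scat g h))
    (b : env M h) : Prop :=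
  exists (N : structure L) (j : forall s, M s -> N s) (r : nat)
    (c : nat -> env N h),
    [/\ elementary j,
        forall i, same_type (imsub j C) (c i) (emap j b)
      & forall l : 'I_r -> nat, injective l ->
          ~ exists a : env N g, forall i, sat p (ecat a (c (l i)))].

(** The formula p(x, b) forks over [C] when it implies a finite disjunction of
    formulas q_i(x, c_i), each of which divides over [C]. *)
Definition forks (L : language) (M : structure L) (C : subfam M) (n k : nat)
    (g : 'I_n -> sorts L) (h : 'I_k -> sorts L) (p : formula (scat g h))
    (b : env M h) : Prop :=
  exists (N : structure L) (j : forall s, M s -> N s) (r : nat)
    (k' : 'I_r -> nat) (h' : forall i, 'I_(k' i) -> sorts L)
    (q : forall i, formula (scat g (h' i))) (c : forall i, env N (h' i)),
    [/\ elementary j,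
        forall i, divides (imsub j C) (q i) (c i)
      & forall a : env N g, sat p (ecat a (emap j b)) ->
          exists i, sat (q i) (ecat a (c i))].

(** [A] and [B] are independent over [C]: for every finite tuple [a] of [A],
    the type tp(a/B u C) does not fork over [C]. *)
Definition independent (L : language) (M : structure L) (C A B : subfam M) :
    Prop :=
  forall (n k : nat) (g : 'I_n -> sorts L) (h : 'I_k -> sorts L)
    (p : formula (scat g h)) (a : env M g) (b : env M h),
    env_in A a -> env_in (subunion B C) b -> sat p (ecat a b) ->
    ~ forks C p b.

Definition equivalence_on (D : Type) (R : D -> D -> Prop) : Prop :=
  [/\ forall x, R x x, forall x y, R x y -> R y x
    & forall x y z, R x y -> R y z -> R x z].

Definition frel_of (L : language) (M : structure L) (n : nat)
    (g : 'I_n -> sorts L) (p : formula (scat g g)) (a b : env M g) : Prop :=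
  sat p (ecat a b).

Record eqrel (L : language) (T : theory L) := EqRel {
  er_ar : nat;
  er_sort : 'I_er_ar -> sorts L;
  er_form : formula (scat er_sort er_sort);
  er_equiv : forall M : structure L, model T M ->
    equivalence_on (frel_of (M:=M) er_form) }.

(** The language of [T] with, for each E in [eqrel T], a new sort and a function
    symbol for the projection of tuples onto their E-classes. *)
Definition eq_language (L : language) (T : theory L) : language :=
  @Language
    (sorts L + eqrel T)
    (fsym L + eqrel T)
    (fun f => match f with inl f => far f | inr E => er_ar E end)
    (fun f => match f return
         'I_(match f with inl f => far f | inr E => er_ar E end) -> sorts L + eqrel T
       with
       | inl f => fun i => inl (fdom (f:=f) i)
       | inr E => fun i => inl (er_sort (e:=E) i)
       end)
    (fun f => match f with inl f => inl (fcod f) | inr E => inr E end)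
    (rsym L)
    (fun r => rar r)
    (fun r i => inl (rdom (r:=r) i)).

Definition eq_class (L : language) (M : structure L) (T : theory L)
    (E : eqrel T) (a : env M (er_sort (e:=E))) : env M (er_sort (e:=E)) -> Prop :=
  frel_of (er_form E) a.

Definition eq_carrier (L : language) (T : theory L) (M : structure L)
    (s : sorts (eq_language T)) : Type :=
  match s with
  | inl s => M s
  | inr E => {C : env M (er_sort (e:=E)) -> Prop | exists a, C = eq_class a}
  end.

Lemma env_inhab (L : language) (M : structure L) (n : nat)
    (g : 'I_n -> sorts L) : inhabited (env M g).
Proof.
elim: n g => [|n IH] g; first by split => -[].
have [a] := IH (fun i => g (lift ord0 i)).
have [d] := inhab M (g ord0).
split=> i; case: (unliftP ord0 i) => [j ->|->]; [exact: a | exact: d].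
Qed.

Lemma eq_inhab (L : language) (T : theory L) (M : structure L)
    (s : sorts (eq_language T)) : inhabited (eq_carrier M s).
Proof.
case: s => [s|E] /=; first exact: inhab.
have [a] := env_inhab M (er_sort (e:=E)).
by split; exists (eq_class a); exists a.
Qed.

(** M^eq *)
Definition eq_structure (L : language) (T : theory L) (M : structure L) :
    structure (eq_language T) :=
  @Structure (eq_language T)
    (@eq_carrier L T M)
    (@eq_inhab L T M)
    (fun f => match f return
         env (@eq_carrier L T M) (fdom (l:=eq_language T) (f:=f)) ->
         eq_carrier M (fcod (l:=eq_language T) f)
       with
       | inl f => fun v => fint (s0:=M) (f:=f) v
       | inr E => fun v => exist _ (eq_class (E:=E) v) (ex_intro _ v erefl)
       end)
    (fun r v => rint (s0:=M) (r:=r) v).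

(** Algebraically closed subsets of M^eq, for models [M] of [T]. *)
Record object (L : language) (T : theory L) := Object {
  ob_model : structure L;
  ob_modelP : model T ob_model;
  ob_set : subfam (eq_structure T ob_model);
  ob_closed : forall s (x : eq_structure T ob_model s), acl ob_set x -> ob_set x }.

Definition ob_eq (L : language) (T : theory L) (A : object T) :
  structure (eq_language T) := eq_structure T (ob_model A).

Definition points (L : language) (T : theory L) (A : object T)
    (s : sorts (eq_language T)) : Type :=
  {x : ob_eq A s | ob_set x}.

(** Elementary maps between the subsets, for the language of T^eq. *)
Record hom (L : language) (T : theory L) (A B : object T) := Hom {
  hom_fun :> forall s, points A s -> points B s;
  hom_elem : forall (X : finType) (g : X -> sorts (eq_language T))
    (p : formula g) (v : env (points A) g),
    sat (M:=ob_eq A) p (fun x => sval (v x)) <->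
    sat (M:=ob_eq B) p (fun x => sval (hom_fun (v x))) }.

Definition idhom (L : language) (T : theory L) (A : object T) : hom A A :=
  @Hom L T A A (fun s x => x) (fun X g p v => iff_refl _).

Definition hom_of_eq (L : language) (T : theory L) (A B : object T)
    (e : A = B) : hom A B :=
  match e in _ = C return hom A C with erefl => idhom A end.

Definition is_iso (L : language) (T : theory L) (A B : object T)
    (f : hom A B) : Prop :=
  exists g : hom B A, forall s, cancel (f s) (g s) /\ cancel (g s) (f s).

(** The image of a morphism, as a subset of the ambient M^eq of its target. *)
Definition hom_image (L : language) (T : theory L) (A B : object T)
    (f : hom A B) : subfam (ob_eq B) :=
  fun s y => exists x : points A s, y = sval (f s x).

(** The index set {1, ..., m} is represented by ['I_m]. *)

Definition P (m : nat) : {set {set 'I_m}} := [set: {set 'I_m}].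

Definition Pminus (m : nat) : {set {set 'I_m}} := P m :\ [set: 'I_m].

Record functor (L : language) (T : theory L) (m : nat)
    (D : {set {set 'I_m}}) := Functor {
  fobj :> forall s, s \in D -> object T;
  fmap : forall s t (hs : s \in D) (ht : t \in D), s \subset t ->
    hom (fobj hs) (fobj ht);
  fmap_id : forall s (hs : s \in D) (i : s \subset s) o (x : points (fobj hs) o),
    fmap hs hs i o x = x;
  fmap_comp : forall s t u (hs : s \in D) (ht : t \in D) (hu : u \in D)
    (i : s \subset t) (j : t \subset u) (k : s \subset u) o
    (x : points (fobj hs) o),
    fmap hs hu k o x = fmap ht hu j o (fmap hs ht i o x) }.

Definition restrict (L : language) (T : theory L) (m : nat)
    (b : functor T (P m)) : functor T (Pminus m) :=
  @Functor L T m (Pminus m)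
    (fun s _ => b s (in_setT s))
    (fun s t _ _ i => fmap b (in_setT s) (in_setT t) i)
    (fun s _ => @fmap_id L T m (P m) b s (in_setT s))
    (fun s t u _ _ _ =>
       @fmap_comp L T m (P m) b s t u (in_setT s) (in_setT t) (in_setT u)).

Definition same_subfam (L : language) (M : structure L) (A B : subfam M) :
  Prop := forall s x, A s x <-> B s x.

(** The sets a(s1) and a(s2) live in a(s3) only if s1 and s2 are subsets of s3,
    so condition (ii) is stated for such s1, s2, s3. *)
Record amalgamation (L : language) (T : theory L) (m : nat)
    (D : {set {set 'I_m}}) (a : functor T D) : Prop := Amalgamation {
  am_empty : forall h : set0 \in D,
    same_subfam (ob_set (o:=a set0 h)) (acl (@emptysub _ (ob_eq (a set0 h))));
  am_indep : forall s1 s2 s3 (h1 : s1 \in D) (h2 : s2 \in D) (h3 : s3 \in D)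
    (h12 : s1 :&: s2 \in D) (i1 : s1 \subset s3) (i2 : s2 \subset s3)
    (i12 : s1 :&: s2 \subset s3),
    independent (hom_image (fmap a h12 h3 i12)) (hom_image (fmap a h1 h3 i1))
      (hom_image (fmap a h2 h3 i2));
  am_gen : forall s (h : s \in D),
    same_subfam (ob_set (o:=a s h))
      (acl (M:=ob_eq (a s h)) (fun o y =>
         exists (i : 'I_m) (hi : [set i] \in D) (si : [set i] \subset s),
           hom_image (fmap a hi h si) y)) }.

Definition is_solution (L : language) (T : theory L) (m : nat)
    (a : functor T (Pminus m)) (b : functor T (P m)) : Prop :=
  restrict b = a /\ amalgamation b.

Definition fobj_eq (L : language) (T : theory L) (m : nat)
    (D : {set {set 'I_m}}) (a b : functor T D) (e : a = b) s (h : s \in D) :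
  a s h = b s h := f_equal (fun c : functor T D => c s h) e.

(** Isomorphism of extensions of [a]: a natural isomorphism which is the
    identity of a(s) for every proper subset s. *)
Definition iso_over (L : language) (T : theory L) (m : nat)
    (a : functor T (Pminus m)) (b c : functor T (P m))
    (eb : restrict b = a) (ec : restrict c = a) : Prop :=
  exists eta : forall s (h : s \in P m), hom (b s h) (c s h),
    [/\ forall s h, is_iso (eta s h),
        forall s t (hs : s \in P m) (ht : t \in P m) (i : s \subset t) o
          (x : points (b s hs) o),
          eta t ht o (fmap b hs ht i o x) = fmap c hs ht i o (eta s hs o x)
      & forall s (h : s \in Pminus m) o (x : points (b s (in_setT s)) o),
          hom_of_eq (fobj_eq ec h) o (eta s (in_setT s) o x) =
          hom_of_eq (fobj_eq eb h) o x].

Definition has_existence (L : language) (T : theory L) (m : nat) : Prop :=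
  forall a : functor T (Pminus m), amalgamation a ->
    exists b : functor T (P m), is_solution a b.

(** [has_uniqueness T 1] fails as soon as acl(emptyset) is a proper subset of some
    M^eq: the image of the nonempty index can be acl(emptyset) or all of M^eq. *)
Definition has_uniqueness (L : language) (T : theory L) (m : nat) : Prop :=
  forall a : functor T (Pminus m), amalgamation a ->
  forall (b c : functor T (P m)) (eb : restrict b = a) (ec : restrict c = a),
    amalgamation b -> amalgamation c -> iso_over eb ec.

(* Main.v *)
Require Import Defs.
From mathcomp Require Import all_boot.
From mathcomp Require Import boolp.

(** The theory is that of the trivial double cover of [Om]^n for an infinite
    set [Om]: its elements are the pairs (t, b) of an n-tuple of points and a
    bit; [E_ij] compares coordinates, and [R] holds of n+1 elements over the
    faces of an (n+1)-tuple whose bits add up to 0.  An automorphism is a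
    permutation of [Om] together with a mod 2 cocycle on n-tuples, degenerate
    tuples included; these cocycles are coboundaries, hence every model is of
    the form above.

    A set which is algebraically closed in T^eq is determined by the set [S] of
    its points, and an elementary map from it is an injection of [S] together
    with a cocycle on [S]^n.  An m-amalgamation problem is thus a set of points
    cut into m parts, with compatible cocycles on the tuples that avoid at least
    one part.  Such tuples form a simplicial set with the homotopy type of the
    boundary of an (m-1)-simplex (or of a point, if a part is empty).
    Uniqueness holds when its cohomology vanishes in degree n-1, and existence
    when it vanishes in degree n; so the first failures occur for m = n+1 and
    m = n+2. *)

Set Implicit Arguments.
Unset Strict Implicit.
Unset Printing Implicit Defensive.

(** * First-order logic *)

(** The notions of the theorem quantify over all formulas, models and imaginaries, yet no quantifier
    elimination is proved: everything goes through automorphisms. The orbit of a finite tuple of a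
    standard model is defined by one formula, since such a tuple is a pattern inside the trivial
    cover of a finite set; hence types are orbits. Embeddings of standard models are elementary
    because there are enough automorphisms over finitely many parameters. Every imaginary has a
    least finite support, which turns algebraic closure, independence and elementary maps into
    statements on vertices and cocycles. All primitives of cocycles come from one operator, the cone
    [w => c (o :: w)]: over F_2 it needs no signs, and no condition on [o] since simplices may
    repeat vertices, which is what the degenerate tuples are for. A simplex is a list, so dimension
    d is length d+1, and a function on n-tuples is a cochain of degree n-1. *)

Definition castS (S : Type) (M : S -> Type) (s s' : S) (e : s = s') (x : M s) :
    M s' :=
  match e in _ = z return M z with erefl => x end.

Lemma castS_id (S : Type) (M : S -> Type) (s : S) (e : s = s) (x : M s) :
  castS e x = x.
Proof. by rewrite (Prop_irrelevance e erefl). Qed.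

Lemma env_ext (S : Type) (M : S -> Type) (X : Type) (g : X -> S)
  (v w : env M g) : (forall x, v x = w x) -> v = w.
Proof. exact: functional_extensionality_dep. Qed.

(** The sort of a renamed variable agrees with the old one only up to the proof [hg], hence the
    transport. *)
Definition precomp (S : Type) (M : S -> Type) (X Y : Type) (g : X -> S)
    (h : Y -> S) (r : X -> Y) (hg : forall x, h (r x) = g x) (v : env M h) :
    env M g :=
  fun x => castS (hg x) (v (r x)).

Lemma term_rename (L : language) (X Y : Type) (g : X -> sorts L)
  (h : Y -> sorts L) (r : X -> Y) (hg : forall x, h (r x) = g x) s
  (t : term g s) :
  exists t' : term h s, forall (M : structure L) (v : env M h),
    eval v t' = eval (precomp hg v) t.
Proof.
elim: t => [x|f u IH].
  exists (castS (M := term h) (hg x) (Var h (r x))) => M v /=.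
  by rewrite /precomp; case: _ / (hg x).
pose u' i := projT1 (cid (IH i)).
exists (App u') => M v /=; congr (fint _); apply: env_ext => i.
exact: projT2 (cid (IH i)) M v.
Qed.

(** Mere existence of a formula with the right meaning is enough and spares a theory of substitution
    for dependently sorted syntax. *)
Lemma formula_rename (L : language) (X : Type) (g : X -> sorts L)
  (p : formula g) :
  forall (Y : Type) (h : Y -> sorts L) (r : X -> Y)
    (hg : forall x, h (r x) = g x),
  exists p' : formula h, forall (M : structure L) (v : env M h),
    sat p' v <-> sat p (precomp hg v).
Proof.
elim: p => {X g} [X g s t u|X g q u|X g|X g p IHp q IHq|X g s p IH] Y h r hg.
- have [t' Et] := term_rename hg t; have [u' Eu] := term_rename hg u.
  by exists (Equal t' u') => M v /=; rewrite Et Eu.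
- pose u' i := projT1 (cid (term_rename hg (u i))).
  exists (Rel u') => M v /=; rewrite (_ : (fun _ => _) =
    fun i => eval (precomp hg v) (u i)) //.
  by apply: env_ext => i; apply: (projT2 (cid (term_rename hg (u i)))).
- by exists (Bot _).
- have [p' Ep] := IHp _ _ _ hg; have [q' Eq] := IHq _ _ _ hg.
  by exists (Imp p' q') => M v /=; rewrite Ep Eq.
- pose hg' o : scons s h (omap r o) = scons s g o :=
    match o with Some x => hg x | None => erefl end.
  have [p' Ep] := IH _ _ _ hg'.
  exists (All p') => M v /=.
  have E d : precomp hg' (econs d v) = econs d (precomp hg v).
    by apply: env_ext => -[].
  by split=> H d; [rewrite -E -Ep | rewrite Ep E].
Qed.

Record embedding (L : language) (M N : structure L)
    (j : forall s, M s -> N s) : Prop := Embedding {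
  emb_inj : forall s, injective (j s);
  emb_fint : forall (f : Defs.fsym L) (v : env M (fdom (f:=f))),
    j _ (fint (f:=f) v) = fint (f:=f) (emap j v);
  emb_rint : forall (r : rsym L) (v : env M (rdom (r:=r))),
    rint (r:=r) v <-> rint (r:=r) (emap j v) }.

Record iso (L : language) (M N : structure L) := Iso {
  iso_fun :> forall s, M s -> N s;
  iso_inv : forall s, N s -> M s;
  iso_funK : forall s, cancel (iso_fun (s:=s)) (iso_inv (s:=s));
  iso_invK : forall s, cancel (iso_inv (s:=s)) (iso_fun (s:=s));
  iso_emb : embedding iso_fun }.

Lemma eval_emb (L : language) (M N : structure L) (j : forall s, M s -> N s)
  (hj : embedding j) (X : Type) (g : X -> sorts L) (v : env M g) s
  (t : term g s) : eval (emap j v) t = j s (eval v t).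
Proof.
elim: t => [x|f u IH] //=.
by rewrite (emb_fint hj); congr (fint _); apply: env_ext => i; rewrite IH.
Qed.

Lemma emap_econs (L : language) (M N : structure L) (j : forall s, M s -> N s)
  (X : Type) (g : X -> sorts L) (s : sorts L) (d : M s) (v : env M g) :
  emap j (econs d v) = econs (j s d) (emap j v).
Proof. by apply: env_ext => -[]. Qed.

Lemma emap_ecat (L : language) (M N : structure L) (j : forall s, M s -> N s)
  (X Y : Type) (g : X -> sorts L) (h : Y -> sorts L) (v : env M g)
  (w : env M h) :
  emap j (ecat v w) = ecat (emap j v) (emap j w).
Proof. by apply: env_ext => -[]. Qed.

Lemma sat_equal_emb (L : language) (M N : structure L)
  (j : forall s, M s -> N s) (hj : embedding j) (X : Type) (g : X -> sorts L)
  s (t u : term g s) (v : env M g) :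
  sat (Equal t u) v <-> sat (Equal t u) (emap j v).
Proof. by rewrite /= !(eval_emb hj); split=> [->|/(emb_inj hj)]. Qed.

Lemma sat_rel_emb (L : language) (M N : structure L)
  (j : forall s, M s -> N s) (hj : embedding j) (X : Type) (g : X -> sorts L)
  (r : rsym L) (u : forall i, term g (rdom (r:=r) i)) (v : env M g) :
  sat (Rel u) v <-> sat (Rel u) (emap j v).
Proof.
rewrite /= (emb_rint hj) (_ : emap j _ = fun i => eval (emap j v) (u i)) //.
by apply: env_ext => i; rewrite (eval_emb hj).
Qed.

Lemma sat_iso (L : language) (M N : structure L) (j : iso M N) (X : Type)
  (g : X -> sorts L) (p : formula g) (v : env M g) :
  sat p v <-> sat p (emap j v).
Proof.
elim: p v => {X g} [X g s t u|X g q u|X g|X g p IHp q IHq|X g s p IH] v.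
- exact: sat_equal_emb (iso_emb j) _ _ _ _ _ _.
- exact: sat_rel_emb (iso_emb j) _ _ _ _ _.
- by [].
- by rewrite /= IHp IHq.
- split=> /= H d; last by rewrite IH emap_econs.
  by have := H (iso_inv j d); rewrite IH emap_econs iso_invK.
Qed.

Lemma elementary_iso (L : language) (M N : structure L) (j : iso M N) :
  elementary j.
Proof. by move=> X g p v; apply: sat_iso. Qed.

Lemma elementary_comp (L : language) (M N K : structure L)
  (j : forall s, M s -> N s) (k : forall s, N s -> K s) :
  elementary j -> elementary k -> elementary (fun s x => k s (j s x)).
Proof. by move=> hj hk X g p v; rewrite hj hk. Qed.

Lemma elementary_id (L : language) (M : structure L) :
  elementary (fun s (x : M s) => x).
Proof. by []. Qed.

Lemma iso_sym_emb (L : language) (M N : structure L) (j : iso M N) :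
  embedding (iso_inv j).
Proof.
have E X (g : X -> sorts L) (v : env N g) : emap j (emap (iso_inv j) v) = v.
  by apply: env_ext => x; apply: iso_invK.
split=> [s|f v|r v]; first exact: can_inj (@iso_invK _ _ _ j s).
  by rewrite -[in LHS](E _ _ v) -(emb_fint (iso_emb j)) iso_funK.
by rewrite (emb_rint (iso_emb j)) E.
Qed.

Definition iso_sym (L : language) (M N : structure L) (j : iso M N) : iso N M :=
  Iso (@iso_invK _ _ _ j) (@iso_funK _ _ _ j) (iso_sym_emb j).

Lemma iso_comp_emb (L : language) (M N K : structure L) (j : iso M N)
  (k : iso N K) : embedding (fun s x => k s (j s x)).
Proof.
split=> [s x y /(emb_inj (iso_emb k)) /(emb_inj (iso_emb j)) //|f v|r v].
  by rewrite (emb_fint (iso_emb j)) (emb_fint (iso_emb k)).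
by rewrite (emb_rint (iso_emb j)) (emb_rint (iso_emb k)).
Qed.

Definition iso_comp (L : language) (M N K : structure L) (j : iso M N)
    (k : iso N K) : iso M K.
Proof.
refine (@Iso _ _ _ (fun s x => k s (j s x))
  (fun s x => iso_inv j (iso_inv k x)) _ _ (iso_comp_emb j k)) => s x.
  by rewrite !iso_funK.
by rewrite !iso_invK.
Defined.

Definition finite_type (X : Type) : Prop := finite_pred (fun _ : X => True).

Lemma finite_type_option (X : Type) : finite_type X -> finite_type (option X).
Proof.
move=> [k [f fP]]; exists k.+1.
exists (fun i => if unlift ord0 i is Some j then Some (f j) else None).
move=> [x|] _; last by exists ord0; rewrite unlift_none.
by have [i ->] := fP x I; exists (lift ord0 i); rewrite liftK.
Qed.

Lemma finite_type_finType (X : finType) : finite_type X.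
Proof.
by exists #|X|, enum_val => x _; exists (enum_rank x); rewrite enum_rankK.
Qed.

(** The Tarski-Vaught test, with an automorphism of [N] over the parameters
    that moves the witness into the image. *)
Lemma elementary_by_autos (L : language) (M N : structure L)
  (j : forall s, M s -> N s) (hj : embedding j)
  (H : forall (X : Type) (g : X -> sorts L) (v : env M g) s (d : N s),
     finite_type X ->
     exists2 psi : iso N N, forall x, psi _ (j _ (v x)) = j _ (v x) &
       exists d0, psi s d = j s d0) :
  elementary j.
Proof.
suff: forall X (g : X -> sorts L) (p : formula g), finite_type X ->
    forall v : env M g, sat p v <-> sat p (emap j v).
  by move=> K X g p v; apply: K; apply: finite_type_finType.
move=> X g; elim=> {X g} [X g s t u|X g q u|X g|X g p IHp q IHq|X g s p IH] fX v.
- exact: sat_equal_emb hj _ _ _ _ _ _.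
- exact: sat_rel_emb hj _ _ _ _ _.
- by [].
- by rewrite /= IHp // IHq.
split=> /= K d; last by rewrite (IH (finite_type_option fX)) emap_econs.
have [psi psi_v [d0 Ed]] := H _ _ v s d fX.
have := K d0; rewrite (IH (finite_type_option fX)) emap_econs -Ed.
rewrite (sat_iso psi _ (econs d _)) emap_econs.
by rewrite (_ : emap psi (emap j v) = emap j v) //; apply: env_ext.
Qed.

(** Definability uniform in all structures. Formulas are rarely written out: they exist by closure
    properties, and sentences are transferred between models through the predicates they define. *)
Definition fdef (L : language) (X : Type) (g : X -> sorts L)
    (D : forall M : structure L, env M g -> Prop) : Prop :=
  exists p : formula g, forall (M : structure L) v, sat p v <-> D M v.

Section Definability.
Variable L : language.

Lemma fdef_ext (X : Type) (g : X -> sorts L) D D' :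
  (forall M v, D M v <-> D' M v) -> @fdef L X g D -> fdef (g:=g) D'.
Proof. by move=> E [p Ep]; exists p => M v; rewrite Ep E. Qed.

Lemma fdef_ren (X Y : Type) (g : X -> sorts L) (h : Y -> sorts L) (r : X -> Y)
  (hg : forall x, h (r x) = g x) D :
  @fdef L X g D -> fdef (g:=h) (fun M v => D M (precomp hg v)).
Proof.
move=> [p Ep]; have [p' Ep'] := formula_rename p hg.
by exists p' => M v; rewrite Ep' Ep.
Qed.

Lemma fdef_eq (X : Type) (g : X -> sorts L) s (t u : term g s) :
  fdef (g:=g) (fun M v => eval v t = eval v u).
Proof. by exists (Equal t u). Qed.

Lemma fdef_rel (X : Type) (g : X -> sorts L) r
  (u : forall i, term g (rdom (r:=r) i)) :
  fdef (g:=g) (fun M v => rint (r:=r) (fun i => eval v (u i))).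
Proof. by exists (Rel u). Qed.

Lemma fdef_imp (X : Type) (g : X -> sorts L) D1 D2 :
  @fdef L X g D1 -> @fdef L X g D2 -> fdef (g:=g) (fun M v => D1 M v -> D2 M v).
Proof. by move=> [p Ep] [q Eq]; exists (Imp p q) => M v /=; rewrite Ep Eq. Qed.

Lemma fdef_const (X : Type) (g : X -> sorts L) (P : Prop) :
  fdef (g:=g) (fun _ _ => P).
Proof.
have [hP|hP] := pselect P; last by exists (Bot g) => M v /=; split.
by exists (Imp (Bot g) (Bot g)) => M v /=; split.
Qed.

Lemma fdef_not (X : Type) (g : X -> sorts L) D :
  @fdef L X g D -> fdef (g:=g) (fun M v => ~ D M v).
Proof. by move=> hD; apply: fdef_imp hD (fdef_const _ False). Qed.

Lemma fdef_and (X : Type) (g : X -> sorts L) D1 D2 :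
  @fdef L X g D1 -> @fdef L X g D2 -> fdef (g:=g) (fun M v => D1 M v /\ D2 M v).
Proof.
move=> h1 h2; apply: fdef_ext (fdef_not (fdef_imp h1 (fdef_not h2))) => M v.
split=> [H|[a b] /(_ a)//]; split; apply: contrapT => K; apply: H.
  by move/K.
by move=> _ /K.
Qed.

Lemma fdef_or (X : Type) (g : X -> sorts L) D1 D2 :
  @fdef L X g D1 -> @fdef L X g D2 -> fdef (g:=g) (fun M v => D1 M v \/ D2 M v).
Proof.
move=> h1 h2; apply: fdef_ext (fdef_imp (fdef_not h1) h2) => M v.
by split=> [H|[]//]; have [?|/H] := pselect (D1 M v); [left|right].
Qed.

Lemma fdef_iff (X : Type) (g : X -> sorts L) D1 D2 :
  @fdef L X g D1 -> @fdef L X g D2 -> fdef (g:=g) (fun M v => D1 M v <-> D2 M v).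
Proof. by move=> h1 h2; apply: fdef_and; apply: fdef_imp. Qed.

Lemma fdef_all (X : Type) (g : X -> sorts L) s D :
  @fdef L (option X) (scons s g) D ->
  fdef (g:=g) (fun M v => forall d : M s, D M (econs d v)).
Proof.
by move=> [p Ep]; exists (All p) => M v /=; split=> H d; apply/Ep/H.
Qed.

Lemma fdef_fin (X : Type) (g : X -> sorts L) (Y : Type)
  (D : Y -> forall M : structure L, env M g -> Prop) :
  finite_type Y -> (forall i, fdef (g:=g) (D i)) ->
  fdef (g:=g) (fun M v => forall i, D i M v).
Proof.
move=> [k [f fP]] H.
apply: (@fdef_ext _ _ (fun M v => forall i, D (f i) M v)).
  by move=> M v; split=> // K y; have [i ->] := fP y I.
elim: k f {fP} => [|k IH] f.
  by apply: fdef_ext (fdef_const _ True) => M v; split=> // _ [].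
have := IH (fun i => f (lift ord0 i)) => /(fdef_and (H (f ord0))).
apply: fdef_ext => M v; split=> [[H0 H1] i|K]; last by split.
by case: (unliftP ord0 i) => [j|] ->.
Qed.

(** Induction on the length of the quantified tuple: its first variable moves into the context,
    where [fdef_all] binds it. *)
Lemma fdef_allenv_ord k : forall (h : 'I_k -> sorts L) (X : Type)
  (g : X -> sorts L) D,
  @fdef L (X + 'I_k) (scat g h) D ->
  fdef (g:=g) (fun M v => forall w : env M h, D M (ecat v w)).
Proof.
elim: k => [|k IH] h X g D hD.
  pose r (z : X + 'I_0) := match z with inl x => x
    | inr (Ordinal m hm) => match notF hm return X with end end.
  have hr z : g (r z) = scat g h z by case: z => [x|[]].
  apply: fdef_ext (fdef_ren hr hD) => M v; split=> [H w|H].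
    suff <- : precomp hr v = ecat v w by [].
    by apply: env_ext => -[x|[]//]; apply: castS_id.
  have w : env M h by case.
  suff -> : precomp hr v = ecat v w by [].
  by apply: env_ext => -[x|[]//]; apply: castS_id.
pose s := h ord0; pose h' i := h (lift ord0 i).
pose r (z : X + 'I_k.+1) : option X + 'I_k := match z with inl x => inl (Some x)
  | inr i => if unlift ord0 i is Some j then inr j else inl None end.
have hr z : scat (scons s g) h' (r z) = scat g h z.
  by case: z => [x|i] //=; case: (unliftP ord0 i) => [j|] ->.
apply: fdef_ext (fdef_all (IH h' _ (scons s g) _ (fdef_ren hr hD))) => M v.
have E (w : env M h) : precomp hr (ecat (econs (w ord0) v)
    (fun i => w (lift ord0 i))) = ecat v w.
  have rl j : r (inr (lift ord0 j)) = inr j by rewrite /r liftK.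
  have r0 : r (inr ord0) = inl None by rewrite /r unlift_none.
  apply: env_ext => -[x|i]; rewrite /precomp.
    by move: (hr (inl x)) => /= e; rewrite castS_id.
  case: (unliftP ord0 i) => [j|] ->.
    by move: (hr (inr (lift ord0 j))); rewrite rl => /= e; rewrite castS_id.
  by move: (hr (inr ord0)); rewrite r0 => /= e; rewrite castS_id.
split=> [H w|H d w]; first by rewrite -E.
(* The sort of a component depends on its index, so the tuple with head [d] and tail [w] is
   assembled by transport along [unliftP]. *)
have [w' [<- Ew]] : exists w' : env M h, w' ord0 = d /\
    forall i, w' (lift ord0 i) = w i.
  exists (fun i => match unliftP ord0 i in unlift_spec _ _ o return M (h i) with
    | UnliftSome j e => castS (M:=fun i => M (h i)) (esym e) (w j)
    | UnliftNone e => castS (M:=fun i => M (h i)) (esym e) d end).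
  split=> [|i].
    case: (unliftP ord0 ord0) => [j e|e]; last first.
      exact: (castS_id (M:=fun i => M (h i))).
    by case/negP: (neq_lift ord0 j); apply/eqP.
  case: (unliftP ord0 (lift ord0 i)) => [j e|e].
    by have ej := lift_inj e; move: e; rewrite -ej => e; exact: (castS_id (M:=fun i => M (h i))).
  by case/negP: (neq_lift ord0 i); apply/eqP.
have -> : w = fun i => w' (lift ord0 i) by apply: env_ext => i; rewrite Ew.
by rewrite E; apply: H.
Qed.

Lemma fdef_allenv (Y : finType) (h : Y -> sorts L) (X : Type)
  (g : X -> sorts L) D :
  @fdef L (X + Y) (scat g h) D ->
  fdef (g:=g) (fun M v => forall w : env M h, D M (ecat v w)).
Proof.
move=> hD.
pose h' (i : 'I_#|Y|) := h (enum_val i).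
pose r (z : X + Y) : X + 'I_#|Y| :=
  match z with inl x => inl x | inr y => inr (enum_rank y) end.
have hr z : scat g h' (r z) = scat g h z.
  by case: z => [x|y] //=; rewrite /h' enum_rankK.
apply: fdef_ext (fdef_allenv_ord (fdef_ren hr hD)) => M v.
have E (w : env M h) : precomp hr (ecat v (fun i => w (enum_val i))) = ecat v w.
  apply: env_ext => -[x|y]; rewrite /precomp; first exact: castS_id.
  move: (hr (inr y)) => /=; rewrite /h'.
  by move: (enum_rankK y) => e0; rewrite e0 => e; apply: castS_id.
split=> [H w|H w]; first by rewrite -E.
pose w' y : M (h y) := castS (M:=fun y => M (h y)) (enum_rankK y) (w (enum_rank y)).
have Ew' i : w' (enum_val i) = w i.
  rewrite /w'; move: (enum_rankK _); rewrite enum_valK => e.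
  exact: (castS_id (M:=fun y => M (h y))).
have -> : w = fun i => w' (enum_val i) by apply: env_ext => i; rewrite Ew'.
by rewrite E; apply: H.
Qed.

Lemma fdef_exenv (Y : finType) (h : Y -> sorts L) (X : Type)
  (g : X -> sorts L) D :
  @fdef L (X + Y) (scat g h) D ->
  fdef (g:=g) (fun M v => exists w : env M h, D M (ecat v w)).
Proof.
move=> /fdef_not/fdef_allenv/fdef_not; apply: fdef_ext => M v.
by rewrite not_existsP.
Qed.

End Definability.

(** * Cochains over F_2 *)

(** The coboundary of the cochain [c] on the simplex [u], whose vertices may be
    repeated. *)
Fixpoint cobd (X : Type) (u : seq X) (c : seq X -> bool) : bool :=
  if u is x :: u' then c u' (+) cobd u' (fun w => c (x :: w)) else false.

Definition face (X : Type) (k : nat) (u : seq X) : seq X :=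
  take k u ++ drop k.+1 u.

Section Cochains.
Variable X : Type.
Implicit Types (u w : seq X) (c d : seq X -> bool).

Lemma cobd_add u c d :
  cobd u (fun w => c w (+) d w) = cobd u c (+) cobd u d.
Proof.
elim: u c d => //= x u IH c d; rewrite IH.
by rewrite !addbA; congr (_ (+) _); rewrite -!addbA; congr (_ (+) _); rewrite addbC.
Qed.

Lemma cobd0 u : cobd u (fun=> false) = false.
Proof. by elim: u => //= x u ->. Qed.

Lemma cobd_cobd u c : cobd u (fun w => cobd w c) = false.
Proof. by elim: u c => //= x u IH c; rewrite cobd_add IH addbF addbb. Qed.

Lemma cobd_map (Y : Type) (k : X -> Y) (c : seq Y -> bool) u :
  cobd (map k u) c = cobd u (fun w => c (map k w)).
Proof. by elim: u c => //= x u IH c; rewrite IH. Qed.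

(** If the coboundary of [c] vanishes at [o :: u], then at [u] the cochain [c] is the coboundary of
    its cone. Primitives of cocycles are found this way throughout. *)
Lemma cobd_cone o u c :
  cobd u (fun w => c (o :: w)) = c u (+) cobd (o :: u) c.
Proof. by rewrite /= addbA addbb. Qed.

Lemma size_face k u : k < size u -> size (face k u) = (size u).-1.
Proof.
move=> h; rewrite size_cat size_drop size_takel 1?ltnW // subnS -subn1.
by rewrite addnBA ?subn_gt0 // subnKC ?subn1 // ltnW.
Qed.

Lemma nth_face x0 k u i : k <= size u -> nth x0 (face k u) i = nth x0 u (bump k i).
Proof.
move=> h; rewrite nth_cat size_takel // /bump [k <= i]leqNgt.
case: ltnP => hi /=; first by rewrite nth_take.
by rewrite nth_drop add1n addSn subnKC.
Qed.

Lemma cobd_sum u c : cobd u c = \big[addb/false]_(k < size u) c (face k u).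
Proof.
elim: u c => [|x u IH] c /=; first by rewrite big_ord0.
rewrite big_ord_recl /face /= drop0; congr (_ (+) _).
by rewrite IH; apply: eq_bigr => k _.
Qed.

End Cochains.

(** The faces of [u] are subsequences of it, so conditions on the entries of [u] pass to them. *)
Lemma eq_cobd (X : eqType) (u : seq X) (c d : seq X -> bool) :
  (forall w, size w = (size u).-1 -> subseq w u -> c w = d w) ->
  cobd u c = cobd u d.
Proof.
elim: u c d => // x u IH c d H.
rewrite [LHS]/= [RHS]/= (H u) ?subseq_cons //; congr (_ (+) _).
case: u H IH => // y u H IH; apply: IH => w sw uw.
by apply: H; rewrite /= ?sw ?eqxx.
Qed.

Lemma face_subseq (X : eqType) k (u : seq X) : subseq (face k u) u.
Proof.
rewrite -{2}(cat_take_drop k u) /face; apply: cat_subseq => //.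
by rewrite -addn1 addnC -drop_drop drop_subseq.
Qed.

(** * Cohomology relative to the simplices that miss a part *)

Definition meets (X : Type) (q : X -> nat) (m : nat) (w : seq X) : bool :=
  [forall i : 'I_m, has (fun x => q x == i) w].

Section Parts.
Variables (X : eqType) (q : X -> nat).
Implicit Types (u w : seq X) (c d : seq X -> bool).

Lemma meetsPn m w : reflect (exists2 i, i < m & all (fun x => q x != i) w)
  (~~ meets q m w).
Proof.
rewrite negb_forall; apply: (iffP existsP) => [[i]|[i hi]].
  by rewrite -all_predC => h; exists i.
by move=> h; exists (Ordinal hi); rewrite -all_predC.
Qed.

Lemma meetsNsub m u w : subseq w u -> ~~ meets q m u -> ~~ meets q m w.
Proof.
move=> wu /meetsPn[i hi /allP h]; apply/meetsPn; exists i => //.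
by apply/allP => x /(mem_subseq wu)/h.
Qed.

(* The simplices avoiding one of [m] parts form a space homotopy equivalent to
   the boundary of an (m-1)-simplex, relative to which the full complex has
   cohomology only in length [m]. *)
Lemma relative_cobd m : forall l c, l != m ->
  (forall w, size w = l -> all (fun x => q x < m) w -> ~~ meets q m w ->
     c w = false) ->
  (forall u, size u = l.+1 -> all (fun x => q x < m) u -> cobd u c = false) ->
  exists g,
    (forall w, size w = l.-1 -> all (fun x => q x < m) w -> ~~ meets q m w ->
       g w = false) /\
    (forall u, size u = l -> all (fun x => q x < m) u -> cobd u g = c u).
Proof.
(* Parts are plain numbers, so that the induction can drop the last one. For m = 0 only the empty
   list has its vertices in the parts, and [ne] excludes its length. *)
elim: m => [|m IH] l c ne c0 cc.
  exists (fun=> false); split=> // u su hu; rewrite cobd0.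
  by case: u su hu => //= su; rewrite -su in ne.
case: l => [|l] in ne c0 cc *.
  exists (fun=> false); split=> // u su hu; rewrite cobd0 c0 //.
  by rewrite (size0nil su); apply/meetsPn; exists 0.
(* The cone is taken from a vertex of the last part. If that part is empty, every simplex misses it
   and [c] vanishes. *)
have [[o /eqP qo]|no] := pselect (exists o, q o == m); last first.
  exists (fun=> false); split=> // u su hu; rewrite cobd0 c0 //.
  apply/meetsPn; exists m => //; apply/allP => x _; apply/eqP => e.
  by apply: no; exists x; rewrite e.
have lt w : all (fun x => q x < m) w -> all (fun x => q x < m.+1) w.
  by move=> /allP h; apply/allP => x /h /ltnW.
have sub u w (p : pred X) : subseq w u -> all p u -> all p w.
  by move=> /mem_subseq h /allP k; apply/allP => x /h /k.
pose g w := c (o :: w).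
have gc u : size u = l.+1 -> all (fun x => q x < m.+1) u -> cobd u g = c u.
  by move=> su hu; rewrite /g cobd_cone cc ?addbF //= ?su // qo ltnSn.
have g0 w : size w = l -> all (fun x => q x < m.+1) w ->
    (exists2 i, i < m & all (fun x => q x != i) w) -> g w = false.
  move=> sw hw [i hi h]; rewrite /g c0 //= ?sw // ?qo ?ltnSn //.
  apply/meetsPn; exists i => /=; first exact: ltnW.
  by rewrite h andbT qo gtn_eqF.
(* The cone [g] vanishes on simplices missing one of the first m parts, but perhaps not on those
   missing the last. On the latter [c] is zero, so there [g] is a cocycle relative to the first m
   parts and has a primitive [h]. *)
have [||h [h0 hh]] := IH l g ne.
- by move=> w sw hw /meetsPn; apply: g0 => //; apply: lt.
- move=> u su hu; rewrite gc ?lt // c0 ?lt //.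
  apply/meetsPn; exists m => //; apply/allP => x /(allP hu) hx.
  by rewrite ltn_eqF.
(* Extended by zero, [h] corrects the cone by a coboundary, which leaves the coboundary of the cone
   unchanged. *)
pose h' w := all (fun x => q x < m) w && h w.
exists (fun w => g w (+) cobd w h'); split=> [w sw hw|u su hu]; last first.
  by rewrite cobd_add cobd_cobd addbF gc.
move=> /meetsPn[i hi hwi].
have [im|im] := ltnP i m.
  rewrite g0 //; last by exists i.
  rewrite (@eq_cobd _ _ _ (fun=> false)) ?cobd0 // => v sv vw.
  rewrite /h'; case: (boolP (all _ v)) => //= hv; apply: h0 => //.
    by rewrite sv sw.
  by apply/meetsPn; exists i => //; apply: sub vw hwi.
have hwm : all (fun x => q x < m) w.
  apply/allP => x xw; have := allP hw x xw; rewrite ltnS leq_eqVlt => /orP[] //.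
  by have := allP hwi x xw; rewrite (_ : i = m) => [/negbTE ->|] //;
    apply/eqP; rewrite eqn_leq im andbT.
rewrite (@eq_cobd _ _ _ h) ?hh ?addbb // => v sv vw.
by rewrite /h' (sub _ _ _ vw hwm).
Qed.

End Parts.

Section PartsCor.
Variables (X : eqType) (m : nat) (q : X -> nat).
Hypothesis q_lt : forall x, q x < m.

(** Extend [f] by zero. Its coboundary is a relative cocycle of length l+1, hence the coboundary of
    a relative cochain [g], and adding [g] repairs the extension without touching the simplices that
    miss a part. *)
Lemma cocycle_extends l (f : seq X -> bool) : l.+1 != m ->
  (forall u, size u = l.+1 -> ~~ meets q m u -> cobd u f = false) ->
  exists F, (forall u, size u = l.+1 -> cobd u F = false) /\
    (forall w, size w = l -> ~~ meets q m w -> F w = f w).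
Proof.
move=> ne ff; pose f' w := ~~ meets q m w && f w.
have allq u : all (fun x => q x < m) u by apply/allP => x _.
have [||g [g0 gg]] := @relative_cobd X q m l.+1 (fun u => cobd u f') ne.
- move=> u su _ mu; rewrite -(ff u su mu); apply: eq_cobd => w _ wu.
  by rewrite /f' (meetsNsub wu mu).
- by move=> u _ _; apply: cobd_cobd.
exists (fun w => f' w (+) g w); split=> [u su|w sw mw].
  by rewrite cobd_add gg ?addbb.
by rewrite g0 // addbF /f' mw.
Qed.

(** Extend [c] to a cocycle on all simplices, where every cocycle is the coboundary of its cone. *)
Lemma cocycle_bounds l (c : seq X -> bool) : l.+2 != m ->
  (forall u, size u = l.+2 -> ~~ meets q m u -> cobd u c = false) ->
  exists g, forall w, size w = l.+1 -> ~~ meets q m w -> cobd w g = c w.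
Proof.
move=> ne /(cocycle_extends ne)[F [FF Fc]].
have [[o _]|no] := pselect (exists o : X, True); last first.
  by exists c => -[|x w] // _; case: no; exists x.
exists (fun w => F (o :: w)) => w sw mw.
by rewrite cobd_cone -Fc // FF ?addbF //= sw.
Qed.
End PartsCor.

(** Here and below [n0] is n-2: the values that matter are those on lists of length n, and the
    condition concerns lists of length n+1. *)
Definition cocycle (n0 : nat) (X : Type) (f : seq X -> bool) : Prop :=
  forall u, size u = n0.+3 -> cobd u f = false.

(** * Gluing and extending cocycles *)

Section Gluing.
Variables (X : eqType) (n0 : nat).
Local Notation n := n0.+2.

Definition cocycle_on (S : X -> Prop) (f : seq X -> bool) : Prop :=
  forall u, size u = n.+1 -> (forall x, x \in u -> S x) -> cobd u f = false.

(* If [S] and [S'] are disjoint, the two cones agree for lack of common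
   simplices: this is where n >= 2 is needed. *)
Lemma cocycle_glue (S S' : X -> Prop) (f f' : seq X -> bool) :
  cocycle_on S f -> cocycle_on S' f' ->
  (forall w, size w = n -> (forall x, x \in w -> S x /\ S' x) -> f w = f' w) ->
  exists F, [/\ cocycle n0 F,
    forall w, size w = n -> (forall x, x \in w -> S x) -> F w = f w &
    forall w, size w = n -> (forall x, x \in w -> S' x) -> F w = f' w].
Proof.
move=> hf hf' ff'.
(* The apices of the two cones: one common point whenever [S] and [S'] meet. *)
have [o [o' [So S'o oo]]] : exists o o' : option X,
    [/\ forall x, S x -> (exists2 y, o = Some y & S y),
        forall x, S' x -> (exists2 y, o' = Some y & S' y) &
        forall x, S x -> S' x -> exists y, [/\ o = Some y, o' = Some y, S y & S' y]].
  have [[y [Sy S'y]]|H] := pselect (exists y, S y /\ S' y).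
    by exists (Some y), (Some y); split=> x *; exists y.
  have F (R : X -> Prop) : exists o, forall x, R x -> exists2 y, o = Some y & R y.
    have [[y Ry]|K] := pselect (exists y, R y).
      by exists (Some y) => x _; exists y.
    by exists None => x Rx; case: K; exists x.
  have [o ho] := F S; have [o' ho'] := F S'.
  by exists o, o'; split=> // x Sx S'x; case: H; exists x.
pose cone (o : option X) c w : bool := if o is Some y then c (y :: w) else false.
pose inS (R : X -> Prop) (w : seq X) := `[< forall x, x \in w -> R x >].
(* This is the cone of [f] on simplices of [S] and the cone of [f'] on those of [S']; the glued
   cocycle is its coboundary. *)
pose g w := if inS S w then cone o f w else inS S' w && cone o' f' w.
have coneE o1 (R : X -> Prop) c w : size w = n -> cocycle_on R c ->
   (forall x, R x -> (exists2 y, o1 = Some y & R y)) ->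
   (forall x, x \in w -> R x) -> cobd w (cone o1 c) = c w.
  move=> sw hc ho Rw.
  have [y -> Ry] : exists2 y, o1 = Some y & R y.
    by case: w sw Rw => //= x w _ Rw; apply: (ho x); apply: Rw; rewrite inE eqxx.
  rewrite /cone cobd_cone (hc (y :: w)) ?addbF //= ?sw // => x.
  by rewrite inE => /orP[/eqP->|/Rw].
exists (fun w => cobd w g); split=> [u _|w sw Sw|w sw S'w].
- exact: cobd_cobd.
- rewrite -(coneE o S f) //; apply: eq_cobd => v _ vw.
  by rewrite /g (_ : inS S v) //; apply/asboolP => x /(mem_subseq vw)/Sw.
rewrite -(coneE o' S' f') //; apply: eq_cobd => v sv vw.
have S'v x : x \in v -> S' x by move=> /(mem_subseq vw)/S'w.
rewrite /g (_ : inS S' v) ?andTb; last by apply/asboolP.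
case: (asboolP (forall x, x \in v -> S x)) => Sv; rewrite /inS.
  rewrite asboolT //; case: v sv vw S'v Sv => [|x v]; first by rewrite sw.
  move=> sv vw S'v Sv; have xv : x \in x :: v by rewrite inE eqxx.
  have [y [-> -> Sy S'y]] := oo x (Sv x xv) (S'v x xv).
  apply: ff'; first by move: sv => /= ->; rewrite sw.
  by move=> z; rewrite inE => /orP[/eqP->|zv] //; split; [apply: Sv|apply: S'v].
by rewrite asboolF.
Qed.

Lemma cocycle_extend (S : X -> Prop) (f : seq X -> bool) : cocycle_on S f ->
  exists F, cocycle n0 F /\
    forall w, size w = n -> (forall x, x \in w -> S x) -> F w = f w.
Proof.
move=> hf; have [F [FF Ff _]] := @cocycle_glue S S f f hf hf (fun _ _ _ => erefl).
by exists F.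
Qed.

End Gluing.

(** * The covers *)

Lemma fresh_map (X Y : eqType) (V : Y -> Prop) (t : seq X) (avoid : seq Y) :
  (forall l : seq Y, exists2 y, V y & y \notin l) -> Y ->
  exists k : X -> Y, {in t &, injective k} /\
    {in t, forall x, V (k x) /\ k x \notin avoid}.
Proof.
move=> freshV y0; elim: t => [|x t [k [kI kV]]].
  by exists (fun=> y0).
have [xt|xt] := boolP (x \in t).
  exists k; split=> [a b|a]; rewrite !inE; last first.
    by move=> /predU1P[->|] /=; [apply: kV | apply: kV].
  move=> ha hb; apply: kI.
    by case/predU1P: ha => [->|].
  by case/predU1P: hb => [->|].
have [y Vy] := freshV (avoid ++ map k t).
rewrite mem_cat negb_or => /andP[ya yk].
have kN a : a \in t -> (a == x) = false.
  by move=> ha; apply/negbTE/eqP => e; rewrite e (negbTE xt) in ha.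
have ykt a : a \in t -> k a <> y.
  by move=> ha e; case/negP: yk; rewrite -e map_f.
exists (fun a => if a == x then y else k a); split=> [a b|a]; rewrite !inE; last first.
  by case/predU1P=> [->|ha]; [rewrite eqxx | rewrite kN //; apply: kV].
case/predU1P=> [->|ha] /predU1P[->|hb]; rewrite ?eqxx ?kN //.
- by move=> e; case: (ykt b hb).
- by move/(ykt a ha).
- exact: kI.
Qed.

Section Perms.
Variable X : eqType.

Definition swap (a b x : X) : X :=
  if x == a then b else if x == b then a else x.

Lemma swapK a b : involutive (swap a b).
Proof.
move=> x; rewrite /swap; case: (eqVneq x a) => [->|xa].
  by case: (eqVneq b a) => [->|ba]; rewrite ?eqxx.
by case: (eqVneq x b) => [->|xb]; rewrite ?eqxx ?(negbTE xa) ?(negbTE xb).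
Qed.

(** One point at a time: composing with the transposition of [p x] and [k x] sets the new value and
    disturbs no earlier one. *)
Lemma perm_extension (l : seq X) (k : X -> X) : {in l &, injective k} ->
  exists p p' : X -> X, [/\ cancel p p', cancel p' p & {in l, p =1 k}].
Proof.
elim: l => [|x l IH] kI; first by exists id, id.
have [|p [p' [pK p'K pk]]] := IH.
  by move=> a b ha hb; apply: kI; rewrite inE ?ha ?hb orbT.
have [xl|xl] := boolP (x \in l).
  by exists p, p'; split=> // a; rewrite inE => /predU1P[->|]; apply: pk.
exists (swap (p x) (k x) \o p), (p' \o swap (p x) (k x)); split.
- by move=> a /=; rewrite swapK pK.
- by move=> a /=; rewrite p'K swapK.
move=> a; rewrite inE => /predU1P[->|al] /=; first by rewrite /swap eqxx.
have ax : a <> x by move=> e; rewrite e (negbTE xl) in al.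
rewrite -(pk _ al) /swap ifN; last by apply/eqP => /(can_inj pK).
rewrite ifN //; apply/eqP; rewrite (pk _ al) => /kI h.
by apply: ax; apply: h; rewrite inE ?al ?eqxx ?orbT.
Qed.

(** The source of all genericity arguments. [V] is the image of an embedding when a witness must be
    moved into a submodel, and everything when a tuple must be made free over [l]. *)
Lemma move_off (V : X -> Prop) (l t avoid : seq X) :
  (forall l : seq X, exists2 y, V y & y \notin l) ->
  exists p p' : X -> X, [/\ cancel p p', cancel p' p, {in l, p =1 id} &
    {in t, forall x, x \notin l -> V (p x) /\ p x \notin avoid}].
Proof.
move=> freshV.
have [y0 _ _] := freshV [::].
have [k [kI kV]] := @fresh_map X X V t (l ++ avoid) freshV y0.
pose k' x := if x \in l then x else k x.
have [|p [p' [pK p'K pk]]] := @perm_extension (l ++ t) k'.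
  move=> a b; rewrite !mem_cat /k'.
  case: (boolP (a \in l)) => [al _|al /= at_]; case: (boolP (b \in l)) => //=.
  - move=> _ bt e; have [_] := kV b bt.
    by rewrite mem_cat -e al.
  - move=> bl _ e; have [_] := kV a at_.
    by rewrite mem_cat e bl.
  - by move=> _ bt; apply: kI.
exists p, p'; split=> // x xl; first by rewrite pk ?mem_cat ?xl // /k' xl.
move=> xl'; rewrite pk ?mem_cat ?xl ?orbT // /k' (negbTE xl').
have [Vk] := kV x xl; rewrite mem_cat negb_or => /andP[_ h].
by split.
Qed.
End Perms.

Record inf_type := InfType {
  inf_sort :> eqType;
  inf_fresh : forall l : seq inf_sort, exists x, x \notin l }.

Section Cover.
Variable n0 : nat.
Local Notation n := n0.+2.

Definition cov (Om : Type) : Type := (n.-tuple Om * bool)%type.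

Definition vtx (Om : Type) (i : 'I_n) (x : cov Om) : Om := tnth x.1 i.

(** Position i of the k-th face of a simplex is position [bump k i] of the simplex. Thus the n+1
    elements lie over the faces of one simplex, a condition that the relations E_ij express. *)
Definition compat (Om : Type) (v : 'I_n.+1 -> cov Om) : Prop :=
  forall (k l : 'I_n.+1) (i j : 'I_n), bump k i = bump l j ->
    vtx i (v k) = vtx j (v l).

Definition cR (Om : Type) (v : 'I_n.+1 -> cov Om) : Prop :=
  compat v /\ \big[addb/false]_k (v k).2 = false.

Definition amap (Om Om' : Type) (k : Om -> Om') (f : seq Om -> bool)
    (x : cov Om) : cov Om' :=
  (map_tuple k x.1, x.2 (+) f x.1).

Definition lies_in (Om : Type) (S : Om -> Prop) (x : cov Om) : Prop :=
  forall i, S (vtx i x).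

Lemma lies_inP (Om : eqType) (S : Om -> Prop) (x : cov Om) :
  lies_in S x <-> forall y, y \in val x.1 -> S y.
Proof.
split=> [h y /tnthP[i ->]|h i]; first exact: h.
by apply: h; apply: mem_tnth.
Qed.

Definition face_tuple (Om : Type) (k : 'I_n.+1) (u : n.+1.-tuple Om) :
    n.-tuple Om :=
  @Tuple n Om (face k u) (introT eqP (etrans (size_face (X:=Om)
    (eq_ind_r (fun m => k < m) (ltn_ord k) (size_tuple u)))
    (congr1 predn (size_tuple u)))).

Lemma cov_ext (Om : Type) (x y : cov Om) :
  (forall i, vtx i x = vtx i y) -> x.2 = y.2 -> x = y.
Proof.
by case: x y => [t b] [t' b'] /= h ->; congr (_, _); apply: eq_from_tnth.
Qed.

Lemma vtx_amap (Om Om' : Type) (k : Om -> Om') (f : seq Om -> bool) i x :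
  vtx i (amap k f x) = k (vtx i x).
Proof. by rewrite /vtx tnth_map. Qed.

Lemma vtx_face (Om : Type) (k : 'I_n.+1) (u : n.+1.-tuple Om) (i : 'I_n) b x0 :
  vtx i (face_tuple k u, b) = nth x0 u (bump k i).
Proof. by rewrite /vtx (tnth_nth x0) /= nth_face // size_tuple ltnW. Qed.

Lemma compat_simplex (Om : eqType) (v : 'I_n.+1 -> cov Om) : compat v ->
  exists u : n.+1.-tuple Om, forall k, (v k).1 = face_tuple k u.
Proof.
move=> hv; pose x0 := vtx ord0 (v (lift ord0 ord0)).
(* Face 0 omits just the first vertex, which is read off face 1. *)
exists (cons_tuple x0 (v ord0).1) => k.
apply: eq_from_tnth => i.
have := vtx_face k (cons_tuple x0 (v ord0).1) i false x0; rewrite /vtx /= => ->.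
case E: (bump k i) => [|p] /=.
  by apply: (hv k (lift ord0 ord0) i ord0); rewrite E.
have hp : p < n.
  have := ltn_ord i; rewrite -ltnS -E /bump.
  by case: (k <= i); rewrite ?add0n // => h; apply: ltn_trans (ltnSn _).
rewrite -(tnth_nth x0 _ (Ordinal hp)).
by apply: (hv k ord0 i (Ordinal hp)); rewrite E.
Qed.

Lemma compat_faces (Om : Type) (u : n.+1.-tuple Om) (b : 'I_n.+1 -> bool) :
  compat (fun k => (face_tuple k u, b k)).
Proof.
move=> k l i j e; have x0 := thead u.
by rewrite !(vtx_face _ _ _ _ x0) e.
Qed.

Lemma cobd_faces (Om : eqType) (u : n.+1.-tuple Om) (f : seq Om -> bool) :
  cobd u f = \big[addb/false]_(k < n.+1) f (face_tuple k u).
Proof.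
rewrite cobd_sum size_tuple; exact: eq_bigr.
Qed.

Lemma compat_amap (Om Om' : Type) (k : Om -> Om') f (v : 'I_n.+1 -> cov Om) :
  (forall a b i j, k (vtx i (v a)) = k (vtx j (v b)) -> vtx i (v a) = vtx j (v b)) ->
  compat (fun a => amap k f (v a)) <-> compat v.
Proof.
by move=> kI; split=> h a b i j e; have := h a b i j e; rewrite !vtx_amap;
  [apply: kI | move=> ->].
Qed.

(** Over the faces of a simplex the bits change by values of [f] whose sum is the coboundary of [f]
    at that simplex, hence zero. *)
Lemma cR_amap (Om Om' : eqType) (S : Om -> Prop) (k : Om -> Om') f
  (v : 'I_n.+1 -> cov Om) :
  (forall x y, S x -> S y -> k x = k y -> x = y) -> cocycle_on n0 S f ->
  (forall a, lies_in S (v a)) ->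
  cR (fun a => amap k f (v a)) <-> cR v.
Proof.
move=> kI hf Sv; rewrite /cR compat_amap; last by move=> a b i j; apply: kI; apply: Sv.
suff E : compat v -> \big[addb/false]_a (amap k f (v a)).2 =
    \big[addb/false]_a (v a).2 by split=> -[hv]; rewrite E.
move=> /compat_simplex[u hu]; rewrite big_split /=.
have -> : \big[addb/false]_(a < n.+1) f (v a).1 = cobd u f.
  by rewrite cobd_faces; apply: eq_bigr => a _; rewrite hu.
rewrite hf ?addbF ?size_tuple //.
move=> x /(nthP x)[p]; rewrite size_tuple => hp <-.
case: p hp => [|p] hp.
  have <- := vtx_face (lift ord0 ord0) u ord0 false x.
  by have := Sv (lift ord0 ord0) ord0; rewrite /vtx hu.
have <- := vtx_face ord0 u (Ordinal (hp : p < n)) false x.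
by have := Sv ord0 (Ordinal (hp : p < n)); rewrite /vtx hu.
Qed.

Lemma amap_inj (Om Om' : eqType) (S : Om -> Prop) (k : Om -> Om') f x y :
  (forall x y, S x -> S y -> k x = k y -> x = y) -> lies_in S x -> lies_in S y ->
  amap k f x = amap k f y -> x = y.
Proof.
move=> kI Sx Sy e.
have E i : vtx i x = vtx i y.
  by apply: kI; [apply: Sx|apply: Sy|rewrite -!(vtx_amap k f) e].
apply: cov_ext => //; have e1 : x.1 = y.1 by apply: eq_from_tnth.
by case: e => _; rewrite e1 => /addIb.
Qed.

(** Preservation of E_ij makes [h] act on vertices, injectivity makes it act on each fibre by adding
    a bit, and preservation of R makes these bits a cocycle. *)
Lemma cover_map_data (Om Om' : eqType) (S : Om -> Prop) (h : cov Om -> cov Om') :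
  (forall i j x y, lies_in S x -> lies_in S y ->
     (vtx i (h x) = vtx j (h y) <-> vtx i x = vtx j y)) ->
  (forall v, (forall a, lies_in S (v a)) -> cR v -> cR (fun a => h (v a))) ->
  (forall x y, lies_in S x -> lies_in S y -> h x = h y -> x = y) ->
  exists k f, [/\ forall x y, S x -> S y -> k x = k y -> x = y,
    cocycle_on n0 S f & forall x, lies_in S x -> h x = amap k f x].
Proof.
move=> hE hR hI.
(* A vertex is named by a constant tuple. *)
pose diag x : cov Om := (nseq_tuple n x, false).
have vd i x : vtx i (diag x) = x by rewrite /vtx /= tnth_nseq.
have od x : S x -> lies_in S (diag x) by move=> Sx i; rewrite vd.
pose k x := vtx ord0 (h (diag x)).
pose f w := if insub w is Some t then (h (t : n.-tuple Om, false)).2 else false.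
have fE (t : n.-tuple Om) : f t = (h (t, false)).2 by rewrite /f valK.
have hk i x : lies_in S x -> vtx i (h x) = k (vtx i x).
  by move=> Sx; apply/hE; rewrite ?vd //; apply: od; apply: Sx.
have hh x : lies_in S x -> h x = amap k f x.
  move=> Sx; apply: cov_ext => [i|]; first by rewrite hk // vtx_amap.
  case: x Sx => t [] Sx; rewrite /= fE //.
  have Sx' : lies_in S (t, false) by [].
  have : h (t, true) <> h (t, false) by move/(hI _ _ Sx Sx').
  have e i : vtx i (h (t, true)) = vtx i (h (t, false)) by rewrite !hk.
  have ne : h (t, true) = h (t, false) -> False by move/(hI _ _ Sx Sx').
  move: (@cov_ext _ _ _ e); case: (h _).2; case: (h _).2 => //= K _;
    by case: ne; apply: K.
exists k, f; split=> // [x y Sx Sy e|u su Su].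
  rewrite -[x](vd ord0) -[y](vd ord0); apply/hE; first exact: od.
    exact: od.
  exact: e.
pose ut : n.+1.-tuple Om := @Tuple n.+1 _ u (introT eqP su).
rewrite -[u]/(val ut) cobd_faces.
(* R holds of the faces with all bits zero; after applying [h] it says that the coboundary of [f] at
   [u] is zero. *)
have [||_] := hR (fun a => (face_tuple a ut, false)).
- move=> a; apply/lies_inP => y /= hy; apply: Su.
  exact: mem_subseq (face_subseq _ _) _ hy.
- by split; [exact: compat_faces (fun=> false) | rewrite big1].
by move=> E; rewrite -[RHS]E; apply: eq_bigr => a _; rewrite fE.
Qed.

Definition lang : language :=
  @Language unit void (fun _ => 0) (fun _ _ => tt) (fun _ => tt)
    (option ('I_n * 'I_n)) (fun r => if r is Some _ then 2 else n.+1)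
    (fun _ _ => tt).

Lemma cov_inhab (Om : inf_type) : inhabited (cov Om).
Proof. by have [x _] := inf_fresh (i:=Om) [::]; split; exact: (nseq_tuple n x, false). Qed.

Definition std (Om : inf_type) : structure lang :=
  @Structure lang (fun _ => cov Om) (fun _ => cov_inhab Om)
    (fun f => match f with end)
    (fun r => match r return ('I_(if r is Some _ then 2 else n.+1) -> cov Om) -> Prop
      with
      | Some (i, j) => fun v => vtx i (v ord0) = vtx j (v ord_max)
      | None => @cR Om
      end).

Lemma amap_embedding (Om Om' : inf_type) (k : Om -> Om') f :
  injective k -> cocycle n0 f ->
  @embedding lang (std Om) (std Om') (fun _ => amap k f).
Proof.
move=> kI hf; pose S (x : Om) := True.
have kI' x y : S x -> S y -> k x = k y -> x = y by move=> _ _ /kI.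
split=> [[] x y|[]|[[i j]|] v] /=.
- exact: (amap_inj kI').
- by rewrite /emap !vtx_amap; split=> [->|/kI].
rewrite /emap (@cR_amap _ _ S) //.
by move=> u su _; apply: hf.
Qed.

Lemma amap_comp (Om Om' Om'' : Type) (k : Om -> Om') f (k' : Om' -> Om'') f' x :
  amap k' f' (amap k f x) =
  amap (k' \o k) (fun w => f w (+) f' (map k w)) x.
Proof.
by apply: cov_ext => [i|]; rewrite ?vtx_amap //= -addbA.
Qed.

Lemma eq_amap (Om : eqType) (Om' : Type) (S : Om -> Prop) (k k' : Om -> Om') f f' x :
  (forall y, S y -> k y = k' y) ->
  (forall w, size w = n -> (forall y, y \in w -> S y) -> f w = f' w) ->
  lies_in S x -> amap k f x = amap k' f' x.
Proof.
move=> ek ef Sx; apply: cov_ext => [i|]; first by rewrite !vtx_amap ek.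
by rewrite /= ef ?size_tuple //; apply/lies_inP.
Qed.

Lemma amap_id (Om : Type) (x : cov Om) : amap id (fun=> false) x = x.
Proof. by apply: cov_ext => [i|]; rewrite ?vtx_amap //= addbF. Qed.

Record aut (Om : Type) := Aut {
  aperm : Om -> Om;
  aperm' : Om -> Om;
  apermK : cancel aperm aperm';
  aperm'K : cancel aperm' aperm;
  acoc : seq Om -> bool;
  acocP : cocycle n0 acoc }.

Lemma cocycle0 (Om : Type) : cocycle n0 (fun _ : seq Om => false).
Proof. by move=> u _; elim: u => //= x u ->. Qed.

Lemma inv_coc (Om : eqType) (a : aut Om) :
  cocycle n0 (fun w => acoc a (map (aperm' a) w)).
Proof. by move=> u su; rewrite -cobd_map acocP // size_map. Qed.

Definition aut_inv (Om : eqType) (a : aut Om) : aut Om :=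
  Aut (aperm'K a) (apermK a) (inv_coc a).

Definition aut_act (Om : Type) (a : aut Om) : cov Om -> cov Om :=
  amap (aperm a) (acoc a).

Lemma aut_invK (Om : eqType) (a : aut Om) : cancel (aut_act a) (aut_act (aut_inv a)).
Proof.
move=> x; rewrite /aut_act amap_comp -[RHS]amap_id.
apply: (eq_amap (S:=fun=> True)) => //= [y _|w _ _]; first by rewrite apermK.
by rewrite mapK ?addbb //; apply: apermK.
Qed.

Lemma aut_Kinv (Om : eqType) (a : aut Om) : cancel (aut_act (aut_inv a)) (aut_act a).
Proof.
move=> x; rewrite /aut_act amap_comp -[RHS]amap_id.
by apply: (eq_amap (S:=fun=> True)) => //= [y _|w _ _]; rewrite ?aperm'K ?addbb.
Qed.

Lemma aperm_inj (Om : Type) (a : aut Om) : injective (aperm a).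
Proof. exact: can_inj (apermK a). Qed.

Definition aut_iso (Om : inf_type) (a : aut Om) : iso (std Om) (std Om) :=
  @Iso lang (std Om) (std Om) (fun _ => aut_act a) (fun _ => aut_act (aut_inv a))
    (fun _ => aut_invK a) (fun _ => aut_Kinv a)
    (amap_embedding (aperm_inj (a:=a)) (acocP a)).

Definition perm_aut (Om : Type) (p p' : Om -> Om) (pK : cancel p p')
    (p'K : cancel p' p) : aut Om :=
  Aut pK p'K (@cocycle0 Om).

(* Every finite partial map with a cocycle on its domain extends to an
   automorphism; here two such maps are glued. *)
Lemma aut_glue (Om : eqType) (s t : seq Om) (k k' : Om -> Om) f f' :
  {in s &, injective k} -> {in t &, injective k'} ->
  cocycle_on n0 (fun x => x \in s) f -> cocycle_on n0 (fun x => x \in t) f' ->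
  (forall x, x \in s -> x \in t -> k x = k' x) ->
  (forall x y, x \in s -> y \in t -> k x = k' y -> x = y) ->
  (forall w, size w = n -> (forall x, x \in w -> x \in s /\ x \in t) -> f w = f' w) ->
  exists a : aut Om,
    (forall x, lies_in (fun y => y \in s) x -> aut_act a x = amap k f x) /\
    (forall x, lies_in (fun y => y \in t) x -> aut_act a x = amap k' f' x).
Proof.
move=> kI k'I hf hf' kk' dj ff'.
have [F [FF Fs Ft]] := @cocycle_glue Om n0 (fun x => x \in s) (fun x => x \in t) f f' hf hf' ff'.
pose K x := if x \in s then k x else k' x.
have Ks x : x \in s -> K x = k x by rewrite /K => ->.
have Kt x : x \in t -> K x = k' x by rewrite /K; case: ifP => // xs xt; rewrite kk'.
have [|p [p' [pK p'K pk]]] := @perm_extension Om (s ++ t) K.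
  move=> a b; rewrite !mem_cat => /orP[ha|ha] /orP[hb|hb].
  - by rewrite !Ks //; apply: kI.
  - by rewrite (Ks a) // (Kt b) //; apply: dj.
  - by rewrite (Ks b) // (Kt a) // => e; rewrite (dj b a).
  - by rewrite !Kt //; apply: k'I.
exists (Aut pK p'K FF); split=> x hx.
  apply: (eq_amap (S:=fun y => y \in s)) => //= y hy.
  by rewrite pk ?mem_cat ?hy ?Ks.
apply: (eq_amap (S:=fun y => y \in t)) => //= y hy.
by rewrite pk ?mem_cat ?hy ?orbT ?Kt.
Qed.

Lemma aut_extend (Om : eqType) (s : seq Om) (k : Om -> Om) f :
  {in s &, injective k} -> cocycle_on n0 (fun x => x \in s) f ->
  exists a : aut Om,
    forall x, lies_in (fun y => y \in s) x -> aut_act a x = amap k f x.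
Proof.
move=> kI hf.
have dj x y : x \in s -> y \in s -> k x = k y -> x = y by move=> xs ys /kI; apply.
have [a [ha _]] := aut_glue kI kI hf hf (fun _ _ _ => erefl) dj (fun _ _ _ => erefl).
by exists a.
Qed.

Definition vtxs (Om : Type) (x : cov Om) : seq Om := x.1.

Definition env_vtxs (Om : inf_type) (X : Type) (g : X -> unit) (k : nat)
    (e : 'I_k -> X) (v : env (std Om) g) : seq Om :=
  flatten [seq vtxs (v (e i)) | i <- enum 'I_k].

Lemma env_vtxsP (Om : inf_type) (X : Type) (g : X -> unit) k (e : 'I_k -> X)
  (v : env (std Om) g) (i : 'I_k) :
  lies_in (fun y => y \in env_vtxs e v) (v (e i)).
Proof.
apply/lies_inP => y hy; apply/flattenP; exists (vtxs (v (e i))) => //.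
by apply/mapP; exists i; rewrite ?mem_enum.
Qed.

Lemma amap_onto (Om Om' : eqType) (k : Om -> Om') f (y : cov Om') :
  lies_in (fun z => exists x, z = k x) y -> exists x, y = amap k f x.
Proof.
move=> hy; pose t := [tuple projT1 (cid (hy i)) | i < n].
exists (t, y.2 (+) f t); apply: cov_ext => [i|]; rewrite ?vtx_amap.
  by rewrite /vtx tnth_mktuple; apply: (projT2 (cid (hy i))).
by rewrite /= addbK.
Qed.

Lemma image_fresh (Om : inf_type) (Y : eqType) (k : Om -> Y) : injective k ->
  forall l : seq Y, exists2 y, (exists x, y = k x) & y \notin l.
Proof.
move=> kI; suff H (l : seq Y) : exists l' : seq Om, forall x, k x \in l -> x \in l'.
  move=> l; have [l' hl'] := H l; have [x hx] := inf_fresh l'.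
  by exists (k x); [exists x | apply: contra hx => /hl'].
elim: l => [|y l [l' IH]]; first by exists [::].
have [[x ex]|no] := pselect (exists x, y = k x).
  exists (x :: l') => z; rewrite !inE ex => /predU1P[/kI ->|/IH ->].
    by rewrite eqxx.
  by rewrite orbT.
exists l' => z; rewrite inE => /predU1P[e|/IH //].
by case: no; exists z.
Qed.

(** A permutation fixing the vertices of the parameters moves those of the witness into the image of
    [k], and every element over that image is attained, whatever its bit. *)
Lemma amap_elementary (Om Om' : inf_type) (k : Om -> Om') f :
  injective k -> cocycle n0 f ->
  @elementary lang (std Om) (std Om') (fun _ => amap k f).
Proof.
move=> kI hf; apply: elementary_by_autos; first exact: amap_embedding.
move=> X g v [] d [m [e eP]].
have [p [p' [pK p'K pid pV]]] := move_off (map k (env_vtxs e v)) (vtxs d) [::]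
  (image_fresh kI).
exists (aut_iso (perm_aut pK p'K)) => /= [x|].
  rewrite -[RHS]amap_id; apply: (eq_amap (S:=fun y => y \in map k (env_vtxs e v))) => //.
  have [i ->] := eP x I.
  by move=> j; rewrite vtx_amap map_f //; apply: env_vtxsP.
apply: amap_onto => i; rewrite vtx_amap /=.
have [/mapP[x xs ex]|ni] := boolP (vtx i d \in map k (env_vtxs e v)).
  by exists x; rewrite ex pid //; apply: map_f.
by have [] := pV (vtx i d) (mem_tnth _ _) ni.
Qed.

End Cover.

(** * Imaginaries *)

Lemma sig_eq (A : Type) (P : A -> Prop) (x y : {a | P a}) :
  sval x = sval y -> x = y.
Proof.
by case: x y => [x hx] [y hy] /= e; subst y; congr exist; apply: Prop_irrelevance.
Qed.

Section EqStructures.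
Variables (L : language) (T : theory L).
Local Notation eqs := (eq_structure T).

Definition eproj (M : structure L) (E : Defs.eqrel T)
    (a : env M (er_sort (e:=E))) : eqs M (inr E) :=
  exist _ (eq_class (E:=E) a) (ex_intro _ a erefl).

Lemma eproj_surj (M : structure L) (E : Defs.eqrel T) (C : eqs M (inr E)) :
  exists a, C = eproj a.
Proof. by case: C => C [a ea]; exists a; apply: sig_eq. Qed.

Lemma eproj_eq (M : structure L) (E : Defs.eqrel T)
  (a b : env M (er_sort (e:=E))) :
  model T M -> eproj a = eproj b <-> frel_of (er_form E) a b.
Proof.
move=> hM; have [r s t] := @er_equiv _ _ E _ hM.
split=> [/(congr1 (fun C => sval C b)) /= e|ab].
  by rewrite /eq_class in e; rewrite e; apply: r.
apply: sig_eq; apply: funext => c; apply: propext; split; last exact: t.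
exact: t (s _ _ ab).
Qed.

Lemma frel_elementary (M N : structure L) (j : forall s, M s -> N s)
  (E : Defs.eqrel T) (a b : env M (er_sort (e:=E))) : elementary j ->
  frel_of (er_form E) a b <-> frel_of (er_form E) (emap j a) (emap j b).
Proof. by move=> hj; rewrite /frel_of (hj _ _ (er_form E)) emap_ecat. Qed.

Section Eqmap.
Variables (M N : structure L) (hM : model T M) (hN : model T N).
Variables (j : forall s, M s -> N s) (hj : elementary j).

(** The pointwise image of a class is not a class of [N], so it is saturated under the equivalence
    relation. *)
Definition class_image (E : Defs.eqrel T) (C : env M (er_sort (e:=E)) -> Prop) :
    env N (er_sort (e:=E)) -> Prop :=
  fun b => exists2 a, C a & frel_of (er_form E) (emap j a) b.

Lemma class_image_proj (E : Defs.eqrel T) (a : env M (er_sort (e:=E))) :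
  class_image (eq_class (E:=E) a) = eq_class (E:=E) (emap j a).
Proof.
have [_ _ t] := @er_equiv _ _ E _ hN; have [r _ _] := @er_equiv _ _ E _ hM.
apply: funext => b; apply: propext; split=> [[a' aa' a'b]|ab].
  by apply: t a'b; apply/(frel_elementary _ _ hj).
by exists a => //; apply: r.
Qed.

Lemma class_image_class (E : Defs.eqrel T) (C : eqs M (inr E)) :
  exists b, class_image (sval C) = eq_class (E:=E) b.
Proof.
have [a ->] := eproj_surj C; exists (emap j a); exact: class_image_proj.
Qed.

Definition eqmap (s : sorts (eq_language T)) : eqs M s -> eqs N s :=
  match s return eqs M s -> eqs N s with
  | inl s => j (s:=s)
  | inr E => fun C => exist _ _ (class_image_class C)
  end.

Lemma eqmap_proj (E : Defs.eqrel T) (a : env M (er_sort (e:=E))) :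
  eqmap (eproj a) = eproj (emap j a).
Proof. by apply: sig_eq; apply: class_image_proj. Qed.

Lemma eqmap_embedding : embedding j -> embedding eqmap.
Proof.
move=> ej; split=> [[s|E]|[f|E] v|r v].
- exact: emb_inj ej s.
- move=> C D; have [a ->] := eproj_surj C; have [b ->] := eproj_surj D.
  rewrite !eqmap_proj => /(eproj_eq _ _ hN)/(frel_elementary _ _ hj) ab.
  exact/eproj_eq.
- exact: (emb_fint ej v).
- exact: eqmap_proj.
- exact: (emb_rint ej v).
Qed.

End Eqmap.

Lemma eqmap_comp (M N K : structure L) hM hN hK (j : forall s, M s -> N s) hj
  (k : forall s, N s -> K s) hk (l : forall s, M s -> K s) hl :
  (forall s x, l s x = k s (j s x)) ->
  forall s (x : eqs M s), @eqmap M K hM hK l hl s x =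
    @eqmap N K hN hK k hk s (@eqmap M N hM hN j hj s x).
Proof.
move=> e [s|E] x; first exact: e.
have [a ->] := eproj_surj x; rewrite !eqmap_proj; congr eproj.
by apply: env_ext => i; apply: e.
Qed.

Lemma eqmap_id (M : structure L) hM hM' (j : forall s, M s -> M s) hj :
  (forall s x, j s x = x) -> forall s (x : eqs M s), @eqmap M M hM hM' j hj s x = x.
Proof.
move=> e [s|E] x; first exact: e.
have [a ->] := eproj_surj x; rewrite !eqmap_proj; congr eproj.
by apply: env_ext => i; apply: e.
Qed.

Section EqIso.
Variables (M N : structure L) (hM : model T M) (hN : model T N) (j : iso M N).

Lemma eq_isoK s : cancel (eqmap hM hN (elementary_iso j) (s:=s))
  (eqmap hN hM (elementary_iso (iso_sym j)) (s:=s)).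
Proof.
move=> x; rewrite -(eqmap_comp _ _ _ _ _ (@elementary_id _ M)) => [|t y].
  exact: eqmap_id.
by rewrite /= iso_funK.
Qed.

Lemma eq_isoK' s : cancel (eqmap hN hM (elementary_iso (iso_sym j)) (s:=s))
  (eqmap hM hN (elementary_iso j) (s:=s)).
Proof.
move=> x; rewrite -(eqmap_comp _ _ _ _ _ (@elementary_id _ N)) => [|t y].
  exact: eqmap_id.
by rewrite /= iso_invK.
Qed.

Definition eq_iso : iso (eqs M) (eqs N) :=
  Iso eq_isoK eq_isoK' (eqmap_embedding hM hN (elementary_iso j) (iso_emb j)).
End EqIso.

Definition reduct (N : structure (eq_language T)) : structure L :=
  @Structure L (fun s => N (inl s)) (fun s => inhab N (inl s))
    (fun f v => fint (L:=eq_language T) (s0:=N) (f:=inl f) v)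
    (fun r v => rint (L:=eq_language T) (s0:=N) (r:=r) v).

Definition lift_env (N : structure (eq_language T)) (X : Type)
    (g : X -> sorts L) (g' : X -> sorts (eq_language T))
    (hg : forall x, g' x = inl (g x)) (v : env N g') : env (reduct N) g :=
  fun x => castS (M:=N) (hg x) (v x).

Lemma term_lift (X : Type) (g : X -> sorts L)
  (g' : X -> sorts (eq_language T)) (hg : forall x, g' x = inl (g x)) s
  (t : term g s) :
  exists t' : term g' (inl s), forall (N : structure (eq_language T)) v,
    eval (M:=N) v t' = eval (lift_env hg v) t.
Proof.
elim: t => [x|f u IH].
  exists (castS (M:=term g') (hg x) (Var g' x)) => N v /=.
  by rewrite /lift_env; case: _ / (hg x).
pose u' i := projT1 (cid (IH i)).
exists (@App (eq_language T) _ g' (inl f) u') => N v /=.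
congr (fint (f:=inl f : Defs.fsym (eq_language T)) _); apply: env_ext => i.
exact: projT2 (cid (IH i)) N v.
Qed.

Lemma formula_lift (X : Type) (g : X -> sorts L) (p : formula g) :
  forall (g' : X -> sorts (eq_language T)) (hg : forall x, g' x = inl (g x)),
  exists p' : formula g', forall (N : structure (eq_language T)) v,
    sat (M:=N) p' v <-> sat p (lift_env hg v).
Proof.
elim: p => {X g} [X g s t u|X g q u|X g|X g p IHp q IHq|X g s p IH] g' hg.
- have [t' Et] := term_lift hg t; have [u' Eu] := term_lift hg u.
  by exists (Equal t' u') => M v /=; rewrite Et Eu.
- pose u' i := projT1 (cid (term_lift hg (u i))).
  exists (@Rel (eq_language T) _ g' q u') => M v /=.
  rewrite (_ : (fun i => eval v (u' i)) = fun i => eval (lift_env hg v) (u i)) //.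
  by apply: env_ext => i; apply: (projT2 (cid (term_lift hg (u i)))).
- by exists (Bot _).
- have [p' Ep] := IHp _ hg; have [q' Eq] := IHq _ hg.
  by exists (Imp p' q') => M v /=; rewrite Ep Eq.
- pose hg' o : scons (inl s) g' o = inl (scons s g o) :=
    match o with Some x => hg x | None => erefl end.
  have [p' Ep] := IH _ hg'.
  exists (@All (eq_language T) _ g' (inl s) p') => M v /=.
  have E d : lift_env hg' (econs d v) = econs (d : reduct M s) (lift_env hg v).
    by apply: env_ext => -[].
  by split=> H d; [rewrite -E -Ep | rewrite Ep E].
Qed.

Lemma fdef_lift (X : Type) (g : X -> sorts L) (D : forall M : structure L, env M g -> Prop)
  (g' : X -> sorts (eq_language T)) (hg : forall x, g' x = inl (g x)) :
  fdef (g:=g) D ->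
  fdef (g:=g') (fun N v => D (reduct N) (lift_env hg v)).
Proof.
move=> [p Ep]; have [p' Ep'] := formula_lift p hg.
by exists p' => N v; rewrite Ep' Ep.
Qed.

Lemma reduct_eq_embedding (M : structure L) :
  @embedding L M (reduct (eqs M)) (fun s x => x).
Proof. by split=> [s x y|f v|r v] //; split. Qed.

Definition reduct_eq_iso (M : structure L) : iso M (reduct (eqs M)) :=
  @Iso L M (reduct (eqs M)) (fun s x => x) (fun s x => x)
    (fun s x => erefl) (fun s x => erefl) (reduct_eq_embedding M).

Lemma fdef_transfer (M N : structure (eq_language T))
  (j : forall s, M s -> N s) (g : void -> sorts (eq_language T)) D :
  elementary j -> fdef (g:=g) D -> forall v w, D M v -> D N w.
Proof.
move=> hj [p Ep] v w /Ep/(hj _ _ p)/Ep.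
by rewrite (_ : emap j v = w) //; apply: env_ext => -[].
Qed.

Section Representation.
Variables (M : structure L) (hM : model T M) (N : structure (eq_language T)).
Variables (j : forall s, eqs M s -> N s) (hj : elementary j).
Let N0 := reduct N.

(** Dividing and forking look for witnesses in arbitrary elementary extensions of M^eq. This is the
    first step towards showing that such an [N] is N0^eq for the model [N0] on its home sorts. *)
Lemma reduct_model : model T N0.
Proof.
move=> p Tp.
pose g0 (x : void) : sorts L := match x with end.
pose g' (x : void) : sorts (eq_language T) := match x with end.
have hg (x : void) : g' x = inl (g0 x) by case: x.
have hp : fdef (g:=fun x : void => match x return sorts L with end)
  (fun M v => sat p v) by exists p.
pose h x : g' x = inl (match x return sorts L with end) :> sorts (eq_language T) :=
  match x with end.
have := fdef_transfer hj (fdef_lift h hp) (v := fun x => match x with end) (fun x => match x with end).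
rewrite /holds => H.
rewrite (_ : (fun _ => _) = lift_env h (fun x => match x with end)); last first.
  by apply: env_ext => -[].
apply: H.
have := sat_iso (reduct_eq_iso M) p (fun x => match x with end).
move=> E; have := hM Tp; rewrite /holds E.
by congr (sat _ _); apply: env_ext => -[].
Qed.

(** The equivalence, quantified over all tuples, is a sentence true in M^eq, hence in [N].
    Surjectivity of the projections is transferred in the same way. *)
Lemma rep_eq (E : Defs.eqrel T) (a b : env N0 (er_sort (e:=E))) :
  fint (L:=eq_language T) (s0:=N) (f:=inr E) a =
  fint (L:=eq_language T) (s0:=N) (f:=inr E) b <-> frel_of (er_form E) a b.
Proof.
pose g' (x : void) : sorts (eq_language T) := match x with end.
pose es := er_sort (e:=E).
pose h' (z : 'I_(er_ar E) + 'I_(er_ar E)) : sorts (eq_language T) :=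
  inl (scat es es z).
pose G := scat g' h'.
have h2 z : h' z = inl (scat es es z) by [].
pose D (N : structure (eq_language T)) (v : env N G) :=
  (fint (L:=eq_language T) (s0:=N) (f:=inr E) (fun i => v (inr (inl i))) =
   fint (L:=eq_language T) (s0:=N) (f:=inr E) (fun i => v (inr (inr i)))) <->
  sat (er_form E) (lift_env h2 (fun z => v (inr z))).
have hD : fdef (g:=G) D.
  apply: fdef_iff.
    exact: (fdef_eq (L:=eq_language T) (g:=G)
      (@App (eq_language T) _ G (inr E) (fun i => Var G (inr (inl i))))
      (@App (eq_language T) _ G (inr E) (fun i => Var G (inr (inr i))))).
  have h3 z : G (inr z) = h' z by [].
  have [p hp] := formula_lift (er_form E) h2.
  have [q hq] := formula_rename p h3.
  exists q => K v; rewrite hq hp.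
  rewrite (_ : precomp h3 v = fun z => v (inr z)) //.
  by apply: env_ext => z; apply: castS_id.
have := fdef_transfer hj (fdef_allenv hD) (v := fun x => match x with end)
  (fun x => match x with end).
move=> H; have {H} := H _ (fun z => match z with inl i => a i | inr i => b i end).
rewrite /D /= => H.
rewrite H; last first.
  move=> w; apply: iff_trans (eproj_eq (E:=E) (fun i => w (inl i))
    (fun i => w (inr i)) hM) _.
  rewrite /frel_of (sat_iso (reduct_eq_iso M)).
  rewrite (_ : emap _ _ = lift_env h2 (w : env (eqs M) h')) //.
  by apply: env_ext => -[] i; rewrite /lift_env castS_id.
rewrite /frel_of (_ : lift_env h2 _ = ecat a b) //.
by apply: env_ext => -[] i; rewrite /lift_env castS_id.
Qed.

Lemma rep_surj (E : Defs.eqrel T) (y : N (inr E)) :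
  exists a : env N0 (er_sort (e:=E)),
    y = fint (L:=eq_language T) (s0:=N) (f:=inr E) a.
Proof.
pose g' (x : void) : sorts (eq_language T) := match x with end.
pose g1 := scons (inr E : sorts (eq_language T)) g'.
pose h' i : sorts (eq_language T) := inl (er_sort (e:=E) i).
pose G := scat g1 h'.
have hD : fdef (g:=G) (fun N v => v (inl None) =
    fint (L:=eq_language T) (s0:=N) (f:=inr E) (fun i => v (inr i))).
  exact: (fdef_eq (L:=eq_language T) (g:=G) (Var G (inl None))
    (@App (eq_language T) _ G (inr E) (fun i => Var G (inr i)))).
have := fdef_transfer hj (fdef_all (fdef_exenv hD))
  (v := fun x => match x with end) (fun x => match x with end).
move=> H; apply: (H _ y) => d.
by have [a ->] := eproj_surj d; exists a.
Qed.

Definition rep_fun (s : sorts (eq_language T)) : eqs N0 s -> N s :=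
  match s return eqs N0 s -> N s with
  | inl s => fun x => x
  | inr E => fun C => fint (L:=eq_language T) (s0:=N) (f:=inr E)
      (projT1 (cid (eproj_surj C)))
  end.

Definition rep_inv (s : sorts (eq_language T)) : N s -> eqs N0 s :=
  match s return N s -> eqs N0 s with
  | inl s => fun x => x
  | inr E => fun y => eproj (projT1 (cid (rep_surj y)))
  end.

Lemma rep_funE (E : Defs.eqrel T) (a : env N0 (er_sort (e:=E))) :
  rep_fun (eproj a) = fint (L:=eq_language T) (s0:=N) (f:=inr E) a.
Proof.
apply/rep_eq; apply/(eproj_eq _ _ reduct_model); apply/esym.
exact: (projT2 (cid (eproj_surj (eproj a)))).
Qed.

Lemma rep_invK s : cancel (rep_inv (s:=s)) (rep_fun (s:=s)).
Proof.
case: s => [s|E] y //; rewrite /rep_inv rep_funE.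
exact/esym/(projT2 (cid (rep_surj y))).
Qed.

Lemma rep_inj s : injective (rep_fun (s:=s)).
Proof.
case: s => [s|E] // C D.
have [a ->] := eproj_surj C; have [b ->] := eproj_surj D.
by rewrite !rep_funE => /rep_eq h; apply/(eproj_eq _ _ reduct_model).
Qed.

Lemma rep_embedding : embedding rep_fun.
Proof. by split=> [s|[f|E] v|r v] //; [apply: rep_inj | apply: rep_funE]. Qed.

Definition rep_iso : iso (eqs N0) N :=
  Iso (fun s => inj_can_sym (rep_invK (s:=s)) (rep_inj (s:=s))) rep_invK
    rep_embedding.

End Representation.
End EqStructures.

(** * The theory *)

Lemma nat_fresh (l : seq nat) : exists x, x \notin l.
Proof.
exists (sumn l).+1; apply/negP => h.
suff: (sumn l).+1 <= sumn l by rewrite ltnn.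
elim: l (sumn l).+1 h => // y l IH x; rewrite inE => /predU1P[->|/IH h] /=.
  exact: leq_addr.
exact: leq_trans h (leq_addl _ _).
Qed.

Definition nat_inf : inf_type := InfType nat_fresh.

Section Models.
Variable n0 : nat.
Local Notation n := n0.+2.
Local Notation lang := (lang n0).
Local Notation cov := (cov n0).

Definition Tn : theory lang := fun p => holds (std n0 nat_inf) p.

Lemma Tn_complete : complete Tn.
Proof.
split; first by exists (std n0 nat_inf).
move=> p; have [h|h] := pselect (holds (std n0 nat_inf) p).
  by left=> M; apply.
by right=> M; apply; rewrite /Tn /holds.
Qed.

Definition sE (M : structure lang) (i j : 'I_n) (x y : M tt) : Prop :=
  rint (L:=lang) (s0:=M) (r:=Some (i, j)) (fun k => if k == ord0 then x else y).

Definition sR (M : structure lang) (v : 'I_n.+1 -> M tt) : Prop :=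
  rint (L:=lang) (s0:=M) (r:=None) v.

(** With the single sort [tt] environments are plain functions, and reindexing them needs no
    transport. *)
Definition odef (X : Type) (D : forall M : structure lang, (X -> M tt) -> Prop) :
  Prop := @fdef lang X (fun _ => tt) D.

Definition sumv (A X Y : Type) (v : X -> A) (w : Y -> A) (z : X + Y) : A :=
  match z with inl x => v x | inr y => w y end.

Lemma odef_all (X : Type) (Y : finType) D : @odef (X + Y) D ->
  @odef X (fun M v => forall w : Y -> M tt, D M (sumv v w)).
Proof.
move=> h.
have e (z : X + Y) : scat (fun=> tt) (fun=> tt) z = tt by case: z.
have := @fdef_ren lang (X + Y) (X + Y) (fun=> tt) (scat (fun=> tt) (fun=> tt))
  id e D h.
move/fdef_allenv; apply: fdef_ext => M v.
have E w : precomp (M:=M) (r:=id) e (ecat v w) = sumv v w.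
  by apply: env_ext => -[] z; apply: castS_id.
by split=> H w; have := H w; rewrite E.
Qed.

Lemma odef_ex (X : Type) (Y : finType) D : @odef (X + Y) D ->
  @odef X (fun M v => exists w : Y -> M tt, D M (sumv v w)).
Proof.
move=> /fdef_not/odef_all/fdef_not; apply: fdef_ext => M v.
by rewrite not_existsP.
Qed.

Lemma odef_E (X : Type) i j (x y : X) :
  @odef X (fun M v => sE i j (v x) (v y)).
Proof.
pose u (k : 'I_2) : term (L:=lang) (fun _ : X => tt) tt :=
  if k == ord0 then Var (L:=lang) (fun _ => tt) x else Var (L:=lang) (fun _ => tt) y.
have := @fdef_rel lang X (fun=> tt) (Some (i, j)) u.
apply: fdef_ext => M v; rewrite /sE.
rewrite (_ : (fun _ => _) = fun k : 'I_2 => if k == ord0 then v x else v y) //.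
by apply: env_ext => k; rewrite /u; case: ifP.
Qed.

Lemma odef_R (X : Type) (x : 'I_n.+1 -> X) :
  @odef X (fun M v => sR (fun k => v (x k))).
Proof.
exact: (@fdef_rel lang X (fun=> tt) None
  (fun k => Var (L:=lang) (fun _ => tt) (x k))).
Qed.

Lemma odef_eq (X : Type) (x y : X) : @odef X (fun M v => v x = v y).
Proof.
exact: (@fdef_eq lang X (fun=> tt) tt (Var (L:=lang) (fun _ => tt) x)
  (Var (L:=lang) (fun _ => tt) y)).
Qed.

Lemma finite_type_fun (I J : finType) : finite_type (I -> J).
Proof.
have [k [f fP]] := finite_type_finType ({ffun I -> J} : finType).
exists k, (fun i (x : I) => (f i : {ffun I -> J}) x) => g _; have [i ei] := fP (finfun g) Logic.I; exists i.
by apply: funext => x; rewrite -ei ffunE.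
Qed.

Lemma finite_type_cov (I : finType) : finite_type (cov I).
Proof. exact: (finite_type_finType ((n.-tuple I * bool)%type : finType)). Qed.

Lemma finite_type_covs (I : finType) : finite_type ('I_n.+1 -> cov I).
Proof. exact: (finite_type_fun 'I_n.+1 ((n.-tuple I * bool)%type : finType)). Qed.

(** A copy of the trivial cover of [I] inside [M]. For finite [I] this is a first-order condition on
    finitely many elements. *)
Definition frame (M : structure lang) (I : Type) (h : cov I -> M tt) : Prop :=
  [/\ forall i j x y, sE i j (h x) (h y) <-> vtx i x = vtx j y,
      forall v, sR (fun k => h (v k)) <-> cR v &
      forall x y, h x = h y -> x = y].

Lemma odef_frame (X : Type) (I : finType) (e : cov I -> X) :
  @odef X (fun M v => frame (fun x => v (e x))).
Proof.
have h1 : @odef X (fun M v => forall i j x y,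
    sE i j (v (e x)) (v (e y)) <-> vtx i x = vtx j y).
  do 2 (refine (fdef_fin (finite_type_finType _) _) => ?).
  do 2 (refine (fdef_fin (finite_type_cov _) _) => ?).
  by apply: fdef_iff; [apply: odef_E | apply: fdef_const].
have h2 : @odef X (fun M v => forall f : 'I_n.+1 -> cov I,
    sR (fun k => v (e (f k))) <-> cR f).
  apply: fdef_fin => [|f]; first exact: finite_type_covs.
  by apply: fdef_iff; [apply: odef_R | apply: fdef_const].
have h3 : @odef X (fun M v => forall x y, v (e x) = v (e y) -> x = y).
  do 2 (refine (fdef_fin (finite_type_cov _) _) => ?).
  by apply: fdef_imp; [apply: odef_eq | apply: fdef_const].
apply: fdef_ext (fdef_and h1 (fdef_and h2 h3)) => M v.
by split=> [[? []]|[]].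
Qed.

Lemma frame_amap (Om : inf_type) (I : eqType) (k : I -> Om) f : injective k ->
  cocycle n0 f -> frame (M:=std n0 Om) (amap k f).
Proof.
move=> kI hf; pose S (x : I) := True.
have kI' x y : S x -> S y -> k x = k y -> x = y by move=> _ _ /kI.
split=> [i j x y|v|x y]; last exact: (amap_inj kI').
  by rewrite /sE /= !vtx_amap; split=> [/kI|->].
by apply: (cR_amap kI') => // u su _; apply: hf.
Qed.

Section Consequences.
Variables (M : structure lang) (hM : model Tn M).

(** Axioms of the theory are produced by checking a definable property in the standard model over
    the natural numbers. *)
Lemma Tn_transfer (Y : finType) D : @odef Y D ->
  (forall w, D (std n0 nat_inf) w) -> forall w, D M w.
Proof.
move=> hD H w.
have hD' : @odef (void + Y) (fun M v => D M (fun y => v (inr y))).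
  have := @fdef_ren lang Y (void + Y) (fun=> tt) (fun=> tt) inr (fun=> erefl) D hD.
  exact: fdef_ext.
have e (x : void) : match x return unit with end = tt by case: x.
have := @fdef_ren lang void void (fun=> tt) (fun x => match x return unit with end)
  id e _ (odef_all hD').
move=> [p hp].
have: holds M p by apply: hM; rewrite /Tn /holds hp => w'; apply: H.
by rewrite /holds hp; apply.
Qed.

Lemma ax_equiv (x y z : M tt) i j k :
  [/\ sE i i x x, sE i j x y -> sE j i y x & sE i j x y -> sE j k y z -> sE i k x z].
Proof.
pose o0 : 'I_3 := ord0; pose o1 : 'I_3 := Ordinal (isT : 1 < 3).
pose o2 : 'I_3 := Ordinal (isT : 2 < 3).
pose D (M : structure lang) (w : 'I_3 -> M tt) :=
  sE i i (w o0) (w o0) /\ ((sE i j (w o0) (w o1) -> sE j i (w o1) (w o0)) /\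
  (sE i j (w o0) (w o1) -> sE j k (w o1) (w o2) -> sE i k (w o0) (w o2))).
have hD : odef D.
  apply: fdef_and; first exact: odef_E.
  apply: fdef_and; first by apply: fdef_imp; apply: odef_E.
  by do 2?[apply: fdef_imp]; apply: odef_E.
have [|h1 [h2 h3]] := Tn_transfer hD _
  (fun i => if i == o0 then x else if i == o1 then y else z).
  by move=> w; rewrite /D /sE /=; split=> //; split=> [->|->].
by split.
Qed.

Lemma ax_vertex (x : M tt) i : exists y, sE ord0 i y x.
Proof.
pose D (M : structure lang) (w : unit -> M tt) :=
  exists y : unit -> M tt, sE ord0 i (y tt) (w tt).
have hD : odef D.
  apply: (@odef_ex unit unit (fun M u => sE ord0 i (u (inr tt)) (u (inl tt)))).
  exact: odef_E.
have [|y hy] := Tn_transfer hD _ (fun=> x).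
  move=> w; exists (fun=> (nseq_tuple n (vtx i (w tt : cov nat)), false)).
  by rewrite /sE /= {1}/vtx tnth_nseq.
by exists (y tt).
Qed.

Lemma ax_compat (v : 'I_n.+1 -> M tt) : sR v ->
  forall (k l : 'I_n.+1) (i j : 'I_n), bump k i = bump l j -> sE i j (v k) (v l).
Proof.
apply: (Tn_transfer (D := fun M v => sR v -> forall (k l : 'I_n.+1) (i j : 'I_n),
  bump k i = bump l j -> sE i j (v k) (v l))).
  apply: fdef_imp; first exact: odef_R.
  do 4 (refine (fdef_fin (finite_type_finType _) _) => ?).
  by apply: fdef_imp; [apply: fdef_const | apply: odef_E].
by move=> w [h _] k l i j e; apply: h.
Qed.

Lemma ax_fibre (x y z : M tt) :
  (forall i, sE i i x y) -> (forall i, sE i i x z) -> x = y \/ x = z \/ y = z.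
Proof.
pose o0 : 'I_3 := ord0; pose o1 : 'I_3 := Ordinal (isT : 1 < 3).
pose o2 : 'I_3 := Ordinal (isT : 2 < 3).
pose D (M : structure lang) (w : 'I_3 -> M tt) :=
  (forall i, sE i i (w o0) (w o1)) -> (forall i, sE i i (w o0) (w o2)) ->
  w o0 = w o1 \/ w o0 = w o2 \/ w o1 = w o2.
have hD : odef D.
  do 2 (apply: fdef_imp;
    first by refine (fdef_fin (finite_type_finType _) _) => ?; exact: odef_E).
  by do 2?[apply: fdef_or]; apply: odef_eq.
have := Tn_transfer hD _ (fun i => if i == o0 then x else if i == o1 then y else z).
apply=> w e1 e2.
have E1 : (w o0 : cov nat).1 = (w o1 : cov nat).1 by apply: eq_from_tnth => i; apply: e1.
have E2 : (w o0 : cov nat).1 = (w o2 : cov nat).1 by apply: eq_from_tnth => i; apply: e2.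
case: (w o0) (w o1) (w o2) E1 E2 => [t b] [t1 b1] [t2 b2] /= <- <-.
by case: b b1 b2 => [] [] []; auto.
Qed.

(** The cover is trivial over every finite set of vertices. This local triviality, a first-order
    scheme, drives the classification of the models. *)
Lemma ax_frame r (p : 'I_r -> M tt) :
  (forall a b, a != b -> ~ sE ord0 ord0 (p a) (p b)) ->
  exists2 h : cov 'I_r -> M tt, frame h &
    forall x i, sE i ord0 (h x) (p (vtx i x)).
Proof.
pose D (M : structure lang) (p : 'I_r -> M tt) :=
  (forall a b, a != b -> ~ sE ord0 ord0 (p a) (p b)) ->
  exists h : (n.-tuple 'I_r * bool)%type -> M tt, frame (h : cov _ -> _) /\
    forall (x : cov 'I_r) i, sE i ord0 (h x) (p (vtx i x)).
have hD : odef D.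
  apply: fdef_imp.
    do 2 (refine (fdef_fin (finite_type_finType _) _) => ?).
    by apply: fdef_imp; [apply: fdef_const | apply: fdef_not; apply: odef_E].
  apply: (@odef_ex 'I_r (n.-tuple 'I_r * bool)%type (fun M u =>
    let h x := u (inr x) in frame (h : cov _ -> _) /\
    forall (x : cov 'I_r) i, sE i ord0 (h x) (u (inl (vtx i x))))).
  apply: fdef_and; first exact: odef_frame.
  refine (fdef_fin (finite_type_cov _) _) => ?.
  by refine (fdef_fin (finite_type_finType _) _) => ?; exact: odef_E.
move=> hp.
have [|h [h1 h2]] := Tn_transfer hD _ p hp; last by exists h.
move=> q hq; exists (amap (fun a => vtx ord0 (q a : cov nat)) (fun=> false)).
split; last by move=> x i; rewrite /sE /= vtx_amap.
apply: (@frame_amap nat_inf); last exact: cocycle0.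
by move=> a b e; apply: contrapT => /eqP/hq; apply.
Qed.

Lemma ax_infinite r : exists p : 'I_r -> M tt,
  forall a b, a != b -> ~ sE ord0 ord0 (p a) (p b).
Proof.
pose D (M : structure lang) (v : void -> M tt) := exists p : 'I_r -> M tt,
  forall a b, a != b -> ~ sE ord0 ord0 (p a) (p b).
have hD : odef D.
  apply: (@odef_ex void 'I_r (fun M u => forall a b, a != b ->
    ~ sE ord0 ord0 (u (inr a)) (u (inr b)))).
  do 2 (refine (fdef_fin (finite_type_finType _) _) => ?).
  by apply: fdef_imp; [apply: fdef_const | apply: fdef_not; apply: odef_E].
apply: (Tn_transfer hD _ (fun x : void => match x with end)) => v0.
exists (fun a : 'I_r => (nseq_tuple n (val a), false)) => a b ne.
rewrite /sE /= /vtx !tnth_nseq => e; case/eqP: ne; exact: val_inj.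
Qed.

End Consequences.
End Models.
Arguments Tn : clear implicits.

(** * Classification of the models *)

Section Classification.
Variables (n0 : nat) (M : structure (lang n0)) (hM : model (Tn n0) M).
Local Notation n := n0.+2.
Local Notation cov := (cov n0).

(** The quotient of [M] by E_00. By [ax_vertex] the other coordinates of an element give classes of
    the same kind. *)
Definition vertex_set : Type :=
  {C : M tt -> Prop | exists p, C = fun q => sE ord0 ord0 q p}.
Definition vertices : eqType := {classic vertex_set}.

Lemma vt_exists (i : 'I_n) (x : M tt) :
  exists p, (fun q => sE ord0 i q x) = fun q => sE ord0 ord0 q p.
Proof.
have [p px] := ax_vertex hM x i; exists p.
apply: funext => q; apply: propext.
have [_ s _] := ax_equiv hM p x x ord0 i i.
have [_ _ t] := ax_equiv hM q x p ord0 i ord0.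
have [_ _ t'] := ax_equiv hM q p x ord0 ord0 i.
by split=> h; [apply: t h (s px) | apply: t' h px].
Qed.

Definition vt (i : 'I_n) (x : M tt) : vertices :=
  exist _ (fun q => sE ord0 i q x) (vt_exists i x).

Lemma vt_eq i j x y : vt i x = vt j y <-> sE i j x y.
Proof.
have [p px] := ax_vertex hM x i; split=> [/(congr1 (fun C => sval C p)) /= e|h].
  have [_ s _] := ax_equiv hM p x x ord0 i i.
  have [_ _ t] := ax_equiv hM x p y i ord0 j.
  by apply: t (s px) _; rewrite -e.
apply: sig_eq; apply: funext => q; apply: propext => /=.
have [_ s _] := ax_equiv hM x y x i j i.
have [_ _ t] := ax_equiv hM q x y ord0 i j.
have [_ _ t'] := ax_equiv hM q y x ord0 j i.
by split=> k; [apply: t k h | apply: t' k (s h)].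
Qed.

Lemma vt_surj (o : vertices) : exists p, o = vt ord0 p.
Proof. by case: o => C [p e]; exists p; apply: sig_eq. Qed.

Lemma vertices_fresh (l : seq vertices) : exists x, x \notin l.
Proof.
have [p hp] := ax_infinite hM (size l).+1.
apply: contrapT => no.
have hl a : vt ord0 (p a) \in l by apply: contrapT => h; apply: no; exists (vt ord0 (p a)); apply/negP.
have: uniq [seq vt ord0 (p a) | a <- enum 'I_(size l).+1].
  rewrite map_inj_uniq ?enum_uniq // => a b /vt_eq; apply: contraPeq; exact: hp.
move=> /uniq_leq_size h; have := h l.
rewrite size_map size_enum_ord ltnn => K; suff: false by [].
by apply: K => _ /mapP[a _ ->].
Qed.

Definition vertices_inf : inf_type := InfType vertices_fresh.

Lemma vertices_frame (o : vertices) (l : seq vertices) : uniq (o :: l) ->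
  exists2 h : cov 'I_(size l).+1 -> M tt, frame h &
    forall x i, vt i (h x) = nth o (o :: l) (vtx i x).
Proof.
move=> ul.
pose p (a : 'I_(size l).+1) := projT1 (cid (vt_surj (nth o (o :: l) a))).
have hp (a : 'I_(size l).+1) : nth o (o :: l) a = vt ord0 (p a) := projT2 (cid (vt_surj _)).
have [a b ne /vt_eq|h fh hh] := ax_frame hM (p := p).
  rewrite -!hp => /eqP; rewrite nth_uniq //.
  by move=> /eqP/val_inj e; rewrite e eqxx in ne.
by exists h => // x i; rewrite hp; apply/vt_eq.
Qed.

Definition position (o : vertices) (l : seq vertices) (y : vertices) :
  'I_(size l).+1 := inord (index y (o :: l)).

Lemma positionK (o : vertices) (l : seq vertices) y : y \in o :: l ->
  nth o (o :: l) (position o l y) = y.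
Proof.
move=> h; rewrite /position inordK ?nth_index //.
by rewrite -(index_mem y (o :: l)) in h.
Qed.

Lemma cover_seq (s : seq vertices) : 0 < size s ->
  exists o l, uniq (o :: l) /\ {subset s <= o :: l}.
Proof.
case: s => // x s _; have := mem_undup (x :: s); have := undup_uniq (x :: s).
case: (undup (x :: s)) => [|o l] ul hm; first by have := hm x; rewrite inE eqxx.
by exists o, l; split=> // y; rewrite hm.
Qed.

Lemma fibre_exists (t : n.-tuple vertices) : exists x y,
  [/\ x <> y, forall i, vt i x = tnth t i & forall i, vt i y = tnth t i].
Proof.
have [|o [l [ul sl]]] := cover_seq (s := t); first by rewrite size_tuple.
have [h [hE hR hI] hh] := vertices_frame ul.
pose u := map_tuple (position o l) t.
exists (h (u, false)), (h (u, true)); split=> [/hI //|i|i];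
  by rewrite hh /vtx tnth_map positionK // sl // mem_tnth.
Qed.

Definition fibre0 (t : n.-tuple vertices) : M tt := projT1 (cid (fibre_exists t)).
Definition fibre1 (t : n.-tuple vertices) : M tt :=
  projT1 (cid (projT2 (cid (fibre_exists t)))).

(** The bits are assigned to each fibre arbitrarily, without regard to R; [defect] measures the
    resulting error. *)
Definition section0 (x : cov vertices) : M tt :=
  if x.2 then fibre1 x.1 else fibre0 x.1.

Lemma vt_section0 i x : vt i (section0 x) = vtx i x.
Proof.
rewrite /section0 /fibre1 /fibre0 /vtx.
have [_ e1 e2] := projT2 (cid (projT2 (cid (fibre_exists x.1)))).
by case: x.2; [apply: e2 | apply: e1].
Qed.

Lemma section0_inj x y : section0 x = section0 y -> x = y.
Proof.
move=> e.
have ev i : vtx i x = vtx i y by rewrite -!vt_section0 e.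
apply: cov_ext => //; move: e; rewrite /section0.
have e1 : x.1 = y.1 by apply: eq_from_tnth.
rewrite e1 /fibre1 /fibre0.
have [ne _ _] := projT2 (cid (projT2 (cid (fibre_exists y.1)))).
by case: x.2 y.2 => [] [] // e; case: ne.
Qed.

Lemma section0_surj m : exists x, m = section0 x.
Proof.
pose t := [tuple vt i m | i < n].
have et b i : sE i i m (section0 (t, b)).
  by apply/vt_eq; rewrite vt_section0 /vtx tnth_mktuple.
case: (ax_fibre hM (et false) (et true)) => [|[|/section0_inj //]] e.
  by exists (t, false).
by exists (t, true).
Qed.

(** A frame over the finite list [o :: l] trivialises R there, and the arbitrary choice [section0]
    differs from it by one bit per fibre, which is [b]. *)
Lemma section0_frame (o : vertices) (l : seq vertices) : uniq (o :: l) ->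
  exists b : seq vertices -> bool, forall v : 'I_n.+1 -> cov vertices,
    (forall k, lies_in (fun y => y \in o :: l) (v k)) ->
    sR (fun k => section0 (v k)) <->
    cR (fun k => ((v k).1, (v k).2 (+) b (v k).1)).
Proof.
move=> ul; have [h fh hh] := vertices_frame ul; have [hE hR hI] := fh.
pose idx (x : cov vertices) : cov 'I_(size l).+1 := amap (position o l) (fun=> false) x.
have vidx x : lies_in (fun y => y \in o :: l) x -> forall i, vt i (h (idx x)) = vtx i x.
  by move=> ox i; rewrite hh vtx_amap positionK.
have sh x : lies_in (fun y => y \in o :: l) x ->
    exists b, section0 x = h (idx (x.1, b)).
  move=> ox.
  have e b : lies_in (fun y => y \in o :: l) (x.1, b) by [].
  have E b i : sE i i (section0 x) (h (idx (x.1, b))).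
    by apply/vt_eq; rewrite vidx // vt_section0.
  have [->|[->|]] := ax_fibre hM (E false) (E true).
  - by exists false.
  - by exists true.
  - by move/hI => /(congr1 snd).
pose b w := if insub w is Some t then
  `[< section0 (t : n.-tuple _, false) = h (idx (t, true)) >] else false.
have bE x : lies_in (fun y => y \in o :: l) x ->
    section0 x = h (idx (x.1, x.2 (+) b x.1)).
  move=> ox; rewrite /b valK.
  have e c : lies_in (fun y => y \in o :: l) (x.1, c) by [].
  have [c0 h0] := sh _ (e false); have [c1 h1] := sh _ (e true).
  have c01 : c1 = ~~ c0.
    have: section0 (x.1, false) <> section0 (x.1, true) by move/section0_inj.
    by rewrite h0 h1 /=; case: c0 c1 {h0 h1} => [] [] //=.
  have -> : `[< section0 (x.1, false) = h (idx (x.1, true)) >] = c0.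
    rewrite h0 /=; case: c0 {h0 c01}; first by apply/asboolP.
    by apply/asboolPn => /hI/(congr1 snd).
  by case: x {ox e sh} h0 h1 => t [] /= h0 h1; rewrite ?h1 ?h0 ?c01.
exists b => v hv.
have -> : (fun k => section0 (v k)) =
    fun k => h (idx ((v k).1, (v k).2 (+) b (v k).1)).
  by apply: funext => k; apply: bE.
rewrite hR; apply: (@cR_amap n0 _ _ (fun y => y \in o :: l)) => //.
- move=> x y xl yl /(congr1 (fun i : 'I_(size l).+1 => nth o (o :: l) i)).
  by rewrite !positionK.
- by move=> u _ _; apply: cobd0.
Qed.

Definition defect (u : seq vertices) : bool :=
  if insub u is Some t then
    `[< ~ sR (fun k => section0 (face_tuple k (t : n.+1.-tuple _), false)) >]
  else false.

Lemma lies_in_face (S : vertices -> Prop) (u : n.+1.-tuple vertices) k b :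
  (forall x, x \in u -> S x) -> lies_in S (face_tuple k u, b).
Proof.
by move=> h; apply/lies_inP => y /(mem_subseq (face_subseq _ _)); apply: h.
Qed.

Lemma section0_R (o : vertices) (l : seq vertices) : uniq (o :: l) ->
  exists b : seq vertices -> bool,
    (forall u, size u = n.+1 -> {subset u <= o :: l} -> defect u = cobd u b) /\
    forall (u : n.+1.-tuple vertices) (c : 'I_n.+1 -> bool), {subset u <= o :: l} ->
      (sR (fun k => section0 (face_tuple k u, c k)) <->
       \big[addb/false]_k c k = cobd u b).
Proof.
move=> ul; have [b hb] := section0_frame ul.
have H (u : n.+1.-tuple vertices) (c : 'I_n.+1 -> bool) : {subset u <= o :: l} ->
      (sR (fun k => section0 (face_tuple k u, c k)) <->
       \big[addb/false]_k c k = cobd u b).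
  move=> su; rewrite hb; last by move=> k; apply: lies_in_face.
  rewrite /cR /= big_split /= -cobd_faces.
  split=> [[_]|->]; last by rewrite addbb; split=> //; apply: compat_faces.
  by case: (\big[_/_]_k c k); case: (cobd u b).
exists b; split=> // u su ul'.
pose t : n.+1.-tuple vertices := @Tuple n.+1 _ u (introT eqP su).
rewrite /defect -[u]/(val t) valK.
have := H t (fun=> false) ul'; rewrite big1 // => E.
case: (boolP (cobd u b)) => c.
  by apply/asboolP => /E; rewrite /= c.
by apply: asboolF => ne; apply: ne; apply/E; rewrite /= (negbTE c).
Qed.

(** On each finite set of vertices the defect is a coboundary, with a primitive depending on the
    set. So it is a cocycle, and its cone is a primitive on all vertices at once. *)
Lemma defect_cobd : exists g : seq vertices -> bool,
  forall u, size u = n.+1 -> cobd u g = defect u.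
Proof.
have [o _] := inf_fresh (i := vertices_inf) [::].
exists (fun w => defect (o :: w)) => u su.
rewrite cobd_cone; suff -> : cobd (o :: u) defect = false by rewrite addbF.
have [//|o' [l [ul sl]]] := @cover_seq (o :: u).
have [b [hb _]] := section0_R ul.
rewrite -(cobd_cobd (o :: u) b); apply: eq_cobd => w sw wu; apply: hb.
  by rewrite sw /= su.
by move=> y /(mem_subseq wu)/sl.
Qed.

Let g := projT1 (cid defect_cobd).
Let gP : forall u, size u = n.+1 -> cobd u g = defect u := projT2 (cid defect_cobd).

Definition trivialisation (x : cov vertices) : M tt := section0 (amap id g x).

Lemma trivialisation_bij : exists k, cancel trivialisation k /\ cancel k trivialisation.
Proof.
have gK (x : cov vertices) : amap id g (amap id g x) = x.
  by apply: cov_ext => [i|]; rewrite ?vtx_amap //= map_id addbK.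
pose k m := amap id g (projT1 (cid (section0_surj m))).
have kK m : trivialisation (k m) = m.
  by rewrite /trivialisation gK -(projT2 (cid (section0_surj m))).
exists k; split=> // x; apply: (can_inj gK); apply: section0_inj; exact: kK.
Qed.

Lemma trivialisation_R v : sR (fun k => trivialisation (v k)) <-> cR v.
Proof.
have step : compat v -> sR (fun k => trivialisation (v k)) <->
    \big[addb/false]_k (v k).2 = false.
  move=> /compat_simplex[u hu].
  have [|o [l [ul sl]]] := @cover_seq u; first by rewrite size_tuple.
  have [b [h1 h2]] := section0_R ul.
  have -> : (fun k => trivialisation (v k)) =
      fun k => section0 (face_tuple k u, (v k).2 (+) g (face_tuple k u)).
    apply: funext => k; congr section0; apply: cov_ext => [i|] /=; last by rewrite hu.
    by rewrite vtx_amap /vtx hu.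
  rewrite h2 // big_split /= -cobd_faces gP ?size_tuple // h1 ?size_tuple //.
  by case: (\big[_/_]_k _); case: (cobd u b).
split=> [h|[hv s]]; last by apply/step.
have hv : compat v.
  move=> k l i j e; have /vt_eq := ax_compat hM h e.
  by rewrite !vt_section0 !vtx_amap.
by split=> //; apply/step.
Qed.

Lemma trivialisation_embedding :
  @embedding (lang n0) (std n0 vertices_inf) M
    (fun s => match s with tt => trivialisation end).
Proof.
split=> [[] x y|[]|[[i j]|] v].
- by have [k [kK _]] := trivialisation_bij; apply: (can_inj kK).
- have := vt_eq i j (trivialisation (v ord0)) (trivialisation (v ord_max)).
  rewrite !vt_section0 !vtx_amap /= => ->; rewrite /sE.
  rewrite (_ : (fun _ => _) = emap (M:=std n0 vertices_inf) (N:=M)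
    (fun s => match s with tt => trivialisation end) v) //.
  apply: env_ext => -[[|[|//]] h] /=; congr trivialisation; congr (v _); exact: val_inj.
- by rewrite -[X in _ <-> X]/(sR (fun k => trivialisation (v k))) trivialisation_R.
Qed.

Lemma model_std : exists Om : inf_type, inhabited (iso (std n0 Om) M).
Proof.
have [k [k1 k2]] := trivialisation_bij.
exists vertices_inf; split.
pose k' (s : sorts (lang n0)) : M s -> std n0 vertices_inf s :=
  match s with tt => k end.
by apply: (@Iso _ _ _ _ k' _ _ trivialisation_embedding) => -[].
Qed.
End Classification.

(** * Supports of imaginaries *)

Lemma sum_fresh (Om Om' : inf_type) (l : seq (Om + Om')%type) :
  exists x, x \notin l.
Proof.
have inlI : injective (@inl Om Om') by move=> x y [].
by have [y _ hy] := image_fresh inlI l; exists y.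
Qed.

Definition sum_inf (Om Om' : inf_type) : inf_type := InfType (@sum_fresh Om Om').

Section Supports.
Variable n0 : nat.
Local Notation n := n0.+2.
Local Notation cov := (cov n0).
Local Notation T := (Tn n0).

Record cemb (Om Om' : inf_type) := Cemb {
  ek : Om -> Om';
  ekI : injective ek;
  ef : seq Om -> bool;
  efP : cocycle n0 ef }.

Definition emb_act (Om Om' : inf_type) (e : cemb Om Om') : cov Om -> cov Om' :=
  amap (ek e) (ef e).

Lemma emb_elementary (Om Om' : inf_type) (e : cemb Om Om') :
  @elementary (lang n0) (std n0 Om) (std n0 Om') (fun _ => emb_act e).
Proof. by apply: amap_elementary; [apply: ekI | apply: efP]. Qed.

Definition emb_inl (Om Om' : inf_type) : cemb Om (sum_inf Om Om') :=
  @Cemb Om (sum_inf Om Om') inl (fun x y e => let: erefl := e in erefl) _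
    (@cocycle0 n0 Om).
Definition emb_inr (Om Om' : inf_type) : cemb Om' (sum_inf Om Om') :=
  @Cemb Om' (sum_inf Om Om') inr (fun x y e => let: erefl := e in erefl) _
    (@cocycle0 n0 Om').

(** Both [nat_inf] and [Om] embed elementarily into the cover of their disjoint sum. *)
Lemma std_model (Om : inf_type) : model T (std n0 Om).
Proof.
move=> p; rewrite /T /holds => h.
have := emb_elementary (emb_inr nat_inf Om) p (fun x => match x with end).
have := emb_elementary (emb_inl nat_inf Om) p (fun x => match x with end).
set v := emap _ _; set w := emap _ _; have -> : v = w by apply: env_ext => -[].
by move=> <- [_]; apply.
Qed.

Definition stdeq (Om : inf_type) : structure (eq_language T) :=
  eq_structure T (std n0 Om).

Definition eact (Om Om' : inf_type) (e : cemb Om Om') :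
    forall s, stdeq Om s -> stdeq Om' s :=
  eqmap (@std_model Om) (@std_model Om') (emb_elementary e).

(** A home element is treated as the class of a 1-tuple, so that every element of M^eq is [pr] of a
    finite tuple. *)
Definition arity (s : sorts (eq_language T)) : nat :=
  match s with inl _ => 1 | inr E => er_ar E end.

Definition coord_sort (s : sorts (eq_language T)) : 'I_(arity s) -> unit :=
  match s return 'I_(arity s) -> unit with
  | inl s => fun _ => s
  | inr E => er_sort (e:=E)
  end.

Definition pr (Om : inf_type) (s : sorts (eq_language T)) :
    ('I_(arity s) -> cov Om) -> stdeq Om s :=
  match s return ('I_(arity s) -> cov Om) -> stdeq Om s with
  | inl _ => fun A => A ord0
  | inr E => fun A => eproj (A : env (std n0 Om) (er_sort (e:=E)))
  end.

Lemma pr_surj (Om : inf_type) s (e : stdeq Om s) : exists A, e = pr A.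
Proof.
case: s e => [s|E] e; first by exists (fun=> e).
by have [a ea] := eproj_surj (M:=std n0 Om) e; exists a.
Qed.

Lemma eact_pr (Om Om' : inf_type) (e : cemb Om Om') s (A : 'I_(arity s) -> cov Om) :
  eact e (pr A) = pr (fun i => emb_act e (A i)).
Proof. by case: s A => [s|E] A //; apply: eqmap_proj. Qed.

Definition vl (Om : inf_type) k (A : 'I_k -> cov Om) : seq Om :=
  flatten [seq vtxs (A i) | i <- enum 'I_k].

Lemma vlP (Om : inf_type) k (A : 'I_k -> cov Om) i :
  lies_in (fun y => y \in vl A) (A i).
Proof.
apply/lies_inP => y hy; apply/flattenP; exists (vtxs (A i)) => //.
by apply/mapP; exists i; rewrite ?mem_enum.
Qed.

Lemma vl_lies (Om : inf_type) k (A : 'I_k -> cov Om) (S : Om -> Prop) :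
  (forall i, lies_in S (A i)) -> forall y, y \in vl A -> S y.
Proof.
move=> h y /flattenP[s /mapP[i _ ->]] hy.
by have /lies_inP := h i; apply.
Qed.

Lemma eact_inj (Om Om' : inf_type) (e : cemb Om Om') s : injective (eact e (s:=s)).
Proof.
apply: emb_inj; apply: eqmap_embedding; apply: amap_embedding.
  exact: ekI.
exact: efP.
Qed.

Lemma comp_cocycle (Om Om' Om'' : inf_type) (d : cemb Om Om') (e : cemb Om' Om'') :
  cocycle n0 (fun w => ef d w (+) ef e (map (ek d) w)).
Proof.
by move=> u su; rewrite cobd_add -cobd_map !efP // size_map.
Qed.

Definition emb_comp (Om Om' Om'' : inf_type) (d : cemb Om Om')
    (e : cemb Om' Om'') : cemb Om Om'' :=
  Cemb (inj_comp (ekI (c:=e)) (ekI (c:=d))) (comp_cocycle d e).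

Lemma emb_act_comp (Om Om' Om'' : inf_type) (d : cemb Om Om')
  (e : cemb Om' Om'') x :
  emb_act (emb_comp d e) x = emb_act e (emb_act d x).
Proof. by rewrite /emb_act amap_comp. Qed.

Lemma eact_comp (Om Om' Om'' : inf_type) (d : cemb Om Om')
  (e : cemb Om' Om'') s (x : stdeq Om s) :
  eact (emb_comp d e) x = eact e (eact d x).
Proof. by apply: eqmap_comp => t y; apply: emb_act_comp. Qed.

Definition emb_of_aut (Om : inf_type) (a : aut n0 Om) : cemb Om Om :=
  Cemb (aperm_inj (a:=a)) (acocP a).
Coercion emb_of_aut : aut >-> cemb.

Lemma eact_autK (Om : inf_type) (a : aut n0 Om) s :
  cancel (eact a (s:=s)) (eact (aut_inv a) (s:=s)).
Proof.
move=> x; rewrite -eact_comp; apply: eqmap_id => t y.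
by rewrite emb_act_comp; apply: aut_invK.
Qed.

Lemma eact_autK' (Om : inf_type) (a : aut n0 Om) s :
  cancel (eact (aut_inv a) (s:=s)) (eact a (s:=s)).
Proof.
move=> x; rewrite -eact_comp; apply: eqmap_id => t y.
by rewrite emb_act_comp; apply: aut_Kinv.
Qed.

Definition eaut (Om : inf_type) (a : aut n0 Om) : iso (stdeq Om) (stdeq Om) :=
  Iso (eact_autK a) (eact_autK' a)
    (eqmap_embedding (@std_model Om) (@std_model Om) (emb_elementary a)
      (amap_embedding (aperm_inj (a:=a)) (acocP a))).

Definition agree (Om Om' : inf_type) (l : seq Om) (d e : cemb Om Om') : Prop :=
  forall x, lies_in (fun y => y \in l) x -> emb_act d x = emb_act e x.

Definition diag (Om : Type) (x : Om) : cov Om := (nseq_tuple n x, false).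

Lemma vtx_diag (Om : Type) i (x : Om) : vtx i (diag x) = x.
Proof. by rewrite /vtx tnth_nseq. Qed.

Lemma diag_lies (Om : Type) (S : Om -> Prop) x : S x -> lies_in S (diag x).
Proof. by move=> Sx i; rewrite vtx_diag. Qed.

Lemma agree_ek (Om Om' : inf_type) (l : seq Om) (d e : cemb Om Om') x :
  agree l d e -> x \in l -> ek d x = ek e x.
Proof.
move=> h xl; have := h _ (@diag_lies _ (fun y => y \in l) _ xl).
by move=> /(congr1 (vtx ord0)); rewrite !vtx_amap vtx_diag.
Qed.

Lemma agree_ef (Om Om' : inf_type) (l : seq Om) (d e : cemb Om Om') w :
  agree l d e -> size w = n -> (forall x, x \in w -> x \in l) -> ef d w = ef e w.
Proof.
move=> h sw wl; pose t : n.-tuple Om := @Tuple n _ w (introT eqP sw).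
have ht : lies_in (fun y => y \in l) (t, false) by apply/lies_inP.
exact: (congr1 snd (h _ ht)).
Qed.

Lemma agreeP (Om Om' : inf_type) (l : seq Om) (d e : cemb Om Om') :
  (forall x, x \in l -> ek d x = ek e x) ->
  (forall w, size w = n -> (forall x, x \in w -> x \in l) -> ef d w = ef e w) ->
  agree l d e.
Proof. by move=> h1 h2 x; apply: eq_amap. Qed.

Lemma agree_sub (Om Om' : inf_type) (l l' : seq Om) (d e : cemb Om Om') :
  {subset l <= l'} -> agree l' d e -> agree l d e.
Proof. by move=> ll h x hx; apply: h => i; apply: ll. Qed.

Lemma agree_eact (Om Om' : inf_type) (d e : cemb Om Om') s
  (A : 'I_(arity s) -> cov Om) :
  agree (vl A) d e -> eact d (pr A) = eact e (pr A).
Proof.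
move=> h; rewrite !eact_pr; congr pr; apply: funext => i; apply: h; exact: vlP.
Qed.

Definition id_emb (Om : inf_type) : cemb Om Om :=
  @Cemb Om Om id (fun x y e => e) _ (@cocycle0 n0 Om).

Lemma emb_act_id (Om : inf_type) x : emb_act (id_emb Om) x = x.
Proof. exact: amap_id. Qed.

Lemma eact_id (Om : inf_type) s (e : stdeq Om s) : eact (id_emb Om) e = e.
Proof. by apply: eqmap_id => t y; apply: emb_act_id. Qed.

Lemma left_inverse (Om Om' : inf_type) (e : cemb Om Om') :
  exists k, cancel (ek e) k.
Proof.
have [x0 _] := inf_fresh (i := Om) [::].
exists (fun y => if pselect (exists x, ek e x = y) is left h then projT1 (cid h) else x0).
move=> x; case: pselect => [h|[]]; last by exists x.
exact: ekI (projT2 (cid h)).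
Qed.

(* The two embeddings [d], [e] restricted to a finite list [s], and the
   identity on [e(t)], are glued. *)
Lemma conjugate_glue (Om Om' : inf_type) (d e : cemb Om Om') (s t : seq Om) :
  (forall x, x \in s -> x \in t -> ek d x = ek e x) ->
  (forall x y, x \in s -> y \in t -> ek d x = ek e y -> x = y) ->
  (forall w, size w = n -> (forall x, x \in w -> x \in s /\ x \in t) ->
     ef d w = ef e w) ->
  exists a : aut n0 Om',
    (forall x, lies_in (fun y => y \in s) x -> emb_act a (emb_act e x) = emb_act d x) /\
    (forall x, lies_in (fun y => y \in t) x -> emb_act a (emb_act e x) = emb_act e x).
Proof.
move=> h1 h2 h3; have [k kK] := left_inverse e.
(* The vertex map and cocycle of [d] after the inverse of [e], on the image of [e]. *)
pose K y := ek d (k y); pose F w := ef d (map k w) (+) ef e (map k w).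
have FF u : size u = n.+1 -> cobd u F = false.
  by move=> su; rewrite cobd_add -!cobd_map !efP ?size_map.
have [|||||||a [a1 a2]] := @aut_glue n0 Om' (map (ek e) s) (map (ek e) t) K id F (fun=> false).
- by move=> _ _ /mapP[x xs ->] /mapP[y ys ->]; rewrite /K !kK => /ekI ->.
- by [].
- by move=> u su _; apply: FF.
- by move=> u _ _; apply: cobd0.
- move=> _ /mapP[x xs ->]; rewrite mem_map; last exact: ekI.
  by rewrite /K kK; apply: h1.
- move=> _ _ /mapP[x xs ->] /mapP[y yt ->]; rewrite /K kK => e1.
  by rewrite (h2 x y).
- move=> w sw hw.
  have ew : w = map (ek e) (map k w).
    rewrite -map_comp -[LHS]map_id; apply/eq_in_map => y /hw[/mapP[x _ ->] _] /=.
    by rewrite kK.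
  rewrite /F h3 ?addbb ?size_map // => x xw.
  have /hw : ek e x \in w by rewrite ew map_f.
  by rewrite !mem_map //; apply: ekI.
exists a; split=> x hx.
  rewrite /emb_act /= [amap _ _ _]a1; last by move=> i; rewrite vtx_amap map_f.
  rewrite amap_comp; apply: (eq_amap (S:=fun=> True)) => // [y _|w _ _].
    by rewrite /K /= kK.
  by rewrite /F mapK // addbC -addbA addbb addbF.
rewrite /emb_act /= [amap _ _ _]a2; last by move=> i; rewrite vtx_amap map_f.
exact: amap_id.
Qed.

Lemma conjugate (Om Om' : inf_type) (d e : cemb Om Om') (s : seq Om) :
  exists a : aut n0 Om',
    forall x, lies_in (fun y => y \in s) x -> emb_act a (emb_act e x) = emb_act d x.
Proof.
have [//|//||a [ha _]] := @conjugate_glue Om Om' d e s [::]; last by exists a.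
move=> [//|x w] _ h; have [_] := h x (mem_head x w).
by rewrite in_nil.
Qed.

Definition fixes (Om : inf_type) (l : seq Om) (a : aut n0 Om) : Prop :=
  forall x, lies_in (fun y => y \in l) x -> emb_act a x = x.

Definition supports (Om : inf_type) (l : seq Om) s (e : stdeq Om s) : Prop :=
  forall a : aut n0 Om, fixes l a -> eact a e = e.

Lemma fixes_perm (Om : inf_type) (l : seq Om) (p p' : Om -> Om) (pK : cancel p p')
  (p'K : cancel p' p) : {in l, p =1 id} -> fixes l (perm_aut n0 pK p'K).
Proof.
by move=> pl x hx; rewrite -[RHS]amap_id; apply: (eq_amap (S:=fun y => y \in l)).
Qed.

Lemma fixes_ek (Om : inf_type) (l : seq Om) (a : aut n0 Om) x :
  fixes l a -> x \in l -> aperm a x = x.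
Proof.
move=> h xl; apply: (@agree_ek Om Om l a (id_emb Om)) => // y hy.
by rewrite h // emb_act_id.
Qed.

Lemma supports_pr (Om : inf_type) s (A : 'I_(arity s) -> cov Om) :
  supports (vl A) (pr A).
Proof.
move=> a ha; rewrite eact_pr; congr pr; apply: funext => i; apply: ha; exact: vlP.
Qed.

Lemma true_fresh (Om : inf_type) (l : seq Om) : exists2 y, True & y \notin l.
Proof. by have [y] := inf_fresh l; exists y. Qed.

Lemma preimage_list (Om Om' : inf_type) (e : cemb Om Om') (l : seq Om') :
  exists l' : seq Om, forall x, ek e x \in l -> x \in l'.
Proof.
have [k kK] := left_inverse e; exists (map k l) => x h.
by rewrite -[x]kK map_f.
Qed.

Lemma perm_emb_act (Om : inf_type) (p p' : Om -> Om) (pK : cancel p p')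
  (p'K : cancel p' p) x i :
  vtx i (emb_act (perm_aut n0 pK p'K) x) = p (vtx i x).
Proof. by rewrite vtx_amap. Qed.

(** A representative [A] of [x] may have vertices outside [l], where [d] and [e] differ. A conjugate
    [A'] over [l], free from [A], represents [x] too, and one automorphism [b] carries e(A') to
    d(A') while fixing e(A). *)
Lemma supports_agree (Om Om' : inf_type) (l : seq Om) s (x : stdeq Om s)
  (d e : cemb Om Om') : supports l x -> agree l d e -> eact d x = eact e x.
Proof.
move=> sup ag; have [A eA] := pr_surj x.
have [av hav] := preimage_list d (map (ek e) (vl A)).
have [p [p' [pK p'K pl pav]]] := move_off l (vl A) (av ++ vl A) (true_fresh (Om:=Om)).
pose a := perm_aut n0 pK p'K; pose A' i := emb_act a (A i).
have eA' : x = pr A' by rewrite -eact_pr -eA sup //; apply: fixes_perm.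
have key z : z \in map p (vl A) -> z \in l \/ (z \notin av /\ z \notin vl A).
  move=> /mapP[y yA ->]; have [yl|yl] := boolP (y \in l); first by left; rewrite pl.
  by right; have [_] := pav y yA yl; rewrite mem_cat negb_or => /andP[].
have [|||b [b1 b2]] := @conjugate_glue Om Om' d e (map p (vl A)) (vl A).
- by move=> z /key[zl _|[_ /negbTE ->] //]; apply: agree_ek ag zl.
- move=> z y /key[zl yA|[zav _] yA].
    by rewrite (agree_ek ag zl) => /ekI.
  by move=> E; case/negP: zav; apply: hav; rewrite E map_f.
- move=> w sw hw; apply: agree_ef ag sw _ => z /hw[/key[//|[_ /negbTE ->] //]].
(* Hence d(x) = d(A') = b(e(A')) = b(e(A)) = e(A) = e(x), as [A] and [A'] both represent [x]. *)
have E : eact b (eact e (pr A')) = eact b (eact e (pr A)) by rewrite -eA' -eA.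
transitivity (eact d (pr A')); first by rewrite -eA'.
transitivity (eact b (eact e (pr A'))).
  rewrite !eact_pr; congr pr; apply: funext => i; rewrite b1 // => j.
  by rewrite perm_emb_act map_f //; apply: vlP.
rewrite E eA !eact_pr; congr pr; apply: funext => i; rewrite b2 //.
exact: vlP.
Qed.

Lemma supports_eact (Om Om' : inf_type) (l : seq Om) s (x : stdeq Om s)
  (d : cemb Om Om') : supports l x -> supports (map (ek d) l) (eact d x).
Proof.
move=> sup a ha; rewrite -eact_comp; apply: supports_agree sup _ => y hy.
by rewrite emb_act_comp ha // => i; rewrite vtx_amap map_f.
Qed.

(** Given [a] fixing the intersection, a permutation [q] over [l'] makes the rest of [l] generic.
    Then some [b] agrees with [a] on [l] and is the identity on q(l), so a(x) = b(x) = b(q(x)) =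
    q(x) = x. *)
Lemma supports_inter (Om : inf_type) (l l' : seq Om) s (x : stdeq Om s) :
  supports l x -> supports l' x -> supports [seq y <- l | y \in l'] x.
Proof.
move=> sl sl' a ha.
have fa y : y \in l -> y \in l' -> aperm a y = y.
  by move=> yl yl'; apply: (fixes_ek ha); rewrite mem_filter yl yl'.
have [p [p' [pK p'K pl' pav]]] := move_off l' l (l ++ map (aperm a) l)
  (true_fresh (Om:=Om)).
pose q := perm_aut n0 pK p'K.
have key z : z \in map p l -> (z \in l /\ z \in l') \/
    (z \notin l /\ z \notin map (aperm a) l).
  move=> /mapP[y yl ->]; have [yl'|yl'] := boolP (y \in l').
    by left; rewrite pl'.
  by right; have [_] := pav y yl yl'; rewrite mem_cat negb_or => /andP[].
have [|||b [b1 b2]] := @conjugate_glue Om Om a (id_emb Om) l (map p l).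
- by move=> z zl /key[[_ zl']|[/negP//]]; apply: fa.
- move=> z y zl /key[[yl yl'] /= e|[_ /negP yn] /= e].
    by apply: (aperm_inj (a:=a)); rewrite e fa.
  by case: yn; rewrite -e map_f.
- move=> w sw hw.
  apply: (@agree_ef Om Om [seq y <- l | y \in l'] a (id_emb Om)) => //.
    by move=> y hy; rewrite ha // emb_act_id.
  by move=> y /hw[yl /key[[_ yl']|[/negP//]]]; rewrite mem_filter yl yl'.
have qx : eact q x = x by apply: sl'; apply: fixes_perm.
transitivity (eact b x).
  apply: supports_agree sl _ => y hy.
  by have := b1 y hy; rewrite emb_act_id.
rewrite -{1}qx -eact_comp -[RHS]qx; apply: supports_agree sl _ => y hy.
have := b2 (emb_act q y); rewrite emb_act_id emb_act_comp; apply=> i.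
by rewrite perm_emb_act map_f.
Qed.

(** A support of least size is contained in every other one, since intersecting it with another
    cannot make it smaller. *)
Lemma min_support (Om : inf_type) s (x : stdeq Om s) :
  exists l, supports l x /\ forall l', supports l' x -> {subset l <= l'}.
Proof.
have ex : exists k, `[< exists l, supports l x /\ size l = k >].
  have [A ->] := pr_surj x; exists (size (vl A)); apply/asboolP.
  by exists (vl A); split=> //; apply: supports_pr.
have [k /asboolP[l [sl sz]] kmin] := find_ex_minn ex.
exists l; split=> // l' sl'; apply/allP.
rewrite all_count eqn_leq count_size /= sz -size_filter; apply: kmin.
by apply/asboolP; exists [seq y <- l | y \in l']; split=> //; apply: supports_inter.
Qed.

End Supports.

(** * Types *)

Section Types.
Variable n0 : nat.
Local Notation n := n0.+2.
Local Notation cov := (cov n0).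
Local Notation T := (Tn n0).
Local Notation stdeq := (stdeq n0).
Local Notation aut := (aut n0).

Definition msupp (Om : inf_type) s (e : stdeq Om s) : seq Om :=
  projT1 (cid (min_support e)).

Lemma msupp_supports (Om : inf_type) s (e : stdeq Om s) : supports (msupp e) e.
Proof. exact: (projT2 (cid (min_support e))).1. Qed.

Lemma msupp_min (Om : inf_type) s (e : stdeq Om s) l :
  supports l e -> {subset msupp e <= l}.
Proof. exact: (projT2 (cid (min_support e))).2. Qed.

Lemma into_image (Om Om' : inf_type) (d : cemb n0 Om Om') s
  (A : 'I_(arity s) -> cov Om') :
  (forall y, y \in vl A -> exists x, y = ek d x) -> exists e, pr A = eact d e.
Proof.
move=> h.
have hA i : exists x, A i = emb_act d x.
  apply: amap_onto; apply/lies_inP => y hy; apply: h.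
  by move: y hy; apply/lies_inP; apply: vlP.
exists (pr (fun i => projT1 (cid (hA i)))); rewrite eact_pr; congr pr.
by apply: funext => i; apply: (projT2 (cid (hA i))).
Qed.

Lemma move_into (Om Om' : inf_type) (d : cemb n0 Om Om') (l : seq Om') s
  (e : stdeq Om' s) : (forall y, y \in l -> exists x, y = ek d x) ->
  exists2 a : aut Om', fixes l a & exists e0, eact a e = eact d e0.
Proof.
move=> hl; have [A ->] := pr_surj e.
have [p [p' [pK p'K pl pV]]] := move_off l (vl A) [::] (image_fresh (ekI (c:=d))).
exists (perm_aut n0 pK p'K); first exact: fixes_perm.
rewrite eact_pr; apply: into_image; apply: vl_lies => i j.
rewrite perm_emb_act.
have [yl|yl] := boolP (vtx j (A i) \in l); first by rewrite pl //; apply: hl.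
by have [] := pV (vtx j (A i)) (vlP A i j) yl.
Qed.

Lemma fixes_sub (Om : inf_type) (l l' : seq Om) (a : aut Om) :
  {subset l <= l'} -> fixes l' a -> fixes l a.
Proof. by move=> ll h x hx; apply: h => i; apply: ll. Qed.

Lemma eact_elementary (Om Om' : inf_type) (d : cemb n0 Om Om') :
  elementary (eact d).
Proof.
apply: elementary_by_autos.
  apply: eqmap_embedding; apply: amap_embedding; [exact: ekI|exact: efP].
move=> X g v s e [k [f fP]].
pose l := flatten [seq map (ek d) (msupp (v (f i))) | i <- enum 'I_k].
have [|a ha he] := @move_into Om Om' d l s e.
  by move=> y /flattenP[w /mapP[i _ ->]] /mapP[x _ ->]; exists x.
exists (eaut a) => // x; have [i ->] := fP x Logic.I.
have H := supports_eact (d:=d) (@msupp_supports Om _ (v (f i))).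
rewrite [LHS]H //; apply: fixes_sub ha => y hy; apply/flattenP.
by exists (map (ek d) (msupp (v (f i)))) => //; apply/mapP; exists i; rewrite ?mem_enum.
Qed.

(** The defining property: some frame over the finitely many vertices of [v] contains [w] in the
    positions that [v] occupies in the obvious frame. *)
Lemma real_isolated (Om : inf_type) (X : Type) (v : X -> cov Om) :
  finite_type X ->
  exists D : forall M : structure (lang n0), (X -> M tt) -> Prop, odef D /\
    forall w : X -> cov Om,
      D (std n0 Om) w <-> exists a : aut Om, forall x, w x = aut_act a (v x).
Proof.
move=> [k [f fP]].
pose l := undup (vl (fun i => v (f i))); pose r := size l.
pose nt := tnth (in_tuple l).
have ntI : injective nt.
  have x0 : 'I_r -> Om by move=> i; exact: nt i.
  move=> i j; rewrite /nt !(tnth_nth (x0 i)) /= => /eqP.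
  by rewrite nth_uniq ?undup_uniq // => /eqP/val_inj.
have code_ex x : exists c : cov 'I_r, v x = amap nt (fun=> false) c.
  apply: amap_onto => i; have [j ->] := fP x Logic.I.
  have : vtx i (v (f j)) \in in_tuple l by rewrite /= mem_undup; exact: vlP.
  by move=> /tnthP[p ->]; exists p.
pose code x := projT1 (cid (code_ex x)).
have codeE x : v x = amap nt (fun=> false) (code x) := projT2 (cid (code_ex x)).
pose D (M : structure (lang n0)) (w : X -> M tt) :=
  exists h : (n.-tuple 'I_r * bool)%type -> M tt, frame (h : cov 'I_r -> _) /\
    forall x, w x = h (code x).
exists D; split.
  apply: (@odef_ex n0 X (n.-tuple 'I_r * bool)%type (fun M u =>
    let h x := u (inr x) in
    frame (h : cov _ -> _) /\ forall x, u (inl x) = h (code x))).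
  apply: fdef_and; first exact: odef_frame.
  refine (fdef_fin _ _); first by exists k, f.
  by move=> x; apply: odef_eq.
move=> w; split=> [[h [[hE hR hI] hw]]|[a ha]]; last first.
  exists (fun c => aut_act a (amap nt (fun=> false) c)); split.
    rewrite (_ : (fun _ => _) = amap (aperm a \o nt)
        (fun w => false (+) acoc a (map nt w))); last first.
      by apply: funext => c; rewrite /aut_act amap_comp.
    apply: frame_amap; first exact: (inj_comp (aperm_inj (a:=a)) ntI).
    by move=> u su /=; rewrite -cobd_map acocP ?size_map.
  by move=> x; rewrite ha codeE.
(* A frame in a standard model is itself an injection of vertices with a cocycle, which extends to
   an automorphism. *)
have [|||κ [g [kI hg hh]]] := @cover_map_data n0 'I_r Om (fun=> True) h.
- by move=> i j x y _ _; apply: hE.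
- by move=> u _ /hR.
- by move=> x y _ _; apply: hI.
pose pinv (y : Om) := [pick i | nt i == y].
have pinvK i : pinv (nt i) = Some i.
  rewrite /pinv; case: pickP => [j /eqP/ntI -> //|/(_ i)].
  by rewrite eqxx.
have mapK u : pmap pinv (map nt u) = u.
  by elim: u => //= x u IH; rewrite pinvK /= IH.
pose K y := if pinv y is Some i then κ i else y.
pose G u := g (pmap pinv u).
have lnt y : y \in l -> exists i, y = nt i by move=> /(@tnthP _ _ (in_tuple l))[i ->]; exists i.
have [||a ha] := @aut_extend n0 Om l K G.
- move=> _ _ /lnt[i ->] /lnt[j ->]; rewrite /K !pinvK => e.
  by rewrite (kI i j).
- move=> u su hu.
  have [u' eu] : exists u', u = map nt u'.
    elim: u {su} hu => [|y u IH] hu; first by exists [::].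
    have [i ei] := lnt y (hu y (mem_head _ _)).
    have [|u' ->] := IH; first by move=> z zu; apply: hu; rewrite inE zu orbT.
    by exists (i :: u'); rewrite ei.
  rewrite eu cobd_map (@eq_cobd _ _ _ g) => [|c _ _]; last by rewrite /G mapK.
  by apply: hg => //; rewrite -su eu size_map.
exists a => x; rewrite hw ha; last first.
  move=> i; have [j ->] := fP x Logic.I.
  by rewrite mem_undup; apply: vlP.
rewrite codeE amap_comp hh //; apply: (eq_amap (S:=fun=> True)) => //=.
  by move=> y _; rewrite /K pinvK.
by move=> u _ _; rewrite /G mapK.
Qed.

Definition pr_term (Z : Type) (G : Z -> sorts (eq_language T))
    (s : sorts (eq_language T)) :
    (forall i : 'I_(arity s), term G (inl (coord_sort i))) -> term G s :=
  match s return (forall i : 'I_(arity s), term G (inl (coord_sort i))) ->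
    term G s with
  | inl s => fun f => f ord0
  | inr E => fun f => @App (eq_language T) Z G (inr E) f
  end.

Lemma eval_pr_term (Om : inf_type) (Z : Type) (G : Z -> sorts (eq_language T))
  (v : env (stdeq Om) G) s (f : forall i : 'I_(arity s), term G (inl (coord_sort i))) :
  eval (M:=stdeq Om) v (pr_term f) = pr (fun i => eval (M:=stdeq Om) v (f i)).
Proof. by case: s f. Qed.

Lemma castS_const (S C : Type) (s s' : S) (e : s = s') (x : C) :
  castS (M:=fun _ => C) e x = x.
Proof. by case: _ / e. Qed.

(** The formula says that [w] is the projection of some tuple in the orbit of chosen representatives
    of [v]. *)
Lemma isolated (Om : inf_type) (X : finType) (g : X -> sorts (eq_language T))
  (v : env (stdeq Om) g) :
  exists p : formula g, forall w : env (stdeq Om) g,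
    sat p w <-> exists a : aut Om, forall x, w x = eact a (v x).
Proof.
pose A x := projT1 (cid (pr_surj (v x))).
have vA x : v x = pr (A x) := projT2 (cid (pr_surj (v x))).
pose Y : finType := {x : X & 'I_(arity (g x))}.
pose h (y : Y) : unit := coord_sort (tagged y).
pose h' (y : Y) : sorts (eq_language T) := inl (h y).
pose V (y : Y) : cov Om := A (tag y) (tagged y).
have [D [hD DE]] := real_isolated V (finite_type_finType Y).
have hh y : h y = tt by case: (h y).
pose G := scat g h'.
have hG y : G (inr y) = inl (h y) by [].
have h1 := fdef_lift (T:=T) (g:=h) (g':=h') (fun y => erefl)
  (@fdef_ren (lang n0) Y Y (fun=> tt) h id hh D hD).
have h2 := @fdef_ren (eq_language T) Y (X + Y) h' G inr (fun y => erefl) _ h1.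
pose f x : term G (g x) := pr_term (s:=g x)
  (fun i => Var G (inr (Tagged (fun x => 'I_(arity (g x))) i))).
have h3 : fdef (g:=G) (fun N u => forall x,
    eval u (Var G (inl x) : term G (g x)) = eval u (f x)).
  refine (fdef_fin (finite_type_finType X) _) => x.
  exact: (fdef_eq (L:=eq_language T)).
have [p hp] := fdef_exenv (fdef_and h2 h3).
exists p => w; rewrite hp.
have E (b : env (stdeq Om) h') (wb := ecat w b) :
   (D (reduct (stdeq Om)) (precomp (r:=id) hh (lift_env (g':=h') (fun y => erefl)
       (precomp (r:=inr) (g:=h') (h:=G) (fun y => erefl) wb))) /\
    (forall x, eval wb (Var G (inl x) : term G (g x)) = eval wb (f x))) <->
   (exists a : aut Om, forall y, (b y : cov Om) = aut_act a (V y)) /\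
     forall x, w x = pr (fun i => b (Tagged (fun x => 'I_(arity (g x))) i)).
  have -> : precomp (r:=id) hh (lift_env (g':=h') (fun y => erefl)
       (precomp (r:=inr) (g:=h') (h:=G) (fun y => erefl) wb)) = (b : Y -> cov Om).
    by apply: env_ext => y; rewrite /precomp; apply: castS_const.
  have := DE b => DEb.
  have H : D (reduct (stdeq Om)) (b : Y -> cov Om) <->
    exists a : aut Om, forall y : Y, (b y : cov Om) = aut_act a (V y).
    rewrite -DEb; have [q hq] := hD.
    by rewrite -!hq [X in _ <-> X](sat_iso (reduct_eq_iso T (std n0 Om))).
  rewrite H; split=> -[H1 H2]; split=> // x; have := H2 x.
    by rewrite /f eval_pr_term.
  by rewrite /f eval_pr_term.
split=> [[b /E[[a ha] hb]]|[a ha]].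
  exists a => x; rewrite hb vA eact_pr; congr pr.
  by apply: funext => i; rewrite [LHS]ha.
exists (fun y => aut_act a (V y)); apply/E; split; first by exists a.
by move=> x; rewrite ha vA eact_pr.
Qed.

Definition same_formulas (L : language) (M N : structure L) (X : Type)
    (g : X -> sorts L) (v : env M g) (w : env N g) : Prop :=
  forall p : formula g, sat p v <-> sat p w.

Definition id_aut (Om : inf_type) : aut Om :=
  @perm_aut n0 Om id id (fun x => erefl) (fun x => erefl).

Lemma id_aut_act (Om : inf_type) s (e : stdeq Om s) : eact (id_aut Om) e = e.
Proof. by apply: eqmap_id => t y; apply: amap_id. Qed.

(** Homogeneity: since types are isolated by orbits, finite tuples of equal type in two models are
    conjugate in any common extension. *)
Lemma same_formulas_conj (Om Om' Om'' : inf_type) (d : cemb n0 Om Om'')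
  (e : cemb n0 Om' Om'') (X : finType) (g : X -> sorts (eq_language T))
  (v : env (stdeq Om) g) (w : env (stdeq Om') g) :
  same_formulas v w ->
  exists a : aut Om'', forall x, eact e (w x) = eact a (eact d (v x)).
Proof.
move=> h; have [p hp] := isolated (emap (eact d) v).
have /hp[a ha] : sat p (emap (eact e) w).
  rewrite -(eact_elementary e) -h (eact_elementary d); apply/hp.
  by exists (id_aut Om'') => x; rewrite id_aut_act.
by exists a.
Qed.

(** The delicate inclusion is that the larger model does not shrink the support. An automorphism [a]
    of the small model is imitated on finitely many vertices by an automorphism [b] of the large
    one, so the vertices whose images survive already support [e]. *)
Lemma msupp_eact (Om Om' : inf_type) (d : cemb n0 Om Om') s (e : stdeq Om s) y :
  y \in msupp (eact d e) <-> exists2 x, x \in msupp e & y = ek d x.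
Proof.
have sub : {subset msupp (eact d e) <= map (ek d) (msupp e)}.
  exact: (msupp_min (supports_eact (d:=d) (@msupp_supports Om _ e))).
split=> [/sub/mapP[x xe ->]|[x xe ->]]; first by exists x.
have [A eA] := pr_surj e.
pose l := [seq z <- msupp e | ek d z \in msupp (eact d e)].
suff: supports l e by move=> /msupp_min/(_ x xe); rewrite mem_filter => /andP[].
move=> a ha; apply: (eact_inj (e:=d)).
have [b hb] := conjugate (emb_comp a d) d (vl A ++ l).
transitivity (eact b (eact d e)).
  rewrite -!eact_comp eA; apply: agree_eact => z hz.
  rewrite -hb ?emb_act_comp // => i; rewrite mem_cat.
  by have := hz i => /= ->.
apply: msupp_supports => z hz.
have [z0 hz0 ->] : exists2 z0, lies_in (fun y => y \in l) z0 & z = emb_act d z0.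
  have [z0 ez] : exists z0, z = emb_act d z0.
    by apply: amap_onto => i; have /sub/mapP[t _ ->] := hz i; exists t.
  exists z0 => // i; have := hz i; rewrite {1}ez vtx_amap => k.
  rewrite mem_filter k /=.
  by have /mapP[t te /ekI ->] := sub _ k.
rewrite hb ?emb_act_comp; first by congr emb_act; apply: ha.
by move=> i; rewrite mem_cat (hz0 i) orbT.
Qed.

Lemma msupp_real (Om : inf_type) (x : cov Om) y :
  y \in msupp (x : stdeq Om (inl tt)) <-> exists i, y = vtx i x.
Proof.
split=> [h|[i ->]].
  have sx := @supports_pr n0 Om (inl tt) (fun=> x).
  have := msupp_min sx h => /flattenP[w /mapP[i _ ->]] /tnthP[j ->].
  by exists j.
apply: contrapT => /negP ni.
have [z hz] := inf_fresh (vtx i x :: msupp (x : stdeq Om (inl tt))).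
pose a := perm_aut n0 (swapK (vtx i x) z) (swapK (vtx i x) z).
have fa : fixes (msupp (x : stdeq Om (inl tt))) a.
  apply: fixes_perm => t ht; rewrite /swap; case: eqP => [e|_].
    by rewrite -e ht in ni.
  by case: eqP => // e; rewrite inE -e ht orbT in hz.
have /(congr1 (fun x : cov Om => vtx i x)) : eact a (x : stdeq Om (inl tt)) = x.
  exact: msupp_supports fa.
rewrite [LHS]vtx_amap /= /swap eqxx => e.
by rewrite e inE eqxx in hz.
Qed.

End Types.

(** * Algebraic closure and partial elementary maps *)

Lemma finite_pred_code (D : Type) (K : finType) (P : D -> Prop)
  (R : D -> K -> Prop) :
  (forall d, P d -> exists k, R d k) ->
  (forall d d' k, P d -> P d' -> R d k -> R d' k -> d = d') -> finite_pred P.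
Proof.
move=> h1 h2.
have [[d0 _]|no] := pselect (exists d, P d); last first.
  by exists 0, (fun i : 'I_0 => match i with Ordinal m hm => match notF hm with end end)
    => d hd; case: no; exists d.
pose f k : D := if pselect (exists d, P d /\ R d k) is left h
  then projT1 (cid h) else d0.
exists #|K|, (fun i => f (enum_val i)) => d Pd.
have [k Rk] := h1 d Pd; exists (enum_rank k); rewrite enum_rankK /f.
case: pselect => [h|[]]; last by exists d.
by have [Pd' Rd'] := projT2 (cid h); apply: h2 Rk _.
Qed.

Lemma acl_iso (L : language) (M N : structure L) (j : iso M N) (A : subfam M)
  (B : subfam N) (s : sorts L) (x : M s) :
  (forall s x, A s x -> B s (j s x)) -> acl A x -> acl B (j s x).
Proof.
move=> AB [n [h [p [b [bA px [k [f fP]]]]]]].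
exists n, h, p, (emap j b); split.
- by move=> i; apply: AB.
- by rewrite -emap_econs -sat_iso.
exists k, (fun i => j s (f i)) => d.
rewrite -[d](iso_invK j) -emap_econs -sat_iso => /fP[i ->].
by exists i.
Qed.

Section Closure.
Variable n0 : nat.
Local Notation n := n0.+2.
Local Notation cov := (cov n0).
Local Notation T := (Tn n0).
Local Notation stdeq := (stdeq n0).
Local Notation aut := (aut n0).

(** The coordinate form of an algebraically closed set; it is shown below to coincide with its own
    closure. *)
Definition acl_of (Om : inf_type) (S : Om -> Prop) : subfam (stdeq Om) :=
  fun s e => forall x, x \in msupp e -> S x.

Definition real (Om : inf_type) (x : cov Om) : stdeq Om (inl tt) := x.

(** The formula isolating the type of [e] over [b] defines its orbit over [b], so it suffices to
    code that orbit by a finite type [K]. *)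
Lemma acl_orbit (Om : inf_type) (A : subfam (stdeq Om)) s (e : stdeq Om s) k
  (h : 'I_k -> sorts (eq_language T)) (b : env (stdeq Om) h) (K : finType)
  (R : stdeq Om s -> K -> Prop) :
  env_in A b ->
  (forall a : aut Om, (forall i, eact a (b i) = b i) -> exists c, R (eact a e) c) ->
  (forall (a a' : aut Om) c, (forall i, eact a (b i) = b i) ->
     (forall i, eact a' (b i) = b i) ->
     R (eact a e) c -> R (eact a' e) c -> eact a e = eact a' e) ->
  acl A e.
Proof.
move=> bA h1 h2.
have [p hp] := isolated (econs e b).
have H d : sat p (econs d b) <-> exists a : aut Om, (forall i, eact a (b i) = b i) /\
    d = eact a e.
  rewrite hp; split=> -[a].
    by move=> ha; exists a; split=> [i|]; [rewrite -(ha (Some i)) | rewrite -(ha None)].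
  by move=> [ha ->]; exists a => -[i|] //=; rewrite ha.
exists k, h, p, b; split=> //.
  apply/H; exists (id_aut n0 Om); split=> [i|]; by rewrite id_aut_act.
apply: (@finite_pred_code _ K _ R) => [d /H[a [ha ->]]|d d' c]; first exact: h1.
by move=> /H[a [ha ->]] /H[a' [ha' ->]]; apply: h2.
Qed.

(** An automorphism that fixes the vertices of the support of [e] acts on [e] through the values of
    its cocycle on the finitely many n-tuples of those vertices. *)
Lemma acl_generated (Om : inf_type) (A : subfam (stdeq Om)) (S : Om -> Prop) s
  (e : stdeq Om s) :
  (forall x, S x -> A (inl tt) (real (diag n0 x))) -> acl_of S e -> acl A e.
Proof.
move=> SA Se; pose l := msupp e; pose r := size l.
pose nt := tnth (in_tuple l).
have ntl y : y \in l -> exists i, y = nt i by move=> /(@tnthP _ _ (in_tuple l)).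
pose K : finType := {ffun n.-tuple 'I_r -> bool}.
pose b (i : 'I_r) : stdeq Om (inl tt) := real (diag n0 (nt i)).
pose R (d : stdeq Om s) (c : K) := exists a : aut Om,
  [/\ forall i, aperm a (nt i) = nt i, d = eact a e &
      forall t, c t = acoc a (map_tuple nt t)].
have fixb (a : aut Om) : (forall i, eact a (b i) = b i) -> forall i, aperm a (nt i) = nt i.
  move=> ha i; have /(congr1 (fun x : cov Om => vtx ord0 x)) := ha i.
  by rewrite [LHS]vtx_amap vtx_diag.
apply: (@acl_orbit Om A s e r (fun=> inl tt) b K R).
- by move=> i; apply/SA/Se; rewrite -/l mem_tnth.
- move=> a /fixb ha; exists [ffun t => acoc a (map_tuple nt t)]; exists a.
  by split=> // t; rewrite ffunE.
move=> _ _ c _ _ [a [ha -> ca]] [a' [ha' -> ca']].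
apply: (supports_agree (@msupp_supports n0 Om s e)); apply: agreeP.
  by move=> x /ntl[i ->] /=; rewrite ha ha'.
move=> w sw hw /=.
have [t ->] : exists t : n.-tuple 'I_r, w = map_tuple nt t.
  have [u eu] : exists u, w = map nt u.
    elim: w {sw} hw => [|y w IH] hw; first by exists [::].
    have [i ->] := ntl y (hw y (mem_head _ _)).
    have [|u ->] := IH; first by move=> z zw; apply: hw; rewrite inE zw orbT.
    by exists (i :: u).
  have su : size u == n by rewrite -sw eu size_map.
  by exists (Tuple su).
by rewrite -ca -ca'.
Qed.

Lemma fixes_elt_msupp (Om : inf_type) s (e : stdeq Om s) (a : aut Om) x :
  eact a e = e -> x \in msupp e -> aperm a x \in msupp e.
Proof.
by move=> ae xe; rewrite -ae; apply/msupp_eact; exists x.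
Qed.

(** An automorphism fixing [e] permutes its least support, so a diagonal element over a point of it
    has finitely many conjugates, coded by a point of the support and a bit. *)
Lemma acl_vertex (Om : inf_type) (A : subfam (stdeq Om)) s (e : stdeq Om s) x :
  A s e -> x \in msupp e -> acl A (real (diag n0 x)).
Proof.
move=> Ae xe; pose l := msupp e; pose r := size l.
pose R (d : stdeq Om (inl tt)) (c : 'I_r * bool) :=
  exists2 y, y = tnth (in_tuple l) c.1 & (d : cov Om) = (nseq_tuple n y, c.2).
apply: (@acl_orbit Om A _ (real (diag n0 x)) 1 (fun=> s) (fun=> e) _ R).
- by move=> i.
- move=> a /(_ ord0) ha; have /= := fixes_elt_msupp ha xe.
  move=> /(@tnthP _ _ (in_tuple l))[i ei]; exists (i, acoc a (nseq n x)).
  exists (aperm a x) => //; apply: cov_ext => //= j.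
  by rewrite [LHS]vtx_amap vtx_diag /vtx tnth_nseq.
by move=> a a' c _ _ [y -> e1] [y' -> e2]; rewrite [LHS]e1 [RHS]e2.
Qed.

Lemma msupp_fixes (Om : inf_type) s (e : stdeq Om s) (a : aut Om) :
  fixes (msupp e) a -> eact a e = e.
Proof. exact: msupp_supports. Qed.

Lemma fixes_swap (Om : inf_type) (l : seq Om) x y : x \notin l -> y \notin l ->
  fixes l (perm_aut n0 (swapK x y) (swapK x y)).
Proof.
move=> xl yl; apply: fixes_perm => z zl; rewrite /swap.
case: eqP => [e|_]; first by rewrite -e zl in xl.
by case: eqP => // e; rewrite -e zl in yl.
Qed.

Lemma acl_sub (Om : inf_type) (A : subfam (stdeq Om)) (S : Om -> Prop) s
  (e : stdeq Om s) :
  (forall s x, A s x -> acl_of S x) -> acl A e -> acl_of S e.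
Proof.
move=> AS [k [h [p [b [bA pe [N [f fP]]]]]]] x xe; apply: contrapT => nSx.
pose l := flatten [seq msupp (b i) | i <- enum 'I_k].
have xl : x \notin l.
  apply/negP => /flattenP[w /mapP[i _ ->]] xw; apply: nSx; exact: AS (bA i) _ xw.
(* Swapping [x] with N+1 fresh vertices fixes the parameters and gives N+1 distinct conjugates of
   [e], one more than the formula has solutions. *)
have [y [yI yP]] := @fresh_map 'I_N.+1 Om (fun=> True) (enum 'I_N.+1)
  (x :: l ++ msupp e) (true_fresh (Om:=Om)) x.
have {}yP i : [/\ y i != x, y i \notin l & y i \notin msupp e].
  have [_] := yP i (mem_enum _ i).
  by rewrite inE mem_cat !negb_or => /andP[-> /andP[]].
pose a i := perm_aut n0 (swapK x (y i)) (swapK x (y i)).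
have ab i j : eact (a i) (b j) = b j.
  apply: msupp_fixes.
  have sub : {subset msupp (b j) <= l}.
    move=> z hz; apply/flattenP; exists (msupp (b j)) => //.
    by apply/mapP; exists j; rewrite ?mem_enum.
  by have [_ yl _] := yP i; apply: fixes_sub sub _; apply: fixes_swap.
have hf i : exists c, eact (a i) e = f c.
  apply: fP; have := eact_elementary (a i) p (econs e b).
  rewrite emap_econs => /iffLR/(_ pe).
  by rewrite (_ : emap _ b = b) //; apply: env_ext => j; apply: ab.
pose c i := projT1 (cid (hf i)).
have cI : injective c.
  move=> i j ec; have e1 : eact (a i) e = eact (a j) e.
    by rewrite (projT2 (cid (hf i))) (projT2 (cid (hf j))) -/(c i) ec.
  have : y i \in msupp (eact (a j) e).
    by rewrite -e1; apply/msupp_eact; exists x => //=; rewrite /swap eqxx.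
  move=> /msupp_eact[z ze /=]; have [yx _ ye] := yP i; rewrite /swap.
  case: eqP => _; first by move/yI; apply; rewrite mem_enum.
  case: eqP => _ e2; first by rewrite e2 eqxx in yx.
  by rewrite e2 ze in ye.
by have := leq_card c cI; rewrite !card_ord ltnn.
Qed.

Lemma acl_of_real (Om : inf_type) (S : Om -> Prop) (x : cov Om) :
  acl_of S (real x) <-> lies_in S x.
Proof.
split=> [h i|h y /msupp_real[i ->]]; last exact: h.
by apply: h; apply/msupp_real; exists i.
Qed.

Lemma acl_of_diag (Om : inf_type) (S : Om -> Prop) (x : Om) :
  acl_of S (real (diag n0 x)) <-> S x.
Proof.
rewrite acl_of_real; split=> [/(_ ord0)|Sx]; first by rewrite vtx_diag.
exact: diag_lies.
Qed.

Lemma acl_acl_of (Om : inf_type) (S : Om -> Prop) s (e : stdeq Om s) :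
  acl (acl_of S) e <-> acl_of S e.
Proof.
split; first exact: acl_sub.
by apply: acl_generated => x Sx; apply/acl_of_diag.
Qed.

Lemma acl_mono (L : language) (M : structure L) (A B : subfam M) s (x : M s) :
  (forall s x, A s x -> B s x) -> acl A x -> acl B x.
Proof.
move=> AB [n' [h [p [b [bA px fp]]]]]; exists n', h, p, b; split=> // i; exact: AB.
Qed.

End Closure.

Section Partial.
Variable n0 : nat.
Local Notation n := n0.+2.
Local Notation cov := (cov n0).
Local Notation T := (Tn n0).
Local Notation stdeq := (stdeq n0).
Local Notation aut := (aut n0).
Local Notation emb_inl := (@emb_inl n0).
Local Notation emb_inr := (@emb_inr n0).

Section Maps.
Variables (Om Om' : inf_type).

(** [H] is total for convenience; only its values on [acl_of S] are constrained. *)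
Definition pel (S : Om -> Prop) (H : forall s, stdeq Om s -> stdeq Om' s) : Prop :=
  forall (X : finType) (g : X -> sorts (eq_language T)) (v : env (stdeq Om) g),
    env_in (@acl_of n0 Om S) v -> same_formulas v (emap H v).

Definition hdata (S : Om -> Prop) (H : forall s, stdeq Om s -> stdeq Om' s)
    (k : Om -> Om') (f : seq Om -> bool) : Prop :=
  forall x : cov Om, lies_in S x -> H (inl tt) (real x) = real (amap k f x).

Definition inj_on (S : Om -> Prop) (k : Om -> Om') : Prop :=
  forall x y, S x -> S y -> k x = k y -> x = y.

Lemma pel_data S H : pel S H ->
  exists k f, [/\ inj_on S k, cocycle_on n0 S f & hdata S H k f].
Proof.
move=> hH; pose h (x : cov Om) : cov Om' := H (inl tt) (real x).
pose c (b : bool) : 'I_2 := if b then ord_max else ord0.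
have two i j x y : lies_in S x -> lies_in S y ->
    (vtx i (h x) = vtx j (h y) <-> vtx i x = vtx j y).
  move=> Sx Sy.
  pose g (i : bool) : sorts (eq_language T) := inl tt.
  pose v : env (stdeq Om) g := fun i => if i then real x else real y.
  have Sv : env_in (@acl_of n0 Om S) v by case; apply/acl_of_real.
  pose p : formula g := @Rel (eq_language T) bool g (Some (i, j))
    (fun k : 'I_2 => if k == ord0 then Var g true else Var g false).
  exact: iff_sym (hH _ g v Sv p).
have [|||k [f [kI hf hh]]] := @cover_map_data n0 Om Om' S h.
- exact: two.
- move=> v Sv.
  pose g (i : 'I_n.+1) : sorts (eq_language T) := inl tt.
  have Sv' : env_in (@acl_of n0 Om S) (v : env (stdeq Om) g).
    by move=> i; apply/acl_of_real; apply: Sv.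
  pose p : formula g := @Rel (eq_language T) _ g None (fun k : 'I_n.+1 => Var g k).
  exact: (iffLR (hH _ g v Sv' p)).
- move=> x y Sx Sy.
  pose g (i : bool) : sorts (eq_language T) := inl tt.
  pose v : env (stdeq Om) g := fun i => if i then real x else real y.
  have Sv : env_in (@acl_of n0 Om S) v by case; apply/acl_of_real.
  pose p : formula g := Equal (Var g true) (Var g false).
  exact: (iffRL (hH _ g v Sv p)).
by exists k, f; split.
Qed.

(** A partial elementary map is determined on imaginaries by its values on home elements.
    Homogeneity is applied to [e] together with all elements over its support, so the conjugating
    automorphism is trivial on the image of that support. *)
Lemma pel_emb (Om'' : inf_type) (S : Om -> Prop) H k f (be : cemb n0 Om' Om'')
  (ga : cemb n0 Om Om'') s (e : stdeq Om s) :
  pel S H -> hdata S H k f -> acl_of S e ->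
  (forall x, lies_in (fun y => y \in msupp e) x -> emb_act ga x = emb_act be (amap k f x)) ->
  eact be (H s e) = eact ga e.
Proof.
move=> hH hd Se ag; pose l := msupp e; pose r := size l.
pose nt := tnth (in_tuple l).
have ntl y : y \in l -> exists i, y = nt i by move=> /(@tnthP _ _ (in_tuple l)).
pose X : finType := option (n.-tuple 'I_r * bool)%type.
pose g (o : X) : sorts (eq_language T) := if o is Some _ then inl tt else s.
pose v : env (stdeq Om) g := fun o => match o return stdeq Om (g o) with
  Some t => real (amap nt (fun=> false) (t : cov 'I_r)) | None => e end.
have ntS t : lies_in S (amap nt (fun=> false) (t : cov 'I_r)).
  by move=> i; rewrite vtx_amap; apply: Se; rewrite -/l mem_tnth.
have Sv : env_in (@acl_of n0 Om S) v.
  by move=> [t|] //=; apply/acl_of_real.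
have [a ha] := same_formulas_conj ga be (hH X g v Sv).
rewrite [LHS](ha None) -eact_comp.
apply: (supports_agree (@msupp_supports n0 Om s e)) => x xl.
have [t et] : exists t : cov 'I_r, x = amap nt (fun=> false) t.
  by apply: amap_onto => i; apply: ntl; apply: xl.
rewrite emb_act_comp [RHS]ag // et.
have := ha (Some t); rewrite /v /emap /= hd; last exact: ntS.
exact: esym.
Qed.

(** An injection of [S] into [Om'] may have no injective extension to [Om], for instance when it is
    onto. In the disjoint sum there is room: points outside [S] go to the left copy. *)
Lemma total_emb (S : Om -> Prop) k f : inj_on S k -> cocycle_on n0 S f ->
  exists ga : cemb n0 Om (sum_inf Om Om'), forall x, lies_in S x ->
    emb_act ga x = emb_act (emb_inr Om Om') (amap k f x).
Proof.
move=> kI hf; have [F [FF Ff]] := cocycle_extend hf.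
pose K (x : Om) : sum_inf Om Om' := if `[< S x >] then inr (k x) else inl x.
have KI : injective K.
  move=> x y; rewrite /K; case: asboolP => Sx; case: asboolP => Sy //.
    by move=> [/kI]; apply.
  by case.
exists (Cemb KI FF) => x Sx; rewrite /emb_act amap_comp.
apply: (eq_amap (S:=S)) => //= [y Sy|w sw hw]; first by rewrite /K asboolT.
by rewrite addbF Ff.
Qed.

Lemma pel_unique S H H' k f : pel S H -> pel S H' ->
  inj_on S k -> cocycle_on n0 S f -> hdata S H k f -> hdata S H' k f ->
  forall s (e : stdeq Om s), acl_of S e -> H s e = H' s e.
Proof.
move=> h h' kI hf d d' s e Se; have [ga hga] := total_emb kI hf.
apply: (eact_inj (e:=emb_inr Om Om')).
have sub x : lies_in (fun y => y \in msupp e) x -> lies_in S x.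
  by move=> hx i; apply: Se; apply: hx.
rewrite (pel_emb (ga:=ga) h d) // => [|x /sub/hga //].
by rewrite (pel_emb (ga:=ga) h' d') // => x /sub/hga.
Qed.

Lemma pel_msupp S H k f s (e : stdeq Om s) : pel S H -> hdata S H k f ->
  inj_on S k -> cocycle_on n0 S f -> acl_of S e ->
  forall y, y \in msupp (H s e) <-> exists2 x, x \in msupp e & y = k x.
Proof.
move=> h d kI hf Se y; have [ga hga] := total_emb kI hf.
have sub x : lies_in (fun y => y \in msupp e) x -> lies_in S x.
  by move=> hx i; apply: Se; apply: hx.
have E : eact (emb_inr Om Om') (H s e) = eact ga e.
  by apply: (pel_emb h d) => // x /sub/hga.
have gk x : x \in msupp e -> ek ga x = inr (k x).
  move=> xe; have := hga _ (diag_lies (Se x xe)).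
  by move=> /(congr1 (fun x : cov _ => vtx ord0 x)); rewrite !vtx_amap vtx_diag.
split=> [ye|[x xe ->]].
  have : inr y \in msupp (eact ga e) by rewrite -E; apply/msupp_eact; exists y.
  by move=> /msupp_eact[x xe]; rewrite gk // => -[->]; exists x.
have : inr (k x) \in msupp (eact (emb_inr Om Om') (H s e)).
  by rewrite E; apply/msupp_eact; exists x => //; rewrite gk.
by move=> /msupp_eact[z ze [->]].
Qed.

Lemma in_image (Om1 Om2 : inf_type) (d : cemb n0 Om1 Om2) s (e : stdeq Om2 s) :
  (forall y, y \in msupp e -> exists x, y = ek d x) -> exists e0, e = eact d e0.
Proof.
move=> h; have [a /msupp_fixes ha [e0 he]] := move_into e h.
by exists e0; rewrite -he ha.
Qed.

Lemma pel_exists (S : Om -> Prop) k f : inj_on S k -> cocycle_on n0 S f ->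
  exists H, pel S H /\ hdata S H k f.
Proof.
move=> kI hf; have [ga hga] := total_emb kI hf.
have gk x : S x -> ek ga x = inr (k x).
  move=> Sx; have := hga _ (diag_lies Sx).
  by move=> /(congr1 (fun x : cov _ => vtx ord0 x)); rewrite !vtx_amap vtx_diag.
have ex s (e : stdeq Om s) : exists e', acl_of S e -> eact ga e = eact (emb_inr Om Om') e'.
  have [Se|nS] := pselect (acl_of S e).
    have [|e' he] := @in_image _ _ (emb_inr Om Om') s (eact ga e).
      by move=> y /msupp_eact[x /Se Sx ->]; exists (k x); rewrite gk.
    by exists e'.
  by have [e'] := inhab (stdeq Om') s; exists e'.
pose H s e := projT1 (cid (ex s e)).
have HE s e : acl_of S e -> eact ga e = eact (emb_inr Om Om') (H s e) :=
  projT2 (cid (ex s e)).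
exists H; split=> [X g v Sv p|x Sx].
  rewrite (eact_elementary ga p) (eact_elementary (emb_inr Om Om') p).
  rewrite (_ : emap (eact ga) v = emap (eact (emb_inr Om Om')) (emap H v)) //.
  by apply: env_ext => i; apply/HE/Sv.
apply: (eact_inj (e:=emb_inr Om Om')); rewrite -HE; last exact/acl_of_real.
exact: hga.
Qed.

Lemma pel_image S H k f s (e' : stdeq Om' s) : pel S H -> hdata S H k f ->
  inj_on S k -> cocycle_on n0 S f ->
  (acl_of (fun y => exists2 x, S x & y = k x) e' <->
   exists2 e, acl_of S e & e' = H s e).
Proof.
move=> h d kI hf; have [ga hga] := total_emb kI hf.
have gk x : S x -> ek ga x = inr (k x).
  move=> Sx; have := hga _ (diag_lies Sx).
  by move=> /(congr1 (fun x : cov _ => vtx ord0 x)); rewrite !vtx_amap vtx_diag.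
split=> [Se'|[e Se ->] y]; last first.
  by rewrite (pel_msupp h d) // => -[x /Se Sx ->]; exists x.
have [|e he] := @in_image _ _ ga s (eact (emb_inr Om Om') e').
  by move=> y /msupp_eact[z /Se'[x Sx ->] ->]; exists x; rewrite gk.
have Se : acl_of S e.
  move=> x xe; have : ek ga x \in msupp (eact (emb_inr Om Om') e').
    by rewrite he; apply/msupp_eact; exists x.
  move=> /msupp_eact[z /Se'[x' Sx' ->] /= e1].
  suff -> : x = x' by [].
  by apply: (ekI (c:=ga)); rewrite e1 gk.
exists e => //; apply: (eact_inj (e:=emb_inr Om Om')); rewrite he.
apply/esym/(pel_emb h d) => // x hx; apply: hga => i; apply: Se; exact: hx.
Qed.

End Maps.
End Partial.

(** * Forking independence *)

Section Independence.
Variable n0 : nat.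
Local Notation n := n0.+2.
Local Notation cov := (cov n0).
Local Notation T := (Tn n0).
Local Notation stdeq := (stdeq n0).
Local Notation aut := (aut n0).
Local Notation emb_inl := (@emb_inl n0).
Local Notation emb_inr := (@emb_inr n0).

Lemma representation (M : structure (lang n0)) (N : structure (eq_language T))
  (j : forall s, eq_structure T M s -> N s) :
  model T M -> elementary j -> exists Om, inhabited (iso (stdeq Om) N).
Proof.
move=> hM hj; have hR := reduct_model hM hj.
have [Om [u]] := model_std hR; exists Om; split.
exact: iso_comp (eq_iso (@std_model n0 Om) hR u) (rep_iso hM hj).
Qed.

Definition sup (Om : inf_type) k (h : 'I_k -> sorts (eq_language T))
    (b : env (stdeq Om) h) : seq Om :=
  flatten [seq msupp (b i) | i <- enum 'I_k].

Lemma supP (Om : inf_type) k (h : 'I_k -> sorts (eq_language T))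
  (b : env (stdeq Om) h) x :
  x \in sup b <-> exists i, x \in msupp (b i).
Proof.
split=> [/flattenP[w /mapP[i _ ->]] xw|[i xi]]; first by exists i.
by apply/flattenP; exists (msupp (b i)) => //; apply/mapP; exists i; rewrite ?mem_enum.
Qed.

Lemma sup_agree (Om Om' : inf_type) k (h : 'I_k -> sorts (eq_language T))
  (b : env (stdeq Om) h) (d e : cemb n0 Om Om') :
  agree (sup b) d e -> emap (eact d) b = emap (eact e) b.
Proof.
move=> ag; apply: env_ext => i; apply: (supports_agree (@msupp_supports n0 Om _ (b i))).
by apply: agree_sub ag => x xi; apply/supP; exists i.
Qed.

Lemma sup_fixes (Om : inf_type) k (h : 'I_k -> sorts (eq_language T))
  (b : env (stdeq Om) h) (a : aut Om) :
  fixes (sup b) a -> emap (eact a) b = b.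
Proof.
move=> ha; apply: env_ext => i; apply: msupp_fixes.
by apply: fixes_sub ha => x xi; apply/supP; exists i.
Qed.

Lemma sup_eact (Om Om' : inf_type) k (h : 'I_k -> sorts (eq_language T))
  (b : env (stdeq Om) h) (d : cemb n0 Om Om') y :
  y \in sup (emap (eact d) b) <-> exists2 x, x \in sup b & y = ek d x.
Proof.
split=> [/supP[i /msupp_eact[x xi ->]]|[x /supP[i xi] ->]].
  by exists x => //; apply/supP; exists i.
by apply/supP; exists i; apply/msupp_eact; exists x.
Qed.

Lemma elementary_pel (Om Om' : inf_type) (H : forall s, stdeq Om s -> stdeq Om' s) :
  elementary H -> pel (fun=> True) H.
Proof. by move=> h X g v _ p; apply: h. Qed.

Lemma sup_elementary (Om Om' : inf_type) (H : forall s, stdeq Om s -> stdeq Om' s)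
  k0 f : elementary H -> hdata (fun=> True) H k0 f -> inj_on (fun=> True) k0 ->
  cocycle_on n0 (fun=> True) f ->
  forall k (h : 'I_k -> sorts (eq_language T)) (b : env (stdeq Om) h) y,
  y \in sup (emap H b) <-> exists2 x, x \in sup b & y = k0 x.
Proof.
move=> hH hd kI hf k h b y.
have P i := @pel_msupp n0 Om Om' (fun=> True) H k0 f _ (b i) (elementary_pel hH) hd kI hf
  (fun x _ => Logic.I).
split=> [/supP[i /P[x xi ->]]|[x /supP[i xi] ->]].
  by exists x => //; apply/supP; exists i.
by apply/supP; exists i; apply/P; exists x.
Qed.

Lemma fixes_bit (Om : inf_type) (a : aut Om) (x : cov Om) b :
  emb_act a x = x -> emb_act a (x.1, b) = (x.1, b).
Proof.
case: x => t c e; apply: cov_ext => [i|] /=.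
  by have := congr1 (fun x : cov Om => vtx i x) e; rewrite !vtx_amap.
have := congr1 snd e => /= e2.
by apply: (can_inj (addKb c)); rewrite addbA [c (+) b]addbC -addbA e2 addbC.
Qed.

(* The generic copy of [a] over the finite set [L], free from all the [c' m]. *)
Lemma common_realisation (Om : inf_type) ka (g : 'I_ka -> sorts (eq_language T))
  kc (h : 'I_kc -> sorts (eq_language T)) (q : formula (scat g h))
  (a : env (stdeq Om) g) (c : env (stdeq Om) h) (L : seq Om) (r : nat)
  (psi : 'I_r -> aut Om) :
  sat q (ecat a c) -> (forall x, x \in sup a -> x \in sup c -> x \in L) ->
  (forall m, fixes L (psi m)) ->
  exists a' : env (stdeq Om) g, forall m, sat q (ecat a' (emap (eact (psi m)) c)).
Proof.
move=> hq aL fL.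
pose av := flatten [seq sup (emap (eact (psi m)) c) | m <- enum 'I_r].
have [p [p' [pK p'K pL pav]]] := move_off L (sup a) av (true_fresh (Om:=Om)).
pose chi := perm_aut n0 pK p'K.
exists (emap (eact chi) a) => m.
have psiL x : x \in L -> aperm (psi m) x = x by apply: fixes_ek.
have [||||||| om [o1 o2]] := @aut_glue n0 Om (sup a) (sup c) p (aperm (psi m))
  (fun=> false) (acoc (psi m)).
- by move=> x y _ _; apply: (can_inj pK).
- by move=> x y _ _; apply: aperm_inj.
- by move=> u _ _; apply: cobd0.
- by move=> u su _; apply: acocP.
- by move=> x xa xc; rewrite pL ?psiL // aL.
- move=> x y xa yc.
  have [xL|xL] := boolP (x \in L).
    by rewrite pL // => e; apply: (aperm_inj (a:=psi m)); rewrite psiL.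
  move=> e; have [_ /negP[]] := pav x xa xL; rewrite e.
  apply/flattenP; exists (sup (emap (eact (psi m)) c)).
    by apply/mapP; exists m; rewrite ?mem_enum.
  by apply/sup_eact; exists y.
- move=> w sw hw; apply/esym.
  apply: (@agree_ef n0 Om Om L (psi m) (id_emb n0 Om)) => //.
    by move=> x hx; rewrite fL // emb_act_id.
  by move=> x /hw[]; apply: aL.
have [H _] := sat_iso (eaut om) q (ecat a c); have := H hq; rewrite emap_ecat.
rewrite [X in ecat X _](_ : _ = emap (eact chi) a); last by apply: sup_agree.
by rewrite [X in ecat _ X](_ : _ = emap (eact (psi m)) c); last by apply: sup_agree.
Qed.

Lemma emapK (L : language) (M N : structure L) (j : iso M N) (X : Type)
  (g : X -> sorts L) (v : env N g) : emap j (emap (iso_inv j) v) = v.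
Proof. by apply: env_ext => x; apply: iso_invK. Qed.

(** Over [b], the tuple [a] is made free from the parameters of the dividing formulas. One of these
    formulas then holds at [a], and meets it only in vertices of [S0]; so it has a common
    realisation with all its conjugates over [C], against dividing. *)
Lemma not_forks (Om : inf_type)
  (M : structure (lang n0)) (hM : model T M) (j : iso (stdeq Om) (eq_structure T M))
  (C A B : subfam (eq_structure T M)) (S0 S1 S2 : Om -> Prop) :
  (forall s e, C s (j s e) <-> acl_of S0 e) ->
  (forall s e, A s (j s e) -> acl_of S1 e) ->
  (forall s e, B s (j s e) -> acl_of S2 e) ->
  (forall x, S1 x -> S2 x -> S0 x) -> independent C A B.
Proof.
move=> hC hA hB hS ka kb g h p a b Aa Bb pab [N1 [j1 [r [k' [h' [q [c]]]]]]].
move=> [ej1 hdiv hcover].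
pose a0 := emap (iso_inv j) a; pose b0 := emap (iso_inv j) b.
have Sa0 i x : x \in msupp (a0 i) -> S1 x.
  by apply: hA; rewrite iso_invK; apply: Aa.
have Sb0 i x : x \in msupp (b0 i) -> S2 x \/ S0 x.
  have := Bb i; rewrite -[b i](iso_invK j) => -[/hB k|/hC k] xi; first by left; apply: k.
  by right; apply: k.
have [Om1 [u1]] := representation hM ej1.
pose J1 s (x : stdeq Om s) : stdeq Om1 s := iso_inv u1 (j1 s (j s x)).
have eJ1 : elementary J1.
  apply: (@elementary_comp _ _ N1 _ (fun s x => j1 s (j s x)) (iso_inv u1)).
    exact: elementary_comp (elementary_iso j) ej1.
  exact: (elementary_iso (iso_sym u1)).
have [k1 [f1 [k1I hf1 hd1]]] := pel_data (elementary_pel eJ1).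
have sup1 := sup_elementary eJ1 hd1 k1I hf1.
pose a1 := emap J1 a0; pose b1 := emap J1 b0.
pose c1 i := emap (iso_inv u1) (c i).
have pab1 : sat p (ecat a1 b1).
  by rewrite -emap_ecat -eJ1 (sat_iso j) emap_ecat !emapK.
pose av := flatten [seq sup (c1 i) | i <- enum 'I_r].
(* After this move, a vertex shared by [a] and some [c1 i] lies in the support of [b], hence in
   [S0]. *)
have [pm [pm' [pmK pm'K pmb pmav]]] := move_off (sup b1) (sup a1) av (true_fresh (Om:=Om1)).
pose phi := perm_aut n0 pmK pm'K; pose a1' := emap (eact phi) a1.
have [i hi] : exists i, sat (q i) (ecat a1' (c1 i)).
  have [|i hi] := hcover (emap u1 a1').
    have -> : emap j1 b = emap u1 b1.
      apply: env_ext => x; rewrite /b1 /b0 /emap /J1.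
      by rewrite iso_invK [in RHS]iso_invK.
    rewrite -emap_ecat -sat_iso.
    rewrite -[b1](@sup_fixes _ _ _ _ phi); last exact: fixes_perm.
    by rewrite -emap_ecat -(eact_elementary phi).
  by exists i; rewrite (sat_iso u1) emap_ecat emapK.
have [N2 [j2 [r' [c' [ej2 same incons]]]]] := hdiv i.
have [Om2 [u2]] := representation hM (elementary_comp ej1 ej2).
pose J2 s (x : stdeq Om1 s) : stdeq Om2 s := iso_inv u2 (j2 s (u1 s x)).
have eJ2 : elementary J2.
  apply: (@elementary_comp _ _ N2 _ (fun s x => j2 s (u1 s x)) (iso_inv u2)).
    exact: elementary_comp (elementary_iso u1) ej2.
  exact: (elementary_iso (iso_sym u2)).
have [k2 [f2 [k2I hf2 hd2]]] := pel_data (elementary_pel eJ2).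
have sup2 := sup_elementary eJ2 hd2 k2I hf2.
pose a2 := emap J2 a1'; pose c2 := emap J2 (c1 i).
have q2 : sat (q i) (ecat a2 c2) by rewrite -emap_ecat -eJ2.
pose l0 := [seq x <- sup a0 | `[< S0 x >]]; pose L := map (k2 \o k1) l0.
have aL x : x \in sup a2 -> x \in sup c2 -> x \in L.
  move=> /sup2[y /sup_eact[z za ->] ->] /sup2[y' yc' /k2I e].
  have {}e : y' = aperm phi z by apply/esym/e.
  have [zb|zb] := boolP (z \in sup b1); last first.
    have [_ /negP[]] := pmav z za zb.
    apply/flattenP; exists (sup (c1 i)); first by apply/mapP; exists i; rewrite ?mem_enum.
    by rewrite e in yc'.
  have -> : ek phi z = z by apply: pmb.
  move: za zb => /sup1[t ta ->] /sup1[t' tb /k1I tt'].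
  have {tt'} et : t = t' by apply: tt'.
  rewrite -et in tb; apply: (map_f (k2 \o k1)); rewrite mem_filter ta andbT.
  apply/asboolP; move: ta tb => /supP[m tm] /supP[m' tm'].
  by have [S2t|//] := Sb0 _ _ tm'; apply: hS S2t; apply: Sa0 tm.
(* The parameters from [C] to be used: the elements of bit 0 over all n-tuples of [l0]. An
   automorphism fixing their images fixes all elements over [L], those of bit 1 included by
   [fixes_bit]. *)
pose r0 := size l0; pose nt := tnth (in_tuple l0).
pose Z : finType := n.-tuple 'I_r0.
pose d (z : 'I_#|Z|) : stdeq Om (inl tt) :=
  real (amap nt (fun=> false) (enum_val z : n.-tuple 'I_r0, false)).
have dC z : C _ (j _ (d z)).
  apply/hC/acl_of_real => m; rewrite vtx_amap.
  have : nt (vtx m (enum_val z : n.-tuple 'I_r0, false)) \in l0 by apply: mem_tnth.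
  by rewrite mem_filter => /andP[/asboolP].
pose D2 z := J2 _ (J1 _ (d z)).
have conj m : exists psi : aut Om2, fixes L psi /\
    emap (iso_inv u2) (c' m) = emap (eact psi) c2.
  pose hz (z : 'I_#|Z|) : sorts (eq_language T) := inl tt.
  pose D z := j2 _ (j1 _ (j _ (d z))).
  have uD2 : emap u2 (D2 : env (stdeq Om2) hz) = D.
    by apply: env_ext => z; rewrite /emap /D2 /J2 iso_invK /J1 iso_invK.
  have uc2 : emap u2 c2 = emap j2 (c i).
    by apply: env_ext => z; rewrite /emap /c2 /emap /J2 iso_invK /c1 /emap iso_invK.
  have sf : same_formulas (ecat c2 (D2 : env (stdeq Om2) hz))
      (ecat (emap (iso_inv u2) (c' m)) (D2 : env (stdeq Om2) hz)).
    move=> p0; rewrite !(sat_iso u2 p0) !emap_ecat emapK uD2 uc2.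
    apply: iff_sym; apply: (same m _ hz) => z.
    by exists (j1 _ (j _ (d z))) => //; exists (j _ (d z)).
  have [psi hpsi] := same_formulas_conj (id_emb n0 Om2) (id_emb n0 Om2) sf.
  exists psi; split; last first.
    by apply: env_ext => y; have := hpsi (inl y); rewrite !eact_id.
  move=> x hx.
  have [t ht] : exists t : cov 'I_r0, x = amap (k2 \o k1 \o nt) (fun=> false) t.
    apply: amap_onto => m'; have /mapP[y yl ->] := hx m'.
    by have /(@tnthP _ _ (in_tuple l0))[w ->] := yl; exists w.
  have := hpsi (inr (enum_rank (t.1 : Z))); rewrite !eact_id /=.
  rewrite /D2 /d enum_rankK [J1 _ _]hd1 // [J2 _ _]hd2 // => e.
  have ex : x.1 = (amap k2 f2 (amap k1 f1 (amap nt (fun=> false) (t.1, false)))).1.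
    rewrite ht; apply: eq_from_tnth => w; by rewrite !tnth_map.
  have {}e := fixes_bit x.2 (esym e).
  by rewrite -ex -surjective_pairing in e.
pose psi (m : 'I_r') := projT1 (cid (conj m)).
have psiP m : fixes L (psi m) /\
    emap (iso_inv u2) (c' m) = emap (eact (psi m)) c2 := projT2 (cid (conj m)).
have [a'' ha''] := common_realisation q2 aL (fun m => (psiP m).1).
apply: (incons (fun m : 'I_r' => nat_of_ord m)); first exact: val_inj.
exists (emap u2 a'') => m; rewrite -[c' m](emapK u2) -emap_ecat -sat_iso.
by rewrite (psiP m).2.
Qed.

(** For x in [S1] and [S2] but not in [S0], equality with the diagonal element at x divides over
    [C]: exchanging x with new vertices gives infinitely many distinct conjugates over [C], and two
    of the equalities contradict each other. *)
Lemma dependent_forks (Om : inf_type) (N : structure (eq_language T))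
  (j : iso (stdeq Om) N) (C A B : subfam N) (S0 S1 S2 : Om -> Prop) :
  (forall s e, C s (j s e) -> acl_of S0 e) ->
  (forall s e, acl_of S1 e -> A s (j s e)) ->
  (forall s e, acl_of S2 e -> B s (j s e)) ->
  independent C A B -> forall x, S1 x -> S2 x -> S0 x.
Proof.
move=> hC hA hB ind x S1x S2x; apply: contrapT => nS0.
pose g (i : 'I_1) : sorts (eq_language T) := inl tt.
pose p : formula (scat g g) :=
  Equal (Var (scat g g) (inl ord0)) (Var (scat g g) (inr ord0)).
pose b : env N g := fun i => j _ (real (diag n0 x)).
apply: (ind 1 1 g g p b b) => //.
- by move=> i; apply/hA/acl_of_diag.
- by move=> i; left; apply/hB/acl_of_diag.
exists N, (fun s y => y), 1, (fun=> 1), (fun=> g), (fun=> p), (fun=> b).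
split; [exact: elementary_id | move=> _ | by move=> a hap; exists ord0].
pose in_ := emb_inl Om nat_inf.
pose j2 s (y : N s) : stdeq (sum_inf Om nat_inf) s := eact in_ (iso_inv j y).
pose c (k : nat) : env (stdeq (sum_inf Om nat_inf)) g :=
  fun _ => real (diag n0 (inr k : sum_inf Om nat_inf)).
exists (stdeq (sum_inf Om nat_inf)), j2, 2, c; split.
- apply: (@elementary_comp _ _ (stdeq Om) _ (iso_inv j) (eact in_)).
    exact: (elementary_iso (iso_sym j)).
  exact: eact_elementary.
- move=> k q h p0 d hd.
  pose x' : sum_inf Om nat_inf := inl x; pose k' : sum_inf Om nat_inf := inr k.
  pose a := perm_aut n0 (swapK x' k') (swapK x' k').
  have ab : emap (eact a) (emap j2 b) = c k.
    apply: env_ext => i; rewrite /emap /j2 /b iso_funK; apply: cov_ext => //= m.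
    by rewrite [LHS]vtx_amap [in LHS]vtx_amap !vtx_diag /= /swap eqxx.
  have ad : emap (eact a) d = d.
    apply: sup_fixes; apply: fixes_swap; apply/negP => /supP[i].
      have [y [z Cz ->] ->] := hd i; move=> /msupp_eact[t ty [e]].
      by apply: nS0; rewrite e; apply: (hC _ (iso_inv j z)) ty; rewrite iso_invK.
    by have [y [z Cz ->] ->] := hd i; move=> /msupp_eact[t ty].
  rewrite (eact_elementary a p0 (ecat (emap j2 b) d)) emap_ecat ab ad.
  by split.
move=> l lI [a ha]; have := lI ord0 ord_max => /(_ _)/eqP.
have /= e0 := ha ord0; have /= e1 := ha ord_max.
have: c (l ord0) ord0 = c (l ord_max) ord0 by rewrite -[LHS]e0 -[RHS]e1.
move=> /(congr1 (fun x : cov _ => vtx ord0 x)); rewrite !vtx_diag => -[->].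
by move=> /(_ erefl).
Qed.

End Independence.

(** * Objects and morphisms in coordinates *)

Definition iso_refl (L : language) (M : structure L) : iso M M.
Proof.
by refine (@Iso L M M (fun s x => x) (fun s x => x) (fun s x => erefl)
  (fun s x => erefl) _); split=> [s x y|f v|r v] //; split.
Defined.

Section Objects.
Variable n0 : nat.
Local Notation n := n0.+2.
Local Notation cov := (cov n0).
Local Notation T := (Tn n0).
Local Notation stdeq := (stdeq n0).

(** Coordinates on an object: an isomorphism of its ambient structure with a
    standard one, in which the object is the algebraic closure of [cS]. *)
Record coord (A : object T) := Coord {
  cO : inf_type;
  cI : iso (stdeq cO) (ob_eq A);
  cS : cO -> Prop;
  cP : forall s (e : stdeq cO s), ob_set (o:=A) (cI s e) <-> acl_of cS e }.

Arguments cI [A] c.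
Arguments cP [A] c [s] e.

Lemma coord_ex (A : object T) : inhabited (coord A).
Proof.
have [Om [u]] := model_std (ob_modelP A).
pose v := eq_iso (@std_model n0 Om) (ob_modelP A) u.
pose S x := ob_set (o:=A) (v _ (real (diag n0 x))).
split; apply: (@Coord A Om v S) => s e; split=> [Ae x xe|Se].
  apply: ob_closed; apply: (@acl_iso _ _ _ v (fun s e => ob_set (v s e))) => //.
  exact: acl_vertex Ae xe.
apply: ob_closed; apply: (@acl_iso _ _ _ v (fun s e => ob_set (v s e))) => //.
by apply: acl_generated Se => x.
Qed.

Lemma acl_of_closed (Om : inf_type) (S : Om -> Prop) s (x : stdeq Om s) :
  acl (acl_of S) x -> acl_of S x.
Proof. by move/acl_acl_of. Qed.

Definition mkobj (Om : inf_type) (S : Om -> Prop) : object T :=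
  Object (@std_model n0 Om) (@acl_of_closed Om S).

Definition mkcoord (Om : inf_type) (S : Om -> Prop) : coord (mkobj S) :=
  @Coord (mkobj S) Om (iso_refl (stdeq Om)) S (fun s e => iff_refl _).

Section Homs.
Variables (A B : object T) (cA : coord A) (cB : coord B).

Definition pt s (e : stdeq (cO cA) s) (he : acl_of (cS (c:=cA)) e) : points A s :=
  exist _ (cI cA s e) (iffRL (cP cA e) he).

(** A morphism read in coordinates, with an arbitrary value outside its domain. *)
Definition hext (h : hom A B) s (e : stdeq (cO cA) s) : stdeq (cO cB) s :=
  if pselect (acl_of (cS (c:=cA)) e) is left he then iso_inv (cI cB) (sval (h s (pt he)))
  else projT1 (cid (let: inhabits x := inhab (stdeq (cO cB)) s in
    ex_intro (fun _ => True) x Logic.I)).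

Lemma hextE (h : hom A B) s (x : points A s) :
  cI cB s (hext h (iso_inv (cI cA) (sval x))) = sval (h s x).
Proof.
have he : acl_of (cS (c:=cA)) (iso_inv (cI cA) (sval x)).
  by apply/cP; rewrite iso_invK; apply: svalP.
rewrite /hext; case: pselect => // he'; rewrite iso_invK.
by congr (sval (h s _)); apply: sig_eq; rewrite /= iso_invK.
Qed.

Lemma hext_pt (h : hom A B) s (e : stdeq (cO cA) s) (he : acl_of (cS (c:=cA)) e) :
  cI cB s (hext h e) = sval (h s (pt he)).
Proof. by rewrite -hextE /= iso_funK. Qed.

Lemma hext_acl (h : hom A B) s (e : stdeq (cO cA) s) :
  acl_of (cS (c:=cA)) e -> acl_of (cS (c:=cB)) (hext h e).
Proof. by move=> he; apply/cP; rewrite (hext_pt h he); apply: svalP. Qed.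

Lemma hext_pel (h : hom A B) : pel (cS (c:=cA)) (hext h).
Proof.
move=> X g v Sv p.
rewrite (sat_iso (cI cA)) [X in _ <-> X](sat_iso (cI cB)).
have := hom_elem h p (fun x => pt (Sv x)).
rewrite (_ : (fun x => sval (h _ (pt (Sv x)))) = emap (cI cB) (emap (hext h) v)) //.
by apply: env_ext => x; rewrite -hext_pt.
Qed.

Definition data (h : hom A B) (k : cO cA -> cO cB) (f : seq (cO cA) -> bool) : Prop :=
  [/\ hdata (cS (c:=cA)) (hext h) k f, inj_on (cS (c:=cA)) k,
      cocycle_on n0 (cS (c:=cA)) f & forall x, cS x -> cS (c:=cB) (k x)].

Lemma data_ex (h : hom A B) : exists k f, data h k f.
Proof.
have [k [f [kI hf hd]]] := pel_data (hext_pel h); exists k, f; split=> // x Sx.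
have := hext_acl (h:=h) (iffRL (acl_of_diag n0 _ x) Sx).
rewrite hd; last exact: diag_lies.
by move=> /acl_of_real/(_ ord0); rewrite vtx_amap vtx_diag.
Qed.

Lemma data_unique (h h' : hom A B) k f : data h k f -> data h' k f ->
  forall s x, h s x = h' s x.
Proof.
move=> [d kI hf _] [d' _ _ _] s x; apply: sig_eq; rewrite -!hextE.
congr (cI cB s _); apply: (pel_unique (hext_pel h) (hext_pel h') kI hf d d').
by apply/cP; rewrite iso_invK; apply: svalP.
Qed.

Lemma data_ext (h : hom A B) k f k' f' : data h k f ->
  (forall x, cS x -> k x = k' x) ->
  (forall w, size w = n -> (forall x, x \in w -> cS x) -> f w = f' w) ->
  data h k' f'.
Proof.
move=> [d kI hf kS] ek ef; split.
- by move=> x Sx; rewrite d //; congr real; apply: eq_amap Sx.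
- by move=> x y Sx Sy; rewrite -!ek //; apply: kI.
- move=> u su hu; rewrite -(hf u su hu); apply: eq_cobd => w sw wu.
  rewrite ef //; first by rewrite sw su.
  by move=> x /(mem_subseq wu)/hu.
- by move=> x Sx; rewrite -ek //; apply: kS.
Qed.

Lemma data_fun (h : hom A B) k f k' f' : data h k f -> data h k' f' ->
  (forall x, cS x -> k x = k' x) /\
  (forall w, size w = n -> (forall x, x \in w -> cS x) -> f w = f' w).
Proof.
move=> [d _ _ _] [d' _ _ _]; split=> [x Sx|w sw hw].
  have := d _ (diag_lies Sx); rewrite d'; last exact: diag_lies.
  by move=> /(congr1 (fun x : cov _ => vtx ord0 x)); rewrite !vtx_amap vtx_diag.
pose t : cov _ := (@Tuple n _ w (introT eqP sw), false).
have ht : lies_in (cS (c:=cA)) t by apply/lies_inP.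
by have := d t ht; rewrite d' // => /(congr1 snd).
Qed.

Lemma data_hom k f : inj_on (cS (c:=cA)) k -> cocycle_on n0 (cS (c:=cA)) f ->
  (forall x, cS x -> cS (c:=cB) (k x)) -> exists h : hom A B, data h k f.
Proof.
move=> kI hf kS; have [H [hH hd]] := pel_exists kI hf.
have HS s e : acl_of (cS (c:=cA)) e -> acl_of (cS (c:=cB)) (H s e).
  by move=> Se y /(pel_msupp hH hd kI hf Se)[x /Se/kS xS ->].
have pA s (x : points A s) : acl_of (cS (c:=cA)) (iso_inv (cI cA) (sval x)).
  by apply/cP; rewrite iso_invK; apply: svalP.
pose hf' s (x : points A s) : points B s :=
  exist _ (cI cB s (H s (iso_inv (cI cA) (sval x)))) (iffRL (cP cB _) (HS _ _ (pA s x))).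
have el (X : finType) (g : X -> sorts (eq_language T)) (p : formula g)
    (v : env (points A) g) :
    sat (M:=ob_eq A) p (fun x => sval (v x)) <->
    sat (M:=ob_eq B) p (fun x => sval (hf' _ (v x))).
  pose w : env (stdeq (cO cA)) g := fun x => iso_inv (cI cA) (sval (v x)).
  have := hH X g w (fun x => pA _ (v x)) p.
  rewrite (sat_iso (cI cA)) [X in _ <-> X](sat_iso (cI cB)).
  by rewrite (_ : emap (cI cA) w = fun x => sval (v x)) //; apply: env_ext => x; apply: iso_invK.
exists (Hom el); split=> // x Sx.
apply: (emb_inj (iso_emb (cI cB))).
by rewrite (hext_pt _ (iffRL (acl_of_real _ _) Sx)) /= iso_funK hd.
Qed.

Lemma data_image (h : hom A B) k f : data h k f -> forall s e,
  hom_image h (cI cB s e) <-> acl_of (fun y => exists2 x, cS x & y = k x) e.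
Proof.
move=> [d kI hf _] s e; rewrite (pel_image e (hext_pel h) d kI hf).
split=> [[x ex]|[e0 he0 ->]].
  exists (iso_inv (cI cA) (sval x)).
    by apply/cP; rewrite iso_invK; apply: svalP.
  by apply: (emb_inj (iso_emb (cI cB))); rewrite hextE.
by exists (pt he0); rewrite -hext_pt.
Qed.

End Homs.

Arguments data [A B] cA cB h k f.
Arguments hext [A B] cA cB h [s] e.
Arguments hext_pt [A B] cA cB h [s e] he.

Lemma data_comp (A B C : object T) (cA : coord A) (cB : coord B) (cC : coord C)
  (h : hom A B) (g : hom B C) (l : hom A C) k f k' f' :
  (forall s x, l s x = g s (h s x)) -> data cA cB h k f -> data cB cC g k' f' ->
  data cA cC l (k' \o k) (fun w => f w (+) f' (map k w)).
Proof.
move=> e [d kI hf kS] [d' k'I hf' kS'].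
have L (x : cov _) : lies_in (cS (c:=cA)) x -> lies_in (cS (c:=cB)) (amap k f x).
  by move=> Sx i; rewrite vtx_amap; apply: kS.
split.
- move=> x Sx.
  transitivity (hext cB cC g (real (amap k f x))); last first.
    by rewrite d' ?/real ?amap_comp //; apply: L.
  apply: (emb_inj (iso_emb (cI cC))).
  rewrite (hext_pt cA cC l (iffRL (acl_of_real _ x) Sx)) e.
  rewrite (hext_pt cB cC g (iffRL (acl_of_real _ _) (L x Sx))).
  congr (sval (g _ _)); apply: sig_eq.
  by rewrite -(hext_pt cA cB h) d.
- by move=> x y Sx Sy /k'I e1; apply: kI => //; apply: e1; apply: kS.
- move=> u su hu; rewrite cobd_add -cobd_map hf // hf' ?size_map //.
  by move=> _ /mapP[x /hu/kS xS ->].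
- by move=> x Sx; apply/kS'/kS.
Qed.

Lemma data_id (A : object T) (cA : coord A) (h : hom A A) :
  (forall s x, h s x = x) -> data cA cA h id (fun=> false).
Proof.
move=> e; split=> //; last by move=> u _ _; apply: cobd0.
move=> x Sx; apply: (emb_inj (iso_emb (cI cA))).
by rewrite (hext_pt cA cA h (iffRL (acl_of_real _ x) Sx)) e /= amap_id.
Qed.

Lemma coord_empty (A : object T) (cA : coord A) :
  same_subfam (ob_set (o:=A)) (acl (@emptysub _ (ob_eq A))) <->
  forall x, ~ cS (c:=cA) x.
Proof.
split=> [h x Sx|h s y].
  have /h/(@acl_iso _ _ _ (iso_sym (cI cA)) _ (@emptysub _ _)) : ob_set (cI cA _ (real (diag n0 x))).
    by apply/cP/acl_of_diag.
  rewrite /= iso_funK => /(_ _)/(@acl_sub n0 _ _ (fun=> False)).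
  by move=> K; apply: (iffLR (acl_of_diag n0 (fun=> False) x)); apply: K.
split=> [Ay|Ey].
  rewrite -[y](iso_invK (cI cA)).
  apply: (@acl_iso _ _ _ (cI cA) (@emptysub _ _)) => //.
  apply: (@acl_generated n0 _ _ (cS (c:=cA))) => [x /h //|].
  by apply/cP; rewrite iso_invK.
by apply: ob_closed; apply: acl_mono Ey.
Qed.

Lemma coord_gen (A : object T) (cA : coord A) (B : subfam (ob_eq A))
  (U : cO cA -> Prop) :
  (forall x, U x -> B _ (cI cA _ (real (diag n0 x)))) ->
  (forall s e, B s (cI cA s e) -> acl_of U e) ->
  same_subfam (ob_set (o:=A)) (acl B) <-> forall x, cS x <-> U x.
Proof.
move=> h1 h2.
have E s e : acl B (cI cA s e) <-> acl_of U e.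
  split=> [|Ue].
    move=> /(@acl_iso _ _ _ (iso_sym (cI cA)) _ (fun s e => B s (cI cA s e))).
    rewrite /= iso_funK => K; apply: (@acl_sub n0 _ (fun s e => B s (cI cA s e))) => //.
    by apply: K => t x; rewrite iso_invK.
  apply: (@acl_iso _ _ _ (cI cA) (fun s e => B s (cI cA s e))) => //.
  exact: acl_generated h1 Ue.
split=> [h x|h s y].
  by rewrite -!(acl_of_diag n0) -cP h E.
rewrite -[y](iso_invK (cI cA)) cP E.
by split=> K x /K/h.
Qed.

Lemma coord_indep (A : object T) (cA : coord A) (C X Y : subfam (ob_eq A))
  (S0 S1 S2 : cO cA -> Prop) :
  (forall s e, C s (cI cA s e) <-> acl_of S0 e) ->
  (forall s e, X s (cI cA s e) <-> acl_of S1 e) ->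
  (forall s e, Y s (cI cA s e) <-> acl_of S2 e) ->
  independent C X Y <-> forall x, S1 x -> S2 x -> S0 x.
Proof.
move=> hC hX hY; split.
  by apply: (@dependent_forks n0 _ _ (cI cA)) => s e; [rewrite hC|rewrite hX|rewrite hY].
move=> hS; apply: (@not_forks n0 _ _ (ob_modelP A) (cI cA) C X Y S0 S1 S2) => // s e.
  by rewrite hX.
by rewrite hY.
Qed.

End Objects.

Arguments cI [n0 A] c.
Arguments cP [n0 A] c [s] e.
Arguments data [n0 A B] cA cB h k f.
Arguments hext [n0 A B] cA cB h [s] e.
Arguments hext_pt [n0 A B] cA cB h [s e] he.

(** * Functors *)

Section Functors.
Variables (L : language) (T : theory L).

Lemma hom_ext (A B : object T) (f g : hom A B) :
  (forall s x, f s x = g s x) -> f = g.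
Proof.
case: f g => [f hf] [g hg] /= e.
have E : f = g by apply: functional_extensionality_dep => s; apply: funext => x.
by subst g; congr Hom; apply: Prop_irrelevance.
Qed.

Lemma hom_of_eq_id (A : object T) (e : A = A) s x : hom_of_eq e s x = x.
Proof. by rewrite (Prop_irrelevance e erefl). Qed.

Definition hom_comp (A B C : object T) (f : hom A B) (g : hom B C) : hom A C :=
  @Hom L T A C (fun s x => g s (f s x)) (fun X gX p v =>
    iff_trans (hom_elem f p v) (hom_elem g p (fun x => f _ (v x)))).

Lemma functor_ext m (D : {set {set 'I_m}}) (a b : functor T D)
  (e : forall s h, a s h = b s h) :
  (forall s t hs ht i o x, hom_of_eq (e t ht) o (fmap a hs ht i o x) =
     fmap b hs ht i o (hom_of_eq (e s hs) o x)) -> a = b.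
Proof.
case: a b e => [fa ma ia ca] [fb mb ib cb] /= e.
have E : fa = fb.
  by apply: functional_extensionality_dep => s; apply: functional_extensionality_dep => h.
subst fb => H.
have E : ma = mb.
  apply: functional_extensionality_dep => s; apply: functional_extensionality_dep => t.
  apply: functional_extensionality_dep => hs; apply: functional_extensionality_dep => ht.
  apply: functional_extensionality_dep => i; apply: hom_ext => o x.
  by have := H s t hs ht i o x; rewrite !hom_of_eq_id.
by subst mb; congr Functor; apply: Prop_irrelevance.
Qed.

Section Extension.
Variables (m : nat) (a : functor T (Pminus m)) (O : object T).
Variable rho : forall s (h : s \in Pminus m), hom (a s h) O.
Hypothesis rho_nat : forall (s t : {set 'I_m}) hs ht (i : s \subset t) o x,
  rho ht o (fmap a hs ht i o x) = rho hs o x.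
Arguments rho [s] h.

Lemma PminusP (s : {set 'I_m}) : (s \in Pminus m) = (s != [set: 'I_m]).
Proof. by rewrite !inE andbT. Qed.

Lemma Pminus_up (s t : {set 'I_m}) : ~ s \in Pminus m -> t \in Pminus m ->
  s \subset t -> False.
Proof.
move=> ns; rewrite !PminusP in ns *; move/negP: ns; rewrite negbK => /eqP ->.
by rewrite subTset => /negP.
Qed.

Let dec (s : {set 'I_m}) := pselect (s \in Pminus m).

(** The cocone [rho] adds a top object. The decision [d] is an argument, so that proofs can analyse
    it without disturbing the types that depend on it. *)
Definition ext_obj (s : {set 'I_m}) (d : {s \in Pminus m} + {~ s \in Pminus m}) : object T :=
  match d with left h => a s h | right _ => O end.

Definition ext_map (s t : {set 'I_m}) (ds : {s \in Pminus m} + {~ s \in Pminus m})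
    (dt : {t \in Pminus m} + {~ t \in Pminus m}) (i : s \subset t) :
    hom (ext_obj ds) (ext_obj dt) :=
  match ds, dt return hom (ext_obj ds) (ext_obj dt) with
  | left hs, left ht => fmap a hs ht i
  | left hs, right _ => rho hs
  | right ns, left ht => False_rect _ (Pminus_up ns ht i)
  | right _, right _ => idhom O
  end.

Lemma ext_map_id (s : {set 'I_m}) d (i : s \subset s) o x : @ext_map s s d d i o x = x.
Proof. by case: d x => [h|h] x //; apply: fmap_id. Qed.

Lemma ext_map_comp (s t u : {set 'I_m}) ds dt du (i : s \subset t) (j : t \subset u)
  (k : s \subset u) o x :
  @ext_map s u ds du k o x = @ext_map t u dt du j o (@ext_map s t ds dt i o x).
Proof.
case: ds x => [hs|ns] x; case: dt => [ht|nt]; case: du => [hu|nu] //=.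
- exact: fmap_comp.
- by case: (Pminus_up nt hu j).
- by case: (Pminus_up ns ht i).
- by case: (Pminus_up ns ht i).
- by case: (Pminus_up ns hu k).
Qed.

Definition extension : functor T (P m) :=
  @Functor L T m (P m) (fun s _ => ext_obj (dec s))
    (fun s t _ _ i => ext_map (dec s) (dec t) i)
    (fun s _ => @ext_map_id s (dec s))
    (fun s t u _ _ _ => @ext_map_comp s t u (dec s) (dec t) (dec u)).

Lemma ext_obj_eq (s : {set 'I_m}) (d : {s \in Pminus m} + {~ s \in Pminus m}) (h : s \in Pminus m) :
  ext_obj d = a s h.
Proof. by case: d => [h'|//]; rewrite (Prop_irrelevance h' h). Qed.

Lemma extension_restrict : restrict extension = a.
Proof.
apply: (@functor_ext m (Pminus m) (restrict extension) a
  (fun s h => ext_obj_eq (dec s) h)) => s t hs ht i o /=.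
case: (dec s) => [hs'|//]; case: (dec t) => [ht'|//] /=.
move: (ext_obj_eq _ _) (ext_obj_eq _ _) => /=.
rewrite (Prop_irrelevance hs' hs) (Prop_irrelevance ht' ht) => e1 e2 x.
by rewrite !hom_of_eq_id.
Qed.

(** The existential form hides the case distinction and leaves only the transports along [eb] and
    [eO]. *)
Lemma functor_extension : exists (b : functor T (P m)) (eb : restrict b = a)
  (eO : b setT (in_setT setT) = O),
  forall s (hs : s \in Pminus m) o x,
    hom_of_eq eO o (fmap b (in_setT s) (in_setT setT) (subsetT s) o x) =
    rho hs o (hom_of_eq (fobj_eq eb hs) o x).
Proof.
exists extension, extension_restrict.
have eO : extension setT (in_setT setT) = O.
  rewrite /=; case: (dec setT) => // h.
  by exfalso; have := h; rewrite PminusP eqxx.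
exists eO => s hs o; move: (fobj_eq _ _) eO => /=.
case: (dec s) => [hs'|//]; case: (dec setT) => [h|h] /=.
  by exfalso; have := h; rewrite PminusP eqxx.
rewrite (Prop_irrelevance hs' hs) => e1 e2 x.
by rewrite !hom_of_eq_id.
Qed.
End Extension.

Lemma fmap_of_eq m (D : {set {set 'I_m}}) (a b : functor T D) (e : a = b)
  (s t : {set 'I_m}) hs ht (i : s \subset t) o x :
  hom_of_eq (fobj_eq e ht) o (fmap a hs ht i o x) =
  fmap b hs ht i o (hom_of_eq (fobj_eq e hs) o x).
Proof. by case: _ / e. Qed.

Lemma is_iso_of_eq (A B : object T) (e : A = B) : is_iso (hom_of_eq e).
Proof. by case: _ / e; exists (idhom A). Qed.

Lemma hom_of_eqK (A B : object T) (e : A = B) (e' : B = A) s x :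
  hom_of_eq e' s (hom_of_eq e s x) = x.
Proof. by case: _ / e e' x => e' x; apply: hom_of_eq_id. Qed.

Section IsoOver.
Variables (m : nat) (a : functor T (Pminus m)) (b c : functor T (P m)).
Variables (eb : restrict b = a) (ec : restrict c = a).
Variable eta : hom (b setT (in_setT setT)) (c setT (in_setT setT)).
Hypothesis eta_iso : is_iso eta.
Hypothesis eta_nat : forall s (hs : s \in Pminus m) o x,
  eta o (fmap b (in_setT s) (in_setT setT) (subsetT s) o x) =
  fmap c (in_setT s) (in_setT setT) (subsetT s) o
    (hom_of_eq (esym (fobj_eq ec hs)) o (hom_of_eq (fobj_eq eb hs) o x)).

Definition eta_top s (h : s \in P m) (e : setT = s) : hom (b s h) (c s h) :=
  match e in _ = s' return forall h : s' \in P m, hom (b s' h) (c s' h) with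
  | erefl => fun h =>
    hom_comp (hom_of_eq (congr1 (b setT) (Prop_irrelevance h (in_setT setT))))
      (hom_comp eta (hom_of_eq (congr1 (c setT) (Prop_irrelevance (in_setT setT) h))))
  end h.

Lemma eta_topE (e : setT = setT) o x : eta_top (in_setT setT) e o x = eta o x.
Proof.
by rewrite /eta_top (Prop_irrelevance e erefl) /= !hom_of_eq_id.
Qed.

Lemma full_of_notPminus (s : {set 'I_m}) : ~ s \in Pminus m -> s = setT.
Proof. by rewrite PminusP => /negP; rewrite negbK => /eqP. Qed.

Definition eta_at s (h : s \in P m) (d : {s \in Pminus m} + {~ s \in Pminus m}) :
    hom (b s h) (c s h) :=
  match d with
  | left hs => hom_of_eq (etrans (congr1 (b s) (Prop_irrelevance h (in_setT s)))
      (etrans (fobj_eq eb hs) (etrans (esym (fobj_eq ec hs))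
        (congr1 (c s) (Prop_irrelevance (in_setT s) h)))))
  | right ns => eta_top h (esym (full_of_notPminus ns))
  end.

Lemma hom_of_eq_trans (A B C : object T) (e : A = B) (e' : B = C) (e2 : A = C) s x :
  hom_of_eq e2 s x = hom_of_eq e' s (hom_of_eq e s x).
Proof.
case: _ / e x e' e2 => x e' e2; rewrite hom_of_eq_id.
by rewrite (Prop_irrelevance e2 e').
Qed.

Lemma eta_at_left s hs o x : eta_at (in_setT s) (left hs) o x =
  hom_of_eq (esym (fobj_eq ec hs)) o (hom_of_eq (fobj_eq eb hs) o x).
Proof. exact: hom_of_eq_trans. Qed.

Lemma eta_at_right ns o x : eta_at (in_setT setT) (right ns) o x = eta o x.
Proof. exact: eta_topE. Qed.

(** Below the top the natural isomorphism is forced by the identifications with [a], so a single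
    isomorphism at the top, compatible with the maps from proper subsets, suffices. *)
Lemma iso_over_intro : iso_over eb ec.
Proof.
exists (fun s h => eta_at h (pselect (s \in Pminus m))); split.
- move=> s h; rewrite (Prop_irrelevance h (in_setT s)).
  case: (pselect _) => [hs|ns]; first exact: is_iso_of_eq.
  have e := full_of_notPminus ns; subst s.
  have [g gK] := eta_iso; exists g => s; have [K1 K2] := gK s.
  by split=> x; rewrite eta_at_right ?K1 ?K2.
- move=> s t hs ht i o x.
  move: x; rewrite (Prop_irrelevance hs (in_setT s)) (Prop_irrelevance ht (in_setT t)) => x.
  case: (pselect (s \in _)) => [ps|ns]; case: (pselect (t \in _)) => [pt|nt].
  + rewrite !eta_at_left.
    have /= E1 := @fmap_of_eq m _ _ _ eb s t ps pt i o x.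
    rewrite E1.
    have /= E2 := @fmap_of_eq m _ _ _ ec s t ps pt i o (hom_of_eq (esym (fobj_eq ec ps)) o (hom_of_eq (fobj_eq eb ps) o x)).
    rewrite hom_of_eqK in E2; rewrite -E2.
    by rewrite hom_of_eqK.
  + have e := full_of_notPminus nt; subst t.
    rewrite eta_at_left eta_at_right (Prop_irrelevance i (subsetT s)).
    exact: eta_nat.
  + by case: (Pminus_up ns pt i).
  + have e := full_of_notPminus nt; subst t.
    have e := full_of_notPminus ns; subst s.
    by rewrite !eta_at_right !fmap_id.
- move=> s h o x; case: (pselect _) => [h'|//].
  by rewrite (Prop_irrelevance h' h) eta_at_left hom_of_eqK.
Qed.
End IsoOver.

Lemma iso_over_top m (a : functor T (Pminus m)) (b c : functor T (P m))
  (eb : restrict b = a) (ec : restrict c = a) : iso_over eb ec ->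
  exists eta : hom (b setT (in_setT setT)) (c setT (in_setT setT)),
  forall s (hs : s \in Pminus m) o x,
  eta o (fmap b (in_setT s) (in_setT setT) (subsetT s) o x) =
  fmap c (in_setT s) (in_setT setT) (subsetT s) o
    (hom_of_eq (esym (fobj_eq ec hs)) o (hom_of_eq (fobj_eq eb hs) o x)).
Proof.
move=> [eta [_ nat idn]]; exists (eta setT (in_setT setT)) => s hs o x.
rewrite nat; congr (fmap c _ _ _ _ _).
by rewrite -(idn s hs) (hom_of_eqK (fobj_eq ec hs)).
Qed.

End Functors.

(** * Labelled amalgamation problems *)

Section Labels.
Variable n0 : nat.
Local Notation n := n0.+2.
Local Notation T := (Tn n0).

Section Labelling.
Variables (m : nat) (D : {set {set 'I_m}}).
Hypothesis Ddown : forall s t : {set 'I_m}, s \subset t -> t \in D -> s \in D.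
Variables (a : functor T D) (c : forall s (h : s \in D), coord (a s h)).

(** The vertices of all the a(s) are named coherently by [X]; the name [z]
    belongs to a(s) when [q z \in s]. *)
Definition labelling (X : Type) (q : X -> 'I_m)
    (lam : forall s (h : s \in D), X -> cO (c h)) : Prop :=
  [/\ forall (s : {set 'I_m}) h z, q z \in s -> cS (lam s h z),
      forall (s : {set 'I_m}) h x, cS x -> exists2 z, q z \in s & lam s h z = x,
      forall (s : {set 'I_m}) h z z', q z \in s -> q z' \in s -> lam s h z = lam s h z' -> z = z' &
      forall (s t : {set 'I_m}) hs ht (i : s \subset t) k f,
        data (c hs) (c ht) (fmap a hs ht i) k f ->
        forall z, q z \in s -> k (lam s hs z) = lam t ht z].

Lemma labelling_amalgamation (X : Type) (q : X -> 'I_m) lam :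
  @labelling X q lam -> amalgamation a.
Proof.
move=> [L1 L2 L3 L4].
split=> [h|s1 s2 s3 h1 h2 h3 h12 i1 i2 i12|s h].
- apply/(coord_empty (c h)) => x /L2[z]; by rewrite inE.
- have [k1 [f1 d1]] := data_ex (c h1) (c h3) (fmap a h1 h3 i1).
  have [k2 [f2 d2]] := data_ex (c h2) (c h3) (fmap a h2 h3 i2).
  have [k12 [f12 d12]] := data_ex (c h12) (c h3) (fmap a h12 h3 i12).
  apply/(coord_indep (data_image d12) (data_image d1) (data_image d2)).
  move=> x [x1 /L2[z1 qz1 <-] ->] [x2 /L2[z2 qz2 <-]].
  rewrite (L4 _ _ _ _ _ _ _ d1 z1 qz1) (L4 _ _ _ _ _ _ _ d2 z2 qz2) => /L3 e.
  have {}e : z1 = z2 by apply: e; [apply: (subsetP i1) | apply: (subsetP i2)].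
  subst z2; have qz : q z1 \in s1 :&: s2 by rewrite inE qz1 qz2.
  exists (lam _ h12 z1); first exact: L1.
  by rewrite (L4 _ _ _ _ _ _ _ d12 z1 qz).
have K i hi si := data_ex (c hi) (c h) (fmap a (s:=[set i]) hi h si).
pose U x := exists (i : 'I_m) (hi : [set i] \in D) (si : [set i] \subset s) k f,
  data (c hi) (c h) (fmap a hi h si) k f /\ exists2 y, cS y & x = k y.
apply/(coord_gen (cA := c h) (U := U)).
- move=> x [i [hi [si [k [f [d xy]]]]]]; exists i, hi, si.
  by apply/(data_image d)/acl_of_diag.
- move=> o e [i [hi [si]]]; have [k [f d]] := K i hi si.
  by move=> /(data_image d) he y /he ye; exists i, hi, si, k, f.
move=> x; split=> [/L2[z qz <-]|[i [hi [si [k [f [d [y Sy ->]]]]]]]]; last first.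
  by have [_ _ _] := d; apply.
have si : [set q z] \subset s by rewrite sub1set.
have hi := Ddown si h; have [k [f d]] := K _ hi si.
exists (q z), hi, si, k, f; split=> //.
have qz' : q z \in [set q z] by rewrite inE.
by exists (lam _ hi z); [apply: L1 | rewrite (L4 _ _ _ _ _ _ _ d)].
Qed.

Definition labels : Type :=
  {i : 'I_m & {h : [set i] \in D & {x : cO (c h) | cS x}}}.

Definition label_part (z : labels) : 'I_m := tag z.
Definition label_in (z : labels) : [set label_part z] \in D := tag (tagged z).
Definition label_pt (z : labels) : cO (c (label_in z)) := sval (tagged (tagged z)).

(** The labels are the vertices of the a({i}). Generation makes them exhaust each a(s); independence
    over the empty a(emptyset) keeps those of different parts distinct; functoriality makes the
    names coherent. *)
Lemma amalgamation_labelling : amalgamation a ->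
  exists lam, @labelling labels label_part lam.
Proof.
move=> am.
have K (s t : {set 'I_m}) hs ht (i : s \subset t) : exists kf,
    data (c hs) (c ht) (fmap a (s:=s) (t:=t) hs ht i) kf.1 kf.2.
  have [k [f d]] := data_ex (c hs) (c ht) (fmap a hs ht i).
  by exists (k, f).
pose k s t hs ht i := (projT1 (cid (K s t hs ht i))).1.
have kP s t hs ht i : data (c hs) (c ht) (fmap a hs ht i) (k s t hs ht i)
  (projT1 (cid (K s t hs ht i))).2 := projT2 (cid (K s t hs ht i)).
pose lam (s : {set 'I_m}) (h : s \in D) (z : labels) : cO (c h) :=
  if pselect ([set label_part z] \subset s) is left i
  then k _ _ (label_in z) h i (label_pt z)
  else projT1 (cid (inf_fresh (i := cO (c h)) [::])).
have lamE (s : {set 'I_m}) h z (i : [set label_part z] \subset s) :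
    lam s h z = k _ _ (label_in z) h i (label_pt z).
  rewrite /lam; case: pselect => // i'.
  by rewrite (Prop_irrelevance i' i).
have Sz z : cS (label_pt z) := svalP (tagged (tagged z)).
have empty (s : {set 'I_m}) (h : s \in D) : s = set0 -> forall x, ~ cS (c:=c h) x.
  by move=> es; subst s; apply/coord_empty; exact: (@am_empty _ _ _ _ _ am h).
exists lam; split.
- move=> s h z; rewrite -sub1set => i; rewrite (lamE _ _ _ i).
  by have [_ _ _] := kP _ _ (label_in z) h i; apply.
- move=> s h x Sx.
  pose U x := exists (i : 'I_m) (hi : [set i] \in D) (si : [set i] \subset s),
    exists2 y, cS y & x = k _ _ hi h si y.
  have : U x.
    move: Sx; have := @am_gen _ _ _ _ _ am s h; rewrite (coord_gen (cA := c h) (U := U)).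
    + by move=> ->.
    + move=> y [i [hi [si yy]]]; exists i, hi, si.
      exact/(data_image (kP _ _ _ _ _))/acl_of_diag.
    + move=> o e [i [hi [si]]] /(data_image (kP _ _ _ _ _)) he y /he ye.
      by exists i, hi, si.
  move=> [i [hi [si [y Sy ->]]]].
  pose z : labels := existT _ i (existT _ hi (exist _ y Sy)).
  by exists z; [rewrite -sub1set | rewrite (lamE _ _ z si)].
- move=> s h z z'; rewrite -!sub1set => i i'.
  rewrite (lamE _ _ _ i) (lamE _ _ _ i').
  have [ez|ne] := eqVneq (label_part z) (label_part z').
    case: z z' i i' ez => [j [hj [x Sx]]] [j' [hj' [x' Sx']]].
    rewrite /label_part /label_in /label_pt /= => i i' ej; subst j'.
    rewrite (Prop_irrelevance hj' hj) in x' Sx' *.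
    rewrite (Prop_irrelevance i' i).
    have [_ kI _ _] := kP _ _ hj h i; move=> /(kI _ _ Sx Sx') e; subst x'.
    by rewrite (Prop_irrelevance Sx' Sx).
  have e0 : [set label_part z] :&: [set label_part z'] = set0.
    apply/setP => j; rewrite !inE; apply/negP => /andP[/eqP ->].
    by rewrite (negbTE ne).
  have i0 : [set label_part z] :&: [set label_part z'] \subset s by rewrite e0 sub0set.
  have h0 := Ddown i0 h.
  have := @am_indep _ _ _ _ _ am _ _ _ (label_in z) (label_in z') h h0 i i' i0.
  rewrite (coord_indep (data_image (kP _ _ _ _ _)) (data_image (kP _ _ _ _ _))
    (data_image (kP _ _ _ _ _))) => ind e.
  have [||y Sy _] := ind (k _ _ (label_in z) h i (label_pt z)).
  + by exists (label_pt z).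
  + by exists (label_pt z').
  by case: (empty _ h0 e0 y).
move=> s t hs ht i k0 f0 d0 z; rewrite -sub1set => j.
have jt := subset_trans j i.
rewrite (lamE _ _ _ j) (lamE _ _ _ jt).
have E o x := @fmap_comp _ _ _ _ a _ _ _ (label_in z) hs ht j i jt o x.
have dc := data_comp E (kP _ _ (label_in z) hs j) d0.
by have [->] := data_fun (kP _ _ (label_in z) ht jt) dc.
Qed.

End Labelling.

Lemma P_down m (s t : {set 'I_m}) : s \subset t -> t \in P m -> s \in P m.
Proof. by rewrite !inE. Qed.

Lemma Pminus_down m (s t : {set 'I_m}) : s \subset t -> t \in Pminus m -> s \in Pminus m.
Proof.
rewrite !PminusP => st; apply: contra_neq => e; apply/eqP.
by rewrite -subTset -e.
Qed.

Lemma data_hom_comp (A B C : object T) (cA : coord A) (cB : coord B) (cC : coord C)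
  (h : hom A B) (g : hom B C) k f k' f' :
  data cA cB h k f -> data cB cC g k' f' ->
  data cA cC (hom_comp h g) (k' \o k) (fun w => f w (+) f' (map k w)).
Proof. by apply: data_comp => s x. Qed.

Lemma data_iso (A B : object T) (cA : coord A) (cB : coord B) (h : hom A B) k f :
  data cA cB h k f -> (forall y, cS (c:=cB) y -> exists2 x, cS x & y = k x) -> is_iso h.
Proof.
move=> d ks; have [hd kI hf kS] := d.
have [x0 _] := inf_fresh (i := cO cA) [::].
have Q y : exists x, cS y -> cS x /\ y = k x.
  have [/ks[x Sx ->]|nS] := pselect (cS y); first by exists x.
  by exists x0.
pose k' y := projT1 (cid (Q y)).
have k'P y : cS y -> cS (k' y) /\ y = k (k' y) := projT2 (cid (Q y)).
have k'K x : cS x -> k' (k x) = x.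
  by move=> Sx; have [S' e] := k'P _ (kS _ Sx); apply: kI.
have [||| g dg] := @data_hom n0 _ _ cB cA k' (fun w => f (map k' w)).
- by move=> x y /k'P[_ ex] /k'P[_ ey] e; rewrite ex ey e.
- move=> u su hu; rewrite -cobd_map hf ?size_map // => _ /mapP[x /hu/k'P[Sx _] ->].
  exact: Sx.
- by move=> y /k'P[].
have mapK w : (forall x, x \in w -> cS (c:=cA) x) -> map k' (map k w) = w.
  move=> hw; rewrite -map_comp -[RHS]map_id; apply/eq_in_map => x /hw Sx /=.
  exact: k'K.
have mapK' w : (forall x, x \in w -> cS (c:=cB) x) -> map k (map k' w) = w.
  move=> hw; rewrite -map_comp -[RHS]map_id; apply/eq_in_map => x /hw/k'P[_ e] /=.
  by rewrite -e.
exists g => s; split=> x.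
  have e1 : data cA cA (hom_comp h g) id (fun=> false).
    have dc := data_hom_comp d dg.
    apply: (data_ext dc) => [y Sy|w sw hw] /=.
      by rewrite k'K.
    by rewrite mapK // addbb.
  have e2 := @data_id n0 _ cA (idhom A) (fun s x => erefl).
  exact: (data_unique e1 e2).
have e1 : data cB cB (hom_comp g h) id (fun=> false).
  have dc := data_hom_comp dg d.
  apply: (data_ext dc) => [y /k'P[_ e] //|w sw hw] /=.
  by rewrite addbb.
have e2 := @data_id n0 _ cB (idhom B) (fun s x => erefl).
exact: (data_unique e1 e2).
Qed.

(** A labelling of the top that is coherent with the given one yields a labelling of [b]; coherence
    along an arbitrary inclusion is checked through the singleton of the part of a label. *)
Lemma extension_amalgamation m (b : functor T (P m))
  (c : forall s (h : s \in Pminus m), coord (restrict b s h)) (X : Type)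
  (q : X -> 'I_m) lam :
  labelling (c:=c) q lam -> (forall z, [set q z] \in Pminus m) ->
  forall (cT : coord (b setT (in_setT setT))) (lamT : X -> cO cT),
  (forall z, cS (lamT z)) -> (forall x, cS x -> exists z, lamT z = x) ->
  injective lamT ->
  (forall (s : {set 'I_m}) (hs : s \in Pminus m) k f,
     data (c s hs) cT (fmap b (in_setT s) (in_setT setT) (subsetT s)) k f ->
     forall z, q z \in s -> k (lam s hs z) = lamT z) ->
  amalgamation b.
Proof.
move=> [L1 L2 L3 L4] hq cT lamT LT1 LT2 LT3 LT4.
pose R (s : {set 'I_m}) (h : s \in P m) (cs : coord (b s h)) (ls : X -> cO cs) : Prop :=
  [/\ forall z, q z \in s -> cS (ls z),
      forall x, cS x -> exists2 z, q z \in s & ls z = x,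
      forall z z', q z \in s -> q z' \in s -> ls z = ls z' -> z = z' &
      forall (t : {set 'I_m}) (ht : t \in Pminus m) (i : t \subset s) k f,
        data (c t ht) cs (fmap b (in_setT t) h i) k f ->
        forall z, q z \in t -> k (lam t ht z) = ls z].
have ex (s : {set 'I_m}) (h : s \in P m) : exists cl : {cs : coord (b s h) & X -> cO cs},
    R s h (tag cl) (tagged cl).
  rewrite (Prop_irrelevance h (in_setT s)).
  have [hs|/full_of_notPminus es] := pselect (s \in Pminus m).
    exists (existT _ (c s hs : coord (b s (in_setT s))) (lam s hs)); split=> /=.
    + exact: L1.
    + exact: L2.
    + exact: L3.
    + by move=> t ht i k f d z; apply: L4 d z.
  subst s; exists (existT _ cT lamT); split=> //=.
  + by move=> x /LT2[z <-]; exists z; rewrite ?inE.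
  + by move=> z z' _ _; apply: LT3.
  + by move=> t ht i k f; rewrite (Prop_irrelevance i (subsetT t)); apply: LT4.
pose cc s h := tag (projT1 (cid (ex s h))).
pose ll s h := tagged (projT1 (cid (ex s h))).
have RR s h : R s h (cc s h) (ll s h) := projT2 (cid (ex s h)).
apply: (@labelling_amalgamation m (P m) (@P_down m) b cc X q ll); split.
- by move=> s h; have [] := RR s h.
- by move=> s h; have [] := RR s h.
- by move=> s h; have [] := RR s h.
move=> s t hs ht i k f d z qz.
have [_ _ _ Rs] := RR s hs; have [_ _ _ Rt] := RR t ht.
have is_ : [set q z] \subset s by rewrite sub1set.
have it_ := subset_trans is_ i.
have qq : q z \in [set q z] by rewrite inE.
have [ks [fs ds]] := data_ex (c _ (hq z)) (cc s hs) (fmap b (in_setT _) hs is_).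
have [kt [ft dt]] := data_ex (c _ (hq z)) (cc t ht) (fmap b (in_setT _) ht it_).
rewrite -(Rs _ _ _ _ _ ds z qq) -(Rt _ _ _ _ _ dt z qq).
have E o x := @fmap_comp _ _ _ _ b _ _ _ (in_setT [set q z]) hs ht is_ i it_ o x.
have [-> //] := data_fun dt (data_comp E ds d).
exact: L1.
Qed.

End Labels.

(** * Existence and uniqueness *)

Section Amalgamation.
Variable n0 : nat.
Local Notation n := n0.+2.
Local Notation T := (Tn n0).

Lemma sum_nat_fresh (X : eqType) (l : seq (X + nat)%type) : exists x, x \notin l.
Proof.
have inrI : injective (@inr X nat) by move=> x y [].
by have [y _ hy] := image_fresh (Om:=nat_inf) inrI l; exists y.
Qed.

(** The least s such that all of [w] lives in a(s). *)
Definition parts m (X : Type) (q : X -> 'I_m) (w : seq X) : {set 'I_m} :=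
  [set i | i \in map q w].

Lemma parts_sub m (X : eqType) (q : X -> 'I_m) (w : seq X) (s : {set 'I_m}) :
  parts q w \subset s <-> forall z, z \in w -> q z \in s.
Proof.
split=> [/subsetP h z zw|h]; first by apply: h; rewrite inE map_f.
by apply/subsetP => i; rewrite inE => /mapP[z zw ->]; apply: h.
Qed.

Lemma parts_proper m (X : eqType) (q : X -> 'I_m) (w : seq X) :
  (parts q w \in Pminus m) = ~~ meets (fun z => nat_of_ord (q z)) m w.
Proof.
rewrite PminusP; congr (~~ _); apply/eqP/idP => [e|/forallP h].
  apply/forallP => i; have : i \in parts q w by rewrite e inE.
  by rewrite inE => /mapP[z zw ->]; apply/hasP; exists z.
apply/setP => i; rewrite !inE; have /hasP[z zw /eqP e] := h i.
by apply/mapP; exists z => //; apply/val_inj.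
Qed.

Section Data.
Variables (m : nat) (D : {set {set 'I_m}}) (a : functor T D).
Variables (c : forall s (h : s \in D), coord (a s h)).
Variables (X : eqType) (q : X -> 'I_m).
Variable lam : forall s (h : s \in D), X -> cO (c h).
Hypothesis hlam : labelling (c:=c) q lam.

Lemma lam_seq_in (s : {set 'I_m}) (h : s \in D) (w : seq X) :
  (forall z, z \in w -> q z \in s) -> forall x, x \in map (lam h) w -> cS x.
Proof. by have [L1 _ _ _] := hlam; move=> hw x /mapP[z /hw qz ->]; apply: L1. Qed.

Lemma lam_onto (s : {set 'I_m}) (h : s \in D) (u : seq (cO (c h))) :
  (forall x, x \in u -> cS x) ->
  exists2 w, forall z, z \in w -> q z \in s & u = map (lam h) w.
Proof.
have [_ L2 _ _] := hlam; elim: u => [|x u IH] hu; first by exists [::].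
have [|w hw ->] := IH; first by move=> y yu; apply: hu; rewrite inE yu orbT.
have [|z qz <-] := L2 s h x; first exact/hu/mem_head.
by exists (z :: w) => // y; rewrite inE => /predU1P[->|/hw].
Qed.

Lemma lam_inverse (s : {set 'I_m}) (h : s \in D) : exists mu : cO (c h) -> option X,
  forall z, q z \in s -> mu (lam h z) = Some z.
Proof.
have [_ _ L3 _] := hlam.
exists (fun x => if pselect (exists2 z, q z \in s & lam h z = x) is left e
  then Some (projT1 (cid2 e)) else None) => z qz.
case: pselect => [e|[]]; last by exists z.
have := projT2 (cid2 e); case: (cid2 _) => z' qz' /= e' _.
by rewrite (L3 _ _ _ _ qz' qz e').
Qed.

Lemma label_hom (s : {set 'I_m}) (h : s \in D) (O : object T) (cT : coord O)
  (K : X -> cO cT) (G : seq X -> bool) :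
  (forall z z', q z \in s -> q z' \in s -> K z = K z' -> z = z') ->
  (forall z, q z \in s -> cS (K z)) -> cocycle_on n0 (fun z => q z \in s) G ->
  exists (f : hom (a s h) O) k g, [/\ data (c h) cT f k g,
    forall z, q z \in s -> k (lam h z) = K z &
    forall w, size w = n -> (forall z, z \in w -> q z \in s) ->
      g (map (lam h) w) = G w].
Proof.
move=> KI KS hG; have [mu muK] := lam_inverse h; have [L1 L2 L3 _] := hlam.
have [y0 _] := inf_fresh (i := cO cT) [::].
pose k x := if mu x is Some z then K z else y0.
have kE z : q z \in s -> k (lam h z) = K z by move=> qz; rewrite /k muK.
have pE w : (forall z, z \in w -> q z \in s) -> pmap mu (map (lam h) w) = w.
  elim: w => //= z w IH hw; rewrite muK ?hw ?mem_head //= IH // => y yw.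
  by apply: hw; rewrite inE yw orbT.
have [|||f df] := @data_hom n0 _ _ (c h) cT k (fun w => G (pmap mu w)).
- move=> _ _ /L2[z qz <-] /L2[z' qz' <-]; rewrite !kE //.
  by move=> /(KI _ _ qz qz') ->.
- move=> u su /lam_onto[w hw eu]; subst u; rewrite cobd_map.
  rewrite (@eq_cobd _ _ _ G) => [|v _ vw]; last first.
    by rewrite pE // => z /(mem_subseq vw)/hw.
  by apply: hG; rewrite ?size_map in su.
- by move=> _ /L2[z qz <-]; rewrite kE //; apply: KS.
by exists f, k, (fun w => G (pmap mu w)); split=> // w sw hw; rewrite pE.
Qed.

Lemma label_unique (s : {set 'I_m}) (h : s \in D) (O : object T) (cT : coord O)
  (f f' : hom (a s h) O) k g k' g' : data (c h) cT f k g -> data (c h) cT f' k' g' ->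
  (forall z, q z \in s -> k (lam h z) = k' (lam h z)) ->
  (forall w, size w = n -> (forall z, z \in w -> q z \in s) ->
     g (map (lam h) w) = g' (map (lam h) w)) ->
  forall o x, f o x = f' o x.
Proof.
move=> d d' ek eg; have [_ L2 _ _] := hlam; apply: data_unique d _; apply: data_ext d' _ _.
  by move=> x /L2[z qz <-]; rewrite ek.
move=> u su /lam_onto[w hw eu]; subst u; rewrite eg //.
by rewrite size_map in su.
Qed.

Lemma data_lam (s t : {set 'I_m}) hs ht (i : s \subset t) k f :
  data (c hs) (c ht) (fmap a hs ht i) k f ->
  forall w, (forall z, z \in w -> q z \in s) ->
  map k (map (lam hs) w) = map (lam ht) w.
Proof.
have [_ _ _ L4] := hlam; move=> d w hw; rewrite -map_comp.
by apply/eq_in_map => z /hw qz /=; apply: L4 d z qz.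
Qed.

(** The cocycles of all transition maps, rewritten on labels so that they can be compared.
    Functoriality becomes additivity. *)
Lemma transition_bits : exists F : {set 'I_m} -> {set 'I_m} -> seq X -> bool,
  forall (s t : {set 'I_m}) hs ht (i : s \subset t),
  [/\ cocycle_on n0 (fun z => q z \in s) (F s t),
      forall k f, data (c hs) (c ht) (fmap a hs ht i) k f ->
        forall w, size w = n -> (forall z, z \in w -> q z \in s) ->
        f (map (lam hs) w) = F s t w &
      forall (u : {set 'I_m}) (hu : u \in D) (j : t \subset u) w, size w = n ->
        (forall z, z \in w -> q z \in s) ->
        F s u w = F s t w (+) F t u w].
Proof.
have K (s t : {set 'I_m}) : exists F : seq X -> bool,
    forall hs ht (i : s \subset t) k f, data (c hs) (c ht) (fmap a hs ht i) k f ->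
      forall w, size w = n -> (forall z, z \in w -> q z \in s) ->
      f (map (lam hs) w) = F w.
  have [hs|ns] := pselect (s \in D); last by exists (fun=> false).
  have [ht|nt] := pselect (t \in D); last by exists (fun=> false).
  have [i|ni] := pselect (s \subset t); last by exists (fun=> false).
  have [k [f d]] := data_ex (c hs) (c ht) (fmap a hs ht i).
  exists (fun w => f (map (lam hs) w)) => hs' ht' i'.
  rewrite (Prop_irrelevance hs' hs) (Prop_irrelevance ht' ht) (Prop_irrelevance i' i).
  move=> k' f' d' w sw hw; have [_ e] := data_fun d' d.
  by apply: e; [rewrite size_map | apply: lam_seq_in].
exists (fun s t => projT1 (cid (K s t))) => s t hs ht i.
have FE s1 t1 := projT2 (cid (K s1 t1)).
split=> [u su hu|k f d w|u pu j w sw hw].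
- have [k [f d]] := data_ex (c hs) (c ht) (fmap a hs ht i).
  have [_ _ hf _] := d.
  rewrite -(hf (map (lam hs) u)) ?size_map //; last exact: lam_seq_in.
  rewrite cobd_map; apply: eq_cobd => w sw wu.
  rewrite (FE _ _ _ _ _ _ _ d) ?sw ?su // => z /(mem_subseq wu); exact: hu.
- exact: (FE s t hs ht i k f d w).
have [k1 [f1 d1]] := data_ex (c hs) (c ht) (fmap a hs ht i).
have [k2 [f2 d2]] := data_ex (c ht) (c pu) (fmap a ht pu j).
have ij := subset_trans i j.
have E o x := @fmap_comp _ _ _ _ a _ _ _ hs ht pu i j ij o x.
have d3 := data_comp E d1 d2.
rewrite -(FE _ _ _ _ _ _ _ d3 w sw hw) -(FE _ _ _ _ _ _ _ d1 w sw hw).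
rewrite -(FE _ _ _ _ _ _ _ d2 w sw) => [|z /hw]; last exact: (subsetP i).
by rewrite (data_lam d1 hw).
Qed.

End Data.

(** The equalities [eb] and [eO] are eliminated first, after which the maps into the top are
    literally those of the cocone. *)
Lemma cocone_amalgamation m (a : functor T (Pminus m))
  (c : forall s (h : s \in Pminus m), coord (a s h)) (X : Type)
  (q : X -> 'I_m) lam :
  labelling (c:=c) q lam -> (forall z, [set q z] \in Pminus m) ->
  forall (O : object T) (cT : coord O) (lamT : X -> cO cT),
  (forall z, cS (lamT z)) -> (forall x, cS x -> exists z, lamT z = x) ->
  injective lamT ->
  forall rho : forall s (h : s \in Pminus m), hom (a s h) O,
  (forall (s : {set 'I_m}) (hs : s \in Pminus m) k f, data (c s hs) cT (rho s hs) k f ->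
     forall z, q z \in s -> k (lam s hs z) = lamT z) ->
  forall (b : functor T (P m)) (eb : restrict b = a) (eO : b setT (in_setT setT) = O),
  (forall s (hs : s \in Pminus m) o x,
    hom_of_eq eO o (fmap b (in_setT s) (in_setT setT) (subsetT s) o x) =
    rho s hs o (hom_of_eq (fobj_eq eb hs) o x)) ->
  amalgamation b.
Proof.
move=> hlam hq O cT lamT h1 h2 h3 rho hrho b eb eO.
move: c lam rho hlam hrho; case: _ / eb => c lam rho hlam.
move: cT lamT h1 h2 h3 rho; case: _ / eO => cT lamT h1 h2 h3 rho hrho hb.
apply: (extension_amalgamation hlam hq h1 h2 h3) => s hs k f d z.
have E : rho s hs = fmap b (in_setT s) (in_setT setT) (subsetT s).
  by apply: hom_ext => o x; apply/esym; apply: (hb s hs).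
by apply: (hrho s hs k f); rewrite E.
Qed.

(** The excluded value is n+2. A cocone amounts to cocycles on the a(s) whose differences are the
    transition cocycles. The cochains [g0 s] have the right differences and a common coboundary
    [c0], itself a cocycle; a primitive [g] of [c0] turns them into the cocycles g0 s + g. *)
Lemma existence (m : nat) : m != n0.+4 -> has_existence T m.
Proof.
move=> mne a am.
pose c s (h : s \in Pminus m) : coord (a s h) := projT1 (cid (let: inhabits x := coord_ex (a s h) in
    ex_intro (fun _ => True) x Logic.I)).
have [lam hlam] := amalgamation_labelling (@Pminus_down m) c am.
pose X : eqType := {classic labels c}.
pose q : X -> 'I_m := @label_part _ _ _ a c.
have hq z : [set q z] \in Pminus m := label_in z.
have {}hlam : @labelling n0 m (Pminus m) a c X q lam := hlam.
have [L1 L2 L3 L4] := hlam.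
have [F hF] := transition_bits hlam.
(* The bits gained on the way from the least object containing [w] to a(s). *)
pose g0 (s : {set 'I_m}) (w : seq X) := F (parts q w) s w.
have qin (w : seq X) : forall z, z \in w -> q z \in parts q w.
  by move=> z zw; rewrite inE map_f.
have G (s t : {set 'I_m}) : s \subset t -> t \in Pminus m -> forall w, size w = n ->
    (forall z, z \in w -> q z \in s) -> F s t w = g0 s w (+) g0 t w.
  move=> st ht w sw hw; have hs := Pminus_down st ht.
  have ps : parts q w \subset s by apply/parts_sub.
  have hp := Pminus_down ps hs.
  have [_ _ FC] := hF _ s hp hs ps.
  by rewrite /g0 (FC t ht st w sw (qin w)) addKb.
pose c0 u := cobd u (g0 (parts q u)).
have c0E (s : {set 'I_m}) u : s \in Pminus m -> size u = n.+1 ->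
    (forall z, z \in u -> q z \in s) -> c0 u = cobd u (g0 s).
  move=> hs su hu; have ps : parts q u \subset s by apply/parts_sub.
  have hp := Pminus_down ps hs; have [FF _ _] := hF _ s hp hs ps.
  have := FF u su (qin u); rewrite (@eq_cobd _ _ _ (fun w =>
    g0 (parts q u) w (+) g0 s w)) => [|w sw wu]; last first.
    by apply: G => //; [rewrite sw su | move=> z /(mem_subseq wu)/qin].
  by rewrite cobd_add /c0; case: (cobd u _); case: (cobd u _).
have [||g hg] := @cocycle_bounds X m (fun z => nat_of_ord (q z))
  (fun z => ltn_ord (q z)) n c0.
- by rewrite eq_sym.
- move=> u su; rewrite -parts_proper => hp.
  rewrite (@eq_cobd _ _ _ (fun w => cobd w (g0 (parts q u)))) ?cobd_cobd //.
  move=> w sw wu; apply: c0E => //; first by rewrite sw su.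
  by move=> z /(mem_subseq wu)/qin.
have gP s w : s \in Pminus m -> size w = n.+1 -> (forall z, z \in w -> q z \in s) ->
    cobd w (fun v => g0 s v (+) g v) = false.
  move=> hs sw hw; rewrite cobd_add hg // -?c0E ?addbb // -parts_proper.
  by apply: Pminus_down hs; apply/parts_sub.
(* The summand nat makes the set of vertices infinite even when there are few labels. *)
pose Om := InfType (@sum_nat_fresh X).
pose O := mkobj n0 (fun y : Om => exists z, y = inl z).
pose cT : coord O := mkcoord n0 _.
have inlI (z z' : X) : (inl z : Om) = inl z' -> z = z' by case.
have R s (h : s \in Pminus m) : exists f : hom (a s h) O, exists k g', [/\ data (c s h) cT f k g',
    forall z, q z \in s -> k (lam s h z) = inl z &
    forall w, size w = n -> (forall z, z \in w -> q z \in s) ->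
      g' (map (lam s h) w) = g0 s w (+) g w].
  apply: (@label_hom m (Pminus m) a c X q lam hlam s h O cT inl
    (fun w => g0 s w (+) g w)) => [z z' _ _ /inlI //|z _|u su hu].
    by exists z.
  exact: gP.
pose rho s h := projT1 (cid (R s h)).
have rhoP s h := projT2 (cid (R s h)).
have nat_rho (s t : {set 'I_m}) hs ht (i : s \subset t) o x :
    rho t ht o (fmap a hs ht i o x) = rho s hs o x.
  have [k1 [f1 d1]] := data_ex (c s hs) (c t ht) (fmap a hs ht i).
  have [k2 [f2 [d2 k2E f2E]]] := rhoP t ht.
  have [k3 [f3 [d3 k3E f3E]]] := rhoP s hs.
  have dc := data_hom_comp d1 d2.
  suff E o' x' : hom_comp (fmap a hs ht i) (rho t ht) o' x' = rho s hs o' x' by exact: E.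
  apply: (label_unique hlam dc d3) => [z qz|w sw hw] /=.
    by rewrite (L4 _ _ _ _ _ _ _ d1) // k2E ?k3E //; apply: (subsetP i).
  have [_ FE _] := hF s t hs ht i.
  have hw' z : z \in w -> q z \in t by move=> /hw; apply: (subsetP i).
  rewrite (data_lam hlam d1 hw) (FE _ _ d1 _ sw hw) f2E // f3E // (G s t) //.
  by case: (g0 s w); case: (g0 t w); case: (g w).
have [b [eb [eO hb]]] := functor_extension nat_rho.
exists b; split=> //.
apply: (cocone_amalgamation hlam hq (cT := cT) (lamT := inl) _ _ _ _ hb).
- by move=> z; exists z.
- by move=> _ [z ->]; exists z.
- exact: inlI.
move=> s hs k f d z qz; have [k1 [f1 [d1 E _]]] := rhoP s hs.
by rewrite -E //; have [-> //] := data_fun d d1; apply: L1.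
Qed.


Lemma set1_Pminus m (i : 'I_m) : m != 1 -> [set i] \in Pminus m.
Proof.
move=> m1; rewrite PminusP; apply: contra_neq m1 => e.
by rewrite -[LHS]card_ord -cardsT -e cards1.
Qed.

Definition some_coord (A : object T) : coord A :=
  projT1 (cid (let: inhabits x := coord_ex A in ex_intro (fun _ => True) x Logic.I)).

(** The second excluded value is n+1. The two families of maps from the a(s) to the tops of [b] and
    [c] differ by a cocycle on the simplices missing a part. Extended to all simplices, it is the
    cocycle of the required isomorphism. *)
Lemma uniqueness (m : nat) : m != 1 -> m != n0.+3 -> has_uniqueness T m.
Proof.
move=> m1 mn a am b c eb ec amb amc.
move: ec am; case: _ / eb => ec am.
pose cb s (h : s \in P m) : coord (b s h) := some_coord (b s h).
pose cc s (h : s \in P m) : coord (c s h) := some_coord (c s h).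
have [lb hlb0] := amalgamation_labelling (@P_down m) cb amb.
pose X : eqType := {classic labels cb}.
pose q : X -> 'I_m := @label_part _ _ _ b cb.
have hlb : @labelling n0 m (P m) b cb X q lb := hlb0.
have [B1 B2 B3 B4] := hlb; clear hlb0.
have [lc hlc] := amalgamation_labelling (@P_down m) cc amc.
have [C1 C2 C3 C4] := hlc.
pose q' := @label_part _ _ _ c cc.
pose PT (s : {set 'I_m}) : s \in P m := in_setT s.
pose e s (hs : s \in Pminus m) : hom (b s (PT s)) (c s (PT s)) :=
  hom_of_eq (esym (fobj_eq ec hs)).
pose be s := fmap b (PT s) (PT setT) (subsetT s).
pose ga s := fmap c (PT s) (PT setT) (subsetT s).
pose rho s hs := hom_comp (e s hs) (ga s).
have e_nat (s t : {set 'I_m}) hs ht (i : s \subset t) o x :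
    e t ht o (fmap b (PT s) (PT t) i o x) = fmap c (PT s) (PT t) i o (e s hs o x).
  have /= E := @fmap_of_eq _ _ _ _ _ _ ec s t hs ht i o (e s hs o x).
  rewrite [X in fmap b _ _ _ _ X](_ : x = hom_of_eq (fobj_eq ec hs) o (e s hs o x)).
    by rewrite -[X in e _ _ _ X]E /e; apply: hom_of_eqK.
  by rewrite /e (hom_of_eqK (esym (fobj_eq ec hs))).
have rho_nat (s t : {set 'I_m}) hs ht (i : s \subset t) o x :
    rho s hs o x = rho t ht o (fmap b (PT s) (PT t) i o x).
  rewrite /= (e_nat _ _ hs ht).
  exact: (@fmap_comp _ _ _ _ c _ _ _ (PT s) (PT t) (PT setT) i (subsetT t)).
have be_nat (s t : {set 'I_m}) (i : s \subset t) o x :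
    be s o x = be t o (fmap b (PT s) (PT t) i o x).
  exact: (@fmap_comp _ _ _ _ b _ _ _ (PT s) (PT t) (PT setT) i (subsetT t)).
have KR s hs : exists kf, data (cb s (PT s)) (cc setT (PT setT)) (rho s hs) kf.1 kf.2.
  by have [k [f d]] := data_ex (cb s (PT s)) (cc setT (PT setT)) (rho s hs); exists (k, f).
have KB s : exists kf, data (cb s (PT s)) (cb setT (PT setT)) (be s) kf.1 kf.2.
  by have [k [f d]] := data_ex (cb s (PT s)) (cb setT (PT setT)) (be s); exists (k, f).
pose kr s hs := (projT1 (cid (KR s hs))).1; pose fr s hs := (projT1 (cid (KR s hs))).2.
have dr s hs : data _ _ (rho s hs) (kr s hs) (fr s hs) := projT2 (cid (KR s hs)).
pose kb s := (projT1 (cid (KB s))).1; pose fb s := (projT1 (cid (KB s))).2.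
have db s : data _ _ (be s) (kb s) (fb s) := projT2 (cid (KB s)).
pose hq z : [set q z] \in Pminus m := set1_Pminus (q z) m1.
(* The vertex of the top of [c] that corresponds to the label [z] of [b], reached through its
   singleton, a proper subset since m is not 1. *)
pose lt (z : X) := kr _ (hq z) (lb _ (PT _) z).
have qq z : q z \in [set q z] by rewrite inE.
have step (s t : {set 'I_m}) hs ht : s \subset t ->
    (forall z, q z \in s -> kr s hs (lb s (PT s) z) = kr t ht (lb t (PT t) z)) /\
    (forall w, size w = n -> (forall z, z \in w -> q z \in s) ->
      fb s (map (lb s (PT s)) w) (+) fr s hs (map (lb s (PT s)) w) =
      fb t (map (lb t (PT t)) w) (+) fr t ht (map (lb t (PT t)) w)).
  move=> i.
  have [k [f d]] := data_ex (cb s (PT s)) (cb t (PT t)) (fmap b (PT s) (PT t) i).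
  have [r1 r2] := data_fun (dr s hs) (data_comp (@rho_nat s t hs ht i) d (dr t ht)).
  have [_ b2] := data_fun (db s) (data_comp (@be_nat s t i) d (db t)).
  split=> [z qz|w sw hw].
    by rewrite r1 ?(B4 _ _ _ _ _ _ _ d) //; [rewrite /= (B4 _ _ _ _ _ _ _ d) | apply: B1].
  have hx := lam_seq_in hlb (h := PT s) hw.
  rewrite r2 ?size_map // b2 ?size_map // (data_lam hlb d hw).
  by case: (f _); case: (fb t _); case: (fr t ht _).
have ltE (s : {set 'I_m}) hs z : q z \in s -> kr s hs (lb s (PT s) z) = lt z.
  rewrite -sub1set => i; have [E _] := step _ _ (hq z) hs i.
  by rewrite -(E z (qq z)).
have ltS z : cS (lt z).
  by have [_ _ _] := dr _ (hq z); apply; apply: B1.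
have KE (s : {set 'I_m}) hs : exists kf, data (cb s (PT s)) (cc s (PT s)) (e s hs) kf.1 kf.2.
  by have [k [f d]] := data_ex (cb s (PT s)) (cc s (PT s)) (e s hs); exists (k, f).
(* By the labelling of [c], equal values of [lt] then come from the same part, which reduces
   injectivity to one singleton. *)
have ltC z : exists y, q' y = q z /\ lc setT (PT setT) y = lt z.
  have [[k f] /= d] := KE _ (hq z).
  have [_ _ _ kS] := d.
  have [y qy ey] := C2 _ _ _ (kS _ (B1 _ (PT _) z (qq z))).
  exists y; split; first by move: qy; rewrite inE => /eqP.
  have [k2 [f2 d2]] := data_ex (cc _ (PT [set q z])) (cc setT (PT setT)) (ga [set q z]).
  rewrite -(C4 _ _ _ _ _ _ _ d2 y qy) ey /lt.
  have [-> //] := data_fun (dr _ (hq z)) (data_hom_comp d d2).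
  exact: B1.
have ltI : injective lt.
  move=> z z' E; have [y [qy ey]] := ltC z; have [y' [qy' ey']] := ltC z'.
  have eyy : y = y' by apply: (C3 setT (PT setT)); rewrite ?inE // ey ey' E.
  have eq : q z = q z' by rewrite -qy -qy' eyy.
  have q2 : q z' \in [set q z] by rewrite eq inE.
  move: E; rewrite -(ltE _ (hq z) z' q2) /lt.
  have [_ kI _ _] := dr _ (hq z).
  move=> /kI E; apply: (B3 _ (PT [set q z])) => //; apply: E; exact: B1.
have ltO x : cS x -> exists z, lt z = x.
  (* A vertex of the top of [c] comes from a singleton, where the identification with [a] can be
     inverted to find the label of [b]. *)
  move=> /(C2 setT (PT setT))[y _ <-].
  pose t := [set q' y]; have ht : t \in Pminus m by apply: set1_Pminus.
  have qt : q' y \in t by rewrite inE.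
  have [k2 [f2 d2]] := data_ex (cc t (PT t)) (cc setT (PT setT)) (ga t).
  have [[k f] /= d] := KE _ ht.
  pose ei : hom (c t (PT t)) (b t (PT t)) := hom_of_eq (fobj_eq ec ht).
  have [ki [fi di]] := data_ex (cc t (PT t)) (cb t (PT t)) ei.
  have idc : data (cc t (PT t)) (cc t (PT t)) (hom_comp ei (e t ht)) id (fun=> false).
    by apply: data_id => s1 x1; rewrite /= /e hom_of_eqK.
  have [kk _] := data_fun idc (data_hom_comp di d).
  have Sy := C1 t (PT t) y qt.
  have [_ _ _ kiS] := di.
  have [z qz ez] := B2 t (PT t) _ (kiS _ Sy).
  exists z; rewrite -(ltE t ht z qz) ez -(C4 _ _ _ _ _ _ _ d2 y qt).
  have [-> /=] := data_fun (dr t ht) (data_hom_comp d d2).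
    by rewrite [in RHS](kk _ Sy).
  exact: kiS.
(* The difference between the two maps out of a(s). By [step] it depends on [w] alone, so it can be
   evaluated on the least s, which gives [phi]. *)
pose Phi s hs (w : seq X) := fb s (map (lb s (PT s)) w) (+) fr s hs (map (lb s (PT s)) w).
pose phi (w : seq X) := if pselect (parts q w \in Pminus m) is left h then Phi _ h w else false.
have qin (w : seq X) : forall z, z \in w -> q z \in parts q w.
  by move=> z zw; rewrite inE map_f.
have phiE (s : {set 'I_m}) hs w : size w = n -> (forall z, z \in w -> q z \in s) -> phi w = Phi s hs w.
  move=> sw hw; have ps : parts q w \subset s by apply/parts_sub.
  have hp := Pminus_down ps hs; rewrite /phi; case: pselect => // h.
  by have [_ E] := step _ _ h hs ps; apply: E => //; apply: qin.
have [||F [FF Fphi]] := @cocycle_extends X m (fun z => nat_of_ord (q z))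
  (fun z => ltn_ord (q z)) n phi.
- by rewrite eq_sym.
- move=> u su; rewrite -parts_proper => hp.
  rewrite (@eq_cobd X _ _ (Phi _ hp)) => [|w sw wu]; last first.
    apply: phiE; first by rewrite sw su.
    by move=> z /(mem_subseq wu)/qin.
  rewrite /Phi cobd_add -!cobd_map.
  have [_ _ h1 _] := dr _ hp; have [_ _ h2 _] := db (parts q u).
  have hx := lam_seq_in hlb (h := PT _) (@qin u).
  by rewrite h1 ?size_map // h2 ?size_map.
have [|||eta [k [g [d kE gE]]]] := @label_hom m (P m) b cb X q lb hlb setT (PT setT) _
  (cc setT (PT setT)) lt F.
- by move=> z z' _ _; apply: ltI.
- by move=> z _; apply: ltS.
- by move=> u su _; apply: FF.
apply: (@iso_over_intro _ _ _ _ _ _ _ _ eta).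
  apply: data_iso d _ => y /ltO[z <-].
  have qz : q z \in setT by rewrite inE.
  by exists (lb setT (PT setT) z); [apply: B1 | rewrite kE].
move=> s hs o x; rewrite hom_of_eq_id.
suff E o' x' : hom_comp (be s) eta o' x' = rho s hs o' x' by exact: E.
have dc := data_hom_comp (db s) d.
apply: (label_unique hlb dc (dr s hs)) => [z qz|w sw hw] /=.
  rewrite (B4 _ _ _ _ _ _ _ (db s)) // kE ?inE //.
  by rewrite (ltE s hs z qz).
rewrite (data_lam hlb (db s) hw) gE // => [|z _]; last by rewrite inE.
rewrite Fphi //; last first.
  by rewrite -parts_proper; apply: Pminus_down hs; apply/parts_sub.
by rewrite (phiE s hs) // addKb.
Qed.

End Amalgamation.

(** * Failure of existence and uniqueness *)

Lemma big_addb_count (X : eqType) (x0 : X) (p : pred X) (u : seq X) :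
  \big[addb/false]_(k < size u) p (nth x0 u k) = odd (count p u).
Proof.
elim: u => [|x u IH]; first by rewrite big_ord0.
by rewrite big_ord_recl /= IH oddD; case: (p x).
Qed.

(* Removing one entry of [u] leaves a permutation of [l] for no choice or for
   exactly two choices of the entry. *)
Lemma cobd_perm (X : eqType) (l u : seq X) : uniq l -> size u = (size l).+1 ->
  {subset u <= l} -> cobd u (fun w => perm_eq w l) = false.
Proof.
move=> ul su ul'; rewrite cobd_sum.
have x0 : X by case: u su {ul'} => [|x u].
have face_perm k : k < size u -> perm_eq u (nth x0 u k :: face k u).
  move=> ku; rewrite -{1}(cat_take_drop k u) (drop_nth x0 ku).
  by rewrite perm_sym -[_ :: face k u]cat1s /face perm_catCA cat1s.
have [[k0 [ku0 pk0]]|no] := pselect (exists k, k < size u /\ perm_eq (face k u) l);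
    last first.
  rewrite big1 // => k _; apply/negbTE/negP => pk; apply: no.
  by exists k; split.
pose x := nth x0 u k0.
have pu : perm_eq u (x :: l).
  by apply: perm_trans (face_perm _ ku0) _; rewrite perm_cons.
have E (k : 'I_(size u)) : perm_eq (face k u) l = (nth x0 u k == x).
  have p1 := face_perm k (ltn_ord k).
  apply/idP/eqP => [pk|e]; last first.
    by rewrite e in p1; rewrite -(perm_cons x) -(permPl p1).
  have p2 : perm_eq (x :: l) (nth x0 u k :: l).
    rewrite -(permPl pu); apply: perm_trans p1 _; by rewrite perm_cons.
  apply/eqP; apply: contraT => ne.
  have /permP/(_ (pred1 x)) := p2; rewrite /= eqxx (negbTE ne).
  by move/eqP; rewrite eqn_add2r.
rewrite (eq_bigr (fun k : 'I_(size u) => nth x0 u k == x)) => [|k _]; last exact: E.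
rewrite (big_addb_count x0 (pred1 x)) (permP pu) /= eqxx count_uniq_mem //.
have -> : x \in l by apply: ul'; apply: mem_nth.
by [].
Qed.

(* The cone from [o] over the indicator of the permutations of [o :: l]. *)
Lemma cobd_perm_cone (X : eqType) (o : X) (l u : seq X) : uniq (o :: l) ->
  size u = (size l).+1 -> {subset u <= o :: l} ->
  cobd u (fun w => perm_eq w l) = perm_eq u (o :: l).
Proof.
move=> ul su sul.
rewrite (@eq_cobd _ _ _ (fun w => perm_eq (o :: w) (o :: l))) => [|w _ _]; last first.
  by rewrite perm_cons.
rewrite (cobd_cone o u (fun w => perm_eq w (o :: l))) cobd_perm ?addbF //= ?su //.
by move=> x; rewrite inE => /predU1P[->|/sul //]; rewrite inE eqxx.
Qed.

Section Counterexamples.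
Variable n0 : nat.
Local Notation n := n0.+2.
Local Notation T := (Tn n0).

Section StandardFunctor.
Variables (m : nat) (D : {set {set 'I_m}}).
Hypothesis Ddown : forall s t : {set 'I_m}, s \subset t -> t \in D -> s \in D.

Definition vertices_of (s : {set 'I_m}) (x : nat) : Prop :=
  exists2 i : 'I_m, i \in s & x = i.

Variable f : {set 'I_m} -> {set 'I_m} -> seq nat -> bool.
Hypothesis f_coc : forall s t : {set 'I_m}, s \subset t -> t \in D ->
  cocycle_on n0 (vertices_of s) (f s t).
Hypothesis f_id : forall s w, f s s w = false.
Hypothesis f_comp : forall (s t u : {set 'I_m}) w, s \subset t -> t \subset u ->
  u \in D -> f s u w = f s t w (+) f t u w.

Definition std_obj (s : {set 'I_m}) : object T := mkobj n0 (Om := nat_inf) (vertices_of s).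
Definition std_coord (s : {set 'I_m}) : coord (std_obj s) :=
  mkcoord n0 (Om := nat_inf) (vertices_of s).

Lemma std_map_ex (s t : {set 'I_m}) : s \subset t -> t \in D ->
  exists h : hom (std_obj s) (std_obj t),
    data (std_coord s) (std_coord t) h id (f s t).
Proof.
move=> st ht; apply: data_hom => //; first exact: f_coc.
by move=> x [i si ->]; exists i => //; apply: (subsetP st).
Qed.

Definition std_map (s t : {set 'I_m}) (hs : s \in D) (ht : t \in D) (i : s \subset t) :
  hom (std_obj s) (std_obj t) := projT1 (cid (std_map_ex i ht)).

Lemma std_mapP (s t : {set 'I_m}) (hs : s \in D) (ht : t \in D) (i : s \subset t) :
  data (std_coord s) (std_coord t) (std_map hs ht i) id (f s t).
Proof. exact: (projT2 (cid (std_map_ex i ht))). Qed.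

Lemma std_map_id (s : {set 'I_m}) (hs : s \in D) (i : s \subset s) o
  (x : points (std_obj s) o) : std_map hs hs i o x = x.
Proof.
have d := @data_id n0 _ (std_coord s) (idhom _) (fun s x => erefl).
apply: (data_unique (h' := idhom _) _ d).
by apply: (data_ext (std_mapP hs hs i)) => // w _ _; apply: f_id.
Qed.

Lemma std_map_comp (s t u : {set 'I_m}) (hs : s \in D) (ht : t \in D) (hu : u \in D)
  (i : s \subset t) (j : t \subset u) (k : s \subset u) o
  (x : points (std_obj s) o) :
  std_map hs hu k o x = std_map ht hu j o (std_map hs ht i o x).
Proof.
have d := data_hom_comp (std_mapP hs ht i) (std_mapP ht hu j).
apply: (data_unique (h' := hom_comp _ _) (std_mapP hs hu k)).
by apply: (data_ext d) => // w _ _; rewrite map_id (f_comp w i j hu).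
Qed.

Definition std_functor : functor T D :=
  @Functor _ T m D (fun s _ => std_obj s) std_map std_map_id std_map_comp.

Lemma std_labelling : labelling (a := std_functor) (c := fun s _ => std_coord s)
  (id : 'I_m -> 'I_m) (fun s _ i => (i : nat)).
Proof.
split=> [s h z zs|s h x [i si ->]|s h z z' _ _ /val_inj //|s t hs ht i k g d z zs].
- by exists z.
- by exists i.
have [/(_ (z : nat)) E _] := data_fun d (std_mapP hs ht i).
by apply: E; exists z.
Qed.

Lemma std_amalgamation : amalgamation std_functor.
Proof. exact: labelling_amalgamation std_labelling. Qed.
End StandardFunctor.

Lemma vertices_of_sub m (s : {set 'I_m}) (w : seq nat) i : i < m ->
  (forall x, x \in w -> vertices_of s x) ->
  perm_eq w (i :: iota i.+1 (m - i.+1)) -> forall j : 'I_m, i <= j -> j \in s.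
Proof.
move=> im hw pw j ij.
have : (j : nat) \in w.
  rewrite (perm_mem pw) -/(iota i (m - i.+1).+1) mem_iota ij /=.
  by rewrite -subSn // subSS subnKC // ltnW.
by move=> /hw[j' sj' /val_inj ->].
Qed.

Lemma vertices_of_iota m (s : {set 'I_m}) (w : seq nat) : 0 < m ->
  (forall x, x \in w -> vertices_of s x) -> {subset w <= 0 :: iota 1 m.-1}.
Proof.
move=> m0 hw x /hw[i _ ->].
by rewrite -/(iota 0 m.-1.+1) prednK // mem_iota /= add0n.
Qed.

(** The problem has one vertex in each of n+1 parts and trivial transitions. The cochains 0 and
    [phi] are cocycles on every proper subset and give two solutions. An isomorphism would make
    [phi] a cocycle on all n+1 vertices, but its coboundary at (0, ..., n) is 1. *)
Lemma no_uniqueness : ~ has_uniqueness T n.+1.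
Proof.
pose m := n.+1; pose D := Pminus m.
pose F (s t : {set 'I_m}) (w : seq nat) := false.
have F1 (s t : {set 'I_m}) : s \subset t -> t \in D ->
    cocycle_on n0 (vertices_of s) (F s t) by move=> _ _ u _ _; apply: cobd0.
pose a := @std_functor m D F F1 (fun s w => erefl) (fun s t u w _ _ _ => erefl).
have am : amalgamation a by apply: std_amalgamation; apply: Pminus_down.
pose phi (w : seq nat) := perm_eq w (iota 1 n).
have phi_coc (s : {set 'I_m}) : s \in D -> cocycle_on n0 (vertices_of s) phi.
  (* The coboundary of [phi] is the indicator of the permutations of 0, ..., n, which involve every
     vertex and so lie in no proper subset. *)
  move=> hs u su hu; have := vertices_of_iota (isT : 0 < m) hu => /= su'.
  rewrite [LHS](cobd_perm_cone (o := 0)) ?size_iota //; last exact: (iota_uniq 0 n.+1).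
  apply/negbTE/negP => pu; move: hs; rewrite PminusP => /negP; apply.
  apply/eqP/setP => j; rewrite inE.
  apply: (@vertices_of_sub m s u 0) => //.
pose O := @std_obj m [set: 'I_m]; pose cO := @std_coord m [set: 'I_m].
have vT (s : {set 'I_m}) x : vertices_of s x -> vertices_of [set: 'I_m] x.
  by move=> [i _ ->]; exists i; rewrite ?inE.
have build (g : seq nat -> bool) : (forall s : {set 'I_m}, s \in D -> cocycle_on n0 (vertices_of s) g) ->
  exists (b : functor T (P m)) (eb : restrict b = a) (eO : b setT (in_setT setT) = O)
    (rho : forall s (h : s \in D), hom (a s h) O),
    [/\ amalgamation b, forall s h, data (@std_coord m s) cO (rho s h) id g &
      forall s (hs : s \in D) o x,
      hom_of_eq eO o (fmap b (in_setT s) (in_setT setT) (subsetT s) o x) =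
      rho s hs o (hom_of_eq (fobj_eq eb hs) o x)].
  move=> hg.
  have R s (h : s \in D) : exists h : hom (a s h) O, data (@std_coord m s) cO h id g.
    by apply: data_hom => //; [apply: hg | apply: vT].
  pose rho s h := projT1 (cid (R s h)).
  have rhoP s h : data (@std_coord m s) cO (rho s h) id g := projT2 (cid (R s h)).
  have rn (s t : {set 'I_m}) hs ht (i : s \subset t) o x :
      rho t ht o (fmap a hs ht i o x) = rho s hs o x.
    have d := data_hom_comp (std_mapP F1 hs ht i) (rhoP t ht).
    apply: (data_unique (h := hom_comp _ _) _ (rhoP s hs)).
    by apply: (data_ext d) => // w _ _; rewrite map_id.
  have [b [eb [eO hb]]] := functor_extension rn.
  exists b, eb, eO, rho; split=> //.
  apply: (cocone_amalgamation (std_labelling F1 (fun s w => erefl) (fun s t u w _ _ _ => erefl))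
    _ (cT := cO) (lamT := fun i : 'I_m => (i : nat)) _ _ _ _ hb).
  - by move=> z; apply: set1_Pminus.
  - by move=> z; exists z; rewrite ?inE.
  - by move=> x [i _ ->]; exists i.
  - exact: val_inj.
  move=> s hs k g' d z zs; have [E _] := data_fun d (rhoP s hs).
  by apply: E; exists z.
move=> U.
have [b [eb [eO [rho [amb rhoP rhoE]]]]] := build (fun=> false) (fun s _ u _ _ => cobd0 u).
have [c [ec [eO' [rho' [amc rhoP' rhoE']]]]] := build phi phi_coc.
have [eta etaP] := iso_over_top (U a am b c eb ec amb amc).
pose eta' := hom_comp (hom_of_eq (esym eO)) (hom_comp eta (hom_of_eq eO')).
have eta'P s (hs : s \in D) o x : eta' o (rho s hs o x) = rho' s hs o x.
  have := rhoE s hs o (hom_of_eq (esym (fobj_eq eb hs)) o x).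
  rewrite (hom_of_eqK (esym (fobj_eq eb hs))) => <-; rewrite /= (hom_of_eqK eO).
  rewrite (etaP s hs) (rhoE' s hs).
  by rewrite (hom_of_eqK (esym (fobj_eq eb hs))) (hom_of_eqK (esym (fobj_eq ec hs))).
have [k [g d]] := data_ex cO cO eta'.
have gphi s w : s \in D -> size w = n -> (forall x, x \in w -> vertices_of s x) ->
    g w = phi w.
  move=> hs sw hw.
  have dd := data_comp (fun o x => esym (eta'P s hs o x)) (rhoP s hs) d.
  have [_ E2] := data_fun (rhoP' s hs) dd.
  by rewrite E2 //= map_id.
have [_ _ hg _] := d.
have := hg (iota 0 n.+1) (size_iota _ _).
rewrite (@eq_cobd _ _ _ phi) => [|w sw wu]; last first.
  have sw' : size w = n by rewrite sw size_iota.
  (* A list of length n misses one of the n+1 vertices, so the value of [g] on it is prescribed. *)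
  pose s : {set 'I_m} := [set i : 'I_m | (i : nat) \in w].
  apply: (gphi s) => //.
    rewrite PminusP; apply/eqP => es.
    have : #|s| <= size w.
      rewrite cardE -(size_map val); apply: uniq_leq_size.
        by rewrite map_inj_uniq ?enum_uniq //; apply: val_inj.
      by move=> x /mapP[i]; rewrite mem_enum inE => hi ->.
    by rewrite es cardsT card_ord sw' ltnn.
  move=> x xw; have := mem_subseq wu xw; rewrite mem_iota /= add0n => xm.
  by exists (Ordinal xm); rewrite ?inE.
rewrite (cobd_perm_cone (o := 0)) ?size_iota ?perm_refl //; last exact: (iota_uniq 0 n.+1).
move=> H; suff: true = false by []; apply: H => x; rewrite mem_iota /= add0n => xm.
by exists (Ordinal xm); rewrite ?inE.
Qed.

(** There is one vertex in each of n+2 parts, and the transitions into the face [top] opposite to 0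
    are twisted by [h]. A cocone would yield a cochain on all n-tuples whose coboundary is the
    indicator of the permutations of 1, ..., n+1; but this indicator has coboundary 1 at (0, ...,
    n+1). *)
Lemma no_existence : ~ has_existence T n.+2.
Proof.
pose m := n.+2; pose D := Pminus m.
pose top : {set 'I_m} := [set i : 'I_m | 0 < i].
pose h (w : seq nat) := perm_eq w (iota 2 n).
pose F (s t : {set 'I_m}) (w : seq nat) := ((s == top) (+) (t == top)) && h w.
have hE (s : {set 'I_m}) u : s \subset top -> size u = n.+1 ->
    (forall x, x \in u -> vertices_of s x) -> cobd u h = perm_eq u (iota 1 n.+1).
  move=> st su hu; rewrite (cobd_perm_cone (o := 1)) ?size_iota //.
    exact: (iota_uniq 1 n.+1).
  move=> x /hu[i /(subsetP st) it ->]; have i0 : 0 < i by move: it; rewrite inE.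
  rewrite -/(iota 1 n.+1) mem_iota i0 /= add1n; exact: ltn_ord.
have full (s : {set 'I_m}) u : (forall x, x \in u -> vertices_of s x) ->
    perm_eq u (iota 1 n.+1) -> top \subset s.
  move=> hu pu; apply/subsetP => j; rewrite inE.
  exact: (@vertices_of_sub m s u 1).
have upper (s : {set 'I_m}) : s \in D -> top \subset s -> s = top.
  rewrite PminusP => sT ts; apply/eqP; rewrite eqEsubset ts andbT.
  apply/subsetP => i si; rewrite inE lt0n; apply: contra sT => /eqP i0.
  apply/eqP/setP => j; rewrite inE; have [j0|j0] := posnP j.
    by rewrite (_ : j = i) //; apply: val_inj; rewrite /= j0.
  by apply: (subsetP ts); rewrite inE.
(* On [top] the twist is not a cocycle, but its coboundary lives on simplices using all of [top],
   and these lie in no smaller s. *)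
have F1 (s t : {set 'I_m}) : s \subset t -> t \in D ->
    cocycle_on n0 (vertices_of s) (F s t).
  move=> st ht u su hu; rewrite /F.
  have [es|ns] := eqVneq s top.
    have -> : t = top by apply: upper => //; rewrite -es.
    by rewrite eqxx cobd0.
  have [et|nt] := eqVneq t top; last by rewrite cobd0.
  rewrite [LHS](hE s) //; last by rewrite -et.
  apply/negbTE/negP => /(full s u hu) ts; case/eqP: ns; apply/eqP.
  by rewrite eqEsubset ts -et st.
have F2 (s : {set 'I_m}) w : F s s w = false by rewrite /F addbb.
have F3 (s t u : {set 'I_m}) w : s \subset t -> t \subset u -> u \in D ->
    F s u w = F s t w (+) F t u w.
  by move=> _ _ _; rewrite /F; case: (h w); case: (s == top); case: (t == top); case: (u == top).
pose a := @std_functor m D F F1 F2 F3.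
have am : amalgamation a by apply: std_amalgamation; apply: Pminus_down.
move=> /(_ a am)[b [eb _]].
have [O [rho rhoE]] : exists O, exists rho : forall s (hs : s \in D), hom (a s hs) O,
    forall (s t : {set 'I_m}) hs ht (i : s \subset t) o x,
      rho s hs o x = rho t ht o (fmap a hs ht i o x).
  case: _ / eb; exists (b setT (in_setT setT)).
  exists (fun s _ => fmap b (in_setT s) (in_setT setT) (subsetT s)).
  by move=> s t hs ht i o x; apply: fmap_comp.
have cO := some_coord O.
have K s hs : exists kg, data (@std_coord m s) cO (rho s hs) kg.1 kg.2.
  by have [k [g d]] := data_ex (@std_coord m s) cO (rho s hs); exists (k, g).
pose g s hs := (projT1 (cid (K s hs))).2.
have dg s hs : data (@std_coord m s) cO (rho s hs) _ (g s hs) := projT2 (cid (K s hs)).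
have gF (s t : {set 'I_m}) hs ht : s \subset t -> forall w, size w = n ->
    (forall x, x \in w -> vertices_of s x) -> g s hs w = F s t w (+) g t ht w.
  move=> i w sw hw.
  have dd := data_comp (rhoE s t hs ht i) (std_mapP F1 hs ht i) (dg t ht).
  by have [_ ->] := data_fun (dg s hs) dd; rewrite ?map_id.
pose cl (w : seq nat) : {set 'I_m} := [set i : 'I_m | (i : nat) \in w].
have clP (w : seq nat) : size w <= n.+1 -> cl w \in D.
  move=> sw; rewrite PminusP; apply/eqP => es.
  have : #|cl w| <= size w.
    rewrite cardE -(size_map val); apply: uniq_leq_size.
      by rewrite map_inj_uniq ?enum_uniq //; apply: val_inj.
    by move=> x /mapP[i]; rewrite mem_enum inE => hi ->.
  by rewrite es cardsT card_ord => /leq_trans/(_ sw); rewrite ltnn.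
have clin (w : seq nat) : (forall x, x \in w -> x < m) ->
    forall x, x \in w -> vertices_of (cl w) x.
  by move=> hw x xw; exists (Ordinal (hw x xw)); rewrite ?inE.
(* Adding the twist at [top] makes the bits of the cocone independent of s, so they form a single
   cochain. *)
pose G w := if pselect (cl w \in D) is left hs then
  g _ hs w (+) ((cl w == top) && h w) else false.
have GE (s : {set 'I_m}) hs w : size w = n -> (forall x, x \in w -> vertices_of s x) ->
    G w = g s hs w (+) ((s == top) && h w).
  move=> sw hw.
  have wm x : x \in w -> x < m by move=> /hw[i _ ->]; apply: ltn_ord.
  have cs : cl w \subset s.
    by apply/subsetP => i; rewrite inE => /hw[j sj /val_inj ->].
  rewrite /G; case: pselect => [hs'|[]]; last by apply: clP; rewrite sw.
  rewrite (gF _ _ hs' hs cs) //; last exact: clin.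
  by rewrite /F; case: (h w); case: (cl w == top); case: (s == top); case: (g s hs w).
have cG u : size u = n.+1 -> (forall x, x \in u -> x < m) ->
    cobd u G = perm_eq u (iota 1 n.+1).
  move=> su um; have hs := clP u (eq_leq su); have hu := clin u um.
  rewrite (@eq_cobd _ _ _ (fun w => g _ hs w (+) ((cl u == top) && h w))) => [|w sw wu];
      last first.
    apply: GE; first by rewrite sw su.
    by move=> x /(mem_subseq wu)/hu.
  have [_ _ gc _] := dg _ hs.
  rewrite cobd_add gc //=.
  have [et|nt] := eqVneq (cl u) top; first by apply: (hE (cl u)); rewrite ?et // -et.
  rewrite cobd0; apply/esym/negbTE/negP => pu; case/eqP: nt; apply: upper => //.
  exact: full hu pu.
have := cobd_cobd (iota 0 n.+2) G.
rewrite (@eq_cobd _ _ _ (fun u => perm_eq u (iota 1 n.+1))) => [|u su uu]; last first.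
  apply: cG; first by rewrite su size_iota.
  by move=> x /(mem_subseq uu); rewrite mem_iota /= add0n.
rewrite (cobd_perm_cone (o := 0)) ?size_iota ?perm_refl //.
exact: (iota_uniq 0 n.+2).
Qed.

End Counterexamples.

(** * Stability *)

Definition unbounded (A : nat -> Prop) : Prop := forall N, exists2 x, N <= x & A x.

Lemma unbounded_color (K : finType) (A : nat -> Prop) (c : nat -> K) :
  unbounded A -> exists k, unbounded (fun x => A x /\ c x = k).
Proof.
move=> hA; apply: contrapT => no.
have H k : exists N, forall x, N <= x -> A x -> c x <> k.
  apply: contrapT => h; apply: no; exists k => N; apply: contrapT => h'.
  by apply: h; exists N => x Nx Ax cx; apply: h'; exists x.
pose f k := projT1 (cid (H k)).
have [x fx Ax] := hA (\max_k f k).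
apply: (projT2 (cid (H (c x))) x _ Ax erefl).
exact: leq_trans (leq_bigmax (F := f) (c x)) fx.
Qed.

(** Stability needs just three homogeneous indices. Fix x and an unbounded set joined to x in one
    colour k: either a pair inside has colour k, or k is no longer used there and the induction on
    the number of colours applies. *)
Lemma ramsey_triple (K : finType) (col : nat -> nat -> K) :
  exists i j l, [/\ i < j, j < l, col i j = col i l & col i l = col j l].
Proof.
suff H : forall d (C : {set K}) (A : nat -> Prop), #|C| <= d -> unbounded A ->
    (forall x y, A x -> A y -> x < y -> col x y \in C) ->
    exists i j l, [/\ i < j, j < l, col i j = col i l & col i l = col j l].
  apply: (H #|K| [set: K] (fun=> True)); first by rewrite cardsT.
    by move=> N; exists N.
  by move=> x y _ _ _; rewrite inE.
elim=> [|d IH] C A dC hA hC.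
  have [x _ Ax] := hA 0; have [y xy Ay] := hA x.+1.
  have := hC x y Ax Ay xy; move: dC; rewrite leqn0 cards_eq0 => /eqP ->.
  by rewrite inE.
have [x _ Ax] := hA 0.
have hB : unbounded (fun y => A y /\ x < y).
  by move=> N; have [y] := hA (maxn N x.+1); rewrite geq_max => /andP[Ny xy] Ay; exists y.
have [k hk] := unbounded_color (col x) hB.
have [[i [j [[[Ai xi] ci] [[Aj xj] cj] ij cij]]]|no] := pselect (exists i j,
  [/\ (A i /\ x < i) /\ col x i = k, (A j /\ x < j) /\ col x j = k, i < j & col i j = k]).
  by exists x, i, j; split=> //; rewrite cj ?ci ?cij.
apply: (IH (C :\ k) _ _ hk).
  have [kC|kC] := boolP (k \in C); first by rewrite -ltnS (leq_trans _ dC) // [in X in _ < X](cardsD1 k) kC.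
  have [y _ [[Ay xy] cy]] := hk 0.
  by have := hC x y Ax Ay xy; rewrite cy (negbTE kC).
move=> i j hi hj ij; rewrite !inE; apply/andP; split.
  by apply/eqP => e; apply: no; exists i, j.
by have [[Ai _] _] := hi; have [[Aj _] _] := hj; apply: hC.
Qed.

Section Stability.
Variable n0 : nat.
Local Notation n := n0.+2.
Local Notation cov := (cov n0).

(** The equality patterns make the exchange of the vertices of [v] and [w] a well-defined injection,
    and since the bits agree the zero cocycle will do. *)
Lemma swap_tuples (Om : inf_type) (I : finType) (v w : I -> cov Om) :
  (forall i, (v i).2 = (w i).2) ->
  (forall i i' j j', (vtx j (v i) == vtx j' (v i')) = (vtx j (w i) == vtx j' (w i'))) ->
  (forall i i' j j', (vtx j (v i) == vtx j' (w i')) = (vtx j (w i) == vtx j' (v i'))) ->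
  exists a : aut n0 Om, forall i, aut_act a (v i) = w i /\ aut_act a (w i) = v i.
Proof.
move=> hb hs hx.
pose V (z : I * 'I_n) := vtx z.2 (v z.1); pose W (z : I * 'I_n) := vtx z.2 (w z.1).
pose k x := if [pick z | V z == x] is Some z then W z
  else if [pick z | W z == x] is Some z then V z else x.
have sVW z z' : (V z == V z') = (W z == W z') by apply: hs.
have xVW z z' : (V z == W z') = (W z == V z') by apply: hx.
have kV z : k (V z) = W z.
  rewrite /k; case: pickP => [z'|/(_ z)]; last by rewrite eqxx.
  by rewrite sVW => /eqP.
have kW z : k (W z) = V z.
  rewrite /k; case: pickP => [z'|_]; first by rewrite xVW => /eqP.
  case: pickP => [z'|/(_ z)]; last by rewrite eqxx.
  by rewrite -sVW => /eqP.
pose l := [seq V z | z : I * 'I_n] ++ [seq W z | z : I * 'I_n].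
have lP x : x \in l -> (exists z, x = V z) \/ (exists z, x = W z).
  by rewrite mem_cat => /orP[] /imageP[z _ ->]; [left|right]; exists z.
have [|p [p' [pK p'K pk]]] := @perm_extension Om l k.
  move=> x y /lP[][z ->] /lP[][z' ->]; rewrite ?kV ?kW => /eqP e; apply/eqP.
  - by rewrite sVW.
  - by rewrite xVW.
  - by rewrite -xVW.
  - by rewrite -sVW.
exists (perm_aut n0 pK p'K) => i; split; apply: cov_ext => [j|] /=;
  rewrite ?addbF ?hb // vtx_amap /= pk.
- exact: (kV (i, j)).
- by rewrite mem_cat; apply/orP; left; apply/imageP; exists (i, j).
- exact: (kW (i, j)).
- by rewrite mem_cat; apply/orP; right; apply/imageP; exists (i, j).
Qed.

(** Among three homogeneous indices i < j < l an automorphism exchanges the i-th and the j-th pairs,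
    hence takes p(a_i, b_j) to p(a_j, b_i), against the order property. *)
Lemma Tn_stable : stable (Tn n0).
Proof.
move=> na nb g h p M hM [a [b hab]].
have [Om [u]] := model_std hM.
pose I : finType := ('I_na + 'I_nb)%type.
pose v (i : nat) (z : I) : cov Om :=
  match z with inl x => iso_inv u (a i x) | inr y => iso_inv u (b i y) end.
pose J : finType := (I * 'I_n)%type.
pose V i (z : J) := vtx z.2 (v i z.1).
pose self i : {ffun J * J -> bool} := [ffun z => V i z.1 == V i z.2].
pose cross i j : {ffun J * J -> bool} := [ffun z => V i z.1 == V j z.2].
pose bits i : {ffun I -> bool} := [ffun z => (v i z).2].
have [i [j [l [ij jl]]]] := ramsey_triple (fun i j =>
  (self i, self j, (bits i, bits j), cross i j)).
move=> [_ _ c1] [es3 eb3 c2].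
have S z z' : (V i z == V i z') = (V j z == V j z').
  by have /ffunP/(_ (z, z')) := es3; rewrite !ffunE.
have C1 z z' : (V i z == V j z') = (V i z == V l z').
  by have /ffunP/(_ (z, z')) := c1; rewrite !ffunE.
have C2 z z' : (V i z == V l z') = (V j z == V l z').
  by have /ffunP/(_ (z, z')) := c2; rewrite !ffunE.
have B z : (v i z).2 = (v j z).2.
  by have /ffunP/(_ z) := eb3; rewrite !ffunE.
(* The third index makes the cross pattern symmetric: by homogeneity V i z and V j z both equal V l
   z', so V j z = V j z', and the common self pattern gives V i z = V i z'. *)
have X z z' : V i z = V j z' -> V j z = V i z'.
  move=> /eqP e; have /eqP e1 := e.
  have /eqP e2 : V i z == V l z' by rewrite -C1.
  have /eqP e3 : V j z == V l z' by rewrite -C2 -C1.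
  have : V i z == V i z' by rewrite S e3 -e2 e1.
  by move=> /eqP <-; rewrite e3 e2.
have XX z z' : (V i z == V j z') = (V j z == V i z').
  by apply/eqP/eqP; [exact: X | move=> e; apply/esym/X].
have [||w hw] := @swap_tuples Om I (v i) (v j) B.
- by move=> z z' y y'; apply: (S (z, y) (z', y')).
- by move=> z z' y y'; apply: (XX (z, y) (z', y')).
have := iffRL (hab i j) ij.
have [K _] := sat_iso (iso_comp (iso_sym u) (iso_comp (aut_iso w) u)) p (ecat (a i) (b j)).
move=> /K; rewrite emap_ecat.
rewrite (_ : emap _ (a i) = a j); last first.
  by apply: env_ext => x; rewrite /emap /= [aut_act w _](hw (inl x)).1 iso_invK.
rewrite (_ : emap _ (b j) = b i); last first.
  by apply: env_ext => x; rewrite /emap /= [aut_act w _](hw (inr x)).2 iso_invK.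
by move=> /hab; rewrite ltnNge (ltnW ij).
Qed.
End Stability.

Unset Implicit Arguments.

(* The uniqueness clause leaves out k = 1, for which it cannot hold together
   with the failure of (n+1)-uniqueness. *)
Theorem theorem1p2 (n : nat) (hn : 2 <= n) :
  exists (L : language) (T : theory L),
    [/\ one_sorted L, complete T & stable T] /\
    [/\ forall k : nat, k <= n ->
          has_existence T k.+1 /\ (k <> 1 -> has_uniqueness T k),
        ~ has_existence T n.+2
      & ~ has_uniqueness T n.+1].

Proof.
case: n hn => [|[|n0]] // _.
exists (lang n0), (Tn n0); split.
  split; [by exists tt; case | exact: Tn_complete | exact: Tn_stable].
split; [move=> k kn | exact: no_existence | exact: no_uniqueness].
split=> [|/eqP k1].
  by apply: existence; rewrite eqSS ltn_eqF.
by apply: uniqueness => //; rewrite ltn_eqF.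
Qed.
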